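(* The operator $$\mathcal L f(s)=\frac1{is}\bigl(f(s+i)-f(s-i)\bigr),$$ defined on the domain $\mathcal H[w]$, is essentially self-adjoint in the Hilbert space of even functions on $\mathbb R$ with inner product $\langle f,g\rangle=\frac2\pi\int_{-\infty}^\infty f(s)\overline{g(s)}\,\frac{ds}{|\Gamma(is)|^2}$.
   Context: Here $w(s)=|\Gamma(is)|^{-2}=\frac1\pi s\sinh(\pi s)$ on $\mathbb R$. The Hilbert space consists of even functions $f(s)=f(-s)$ on $\mathbb R$ that are square integrable with respect to $|\Gamma(is)|^{-2}ds$ (equivalently, functions in $L^2(\mathbb R_+,|\Gamma(is)|^{-2}ds)$). The domain $\mathcal H[w]$ consists of even functions $f$ holomorphic in the closed strip $|\operatorname{Im}s|\le1$ (i.e. holomorphic in $|\operatorname{Im}s|<1+\delta$ for some $\delta>0$) such that, for some $\varepsilon>0$, $f(s)=O\bigl(|s|^{-1-\varepsilon}e^{-\pi|\operatorname{Re}s|/2}\bigr)$ as $|\operatorname{Re}s|\to\infty$ in this strip. *)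

(* Defs.v *)
From HB Require Import structures.
From mathcomp Require Import all_boot all_order all_algebra.
From mathcomp Require Import all_classical all_reals all_analysis.
From mathcomp Require Import complex.

Set Implicit Arguments.
Unset Strict Implicit.
Unset Printing Implicit Defensive.

Import Order.TTheory GRing.Theory Num.Theory.
Import numFieldNormedType.Exports.

Local Open Scope classical_set_scope.
Local Open Scope ring_scope.

Notation normc := ComplexField.Normc.normc.

(* Unbounded operators are represented by their graphs.  [H] is the set of
   vectors and [ip] a positive semi-definite hermitian form on [H], linear in
   the first variable; the Hilbert space is the quotient of [H] by the vectors
   of norm zero, so equality of vectors is [ip_eq]. *)
Section UnboundedOperators.
Context {R : realType} {V : lmodType R[i]}.
Variables (H : set V) (ip : V -> V -> R[i]).
Implicit Types (G : set (V * V)) (u v : V).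

Definition ip_norm u : R := Num.sqrt (complex.Re (ip u u)).

Definition ip_eq u v : Prop := ip_norm (u - v) = 0.

Definition is_linear_operator G : Prop :=
  [/\ G `<=` H `*` H,
      G (0, 0),
      (forall (a : R[i]) u v u' v',
         G (u, v) -> G (u', v') -> G (a *: u + u', a *: v + v')) &
      (forall u v u' v',
         G (u, v) -> G (u', v') -> ip_eq u u' -> ip_eq v v')].

Definition densely_defined G : Prop :=
  forall u, H u -> forall eps : R, 0 < eps ->
    exists f g, G (f, g) /\ ip_norm (u - f) < eps.

Definition symmetric_operator G : Prop :=
  forall u v u' v', G (u, v) -> G (u', v') -> ip v u' = ip u v'.

Definition graph_closure G : set (V * V) :=
  [set p | [/\ H p.1, H p.2 & forall eps : R, 0 < eps ->
    exists f g, [/\ G (f, g), ip_norm (p.1 - f) < eps &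
                    ip_norm (p.2 - g) < eps]]].

Definition graph_adjoint G : set (V * V) :=
  [set p | [/\ H p.1, H p.2 & forall f g, G (f, g) -> ip g p.1 = ip f p.2]].

Definition selfadjoint G : Prop :=
  [/\ is_linear_operator G, densely_defined G & graph_adjoint G = G].

Definition essentially_selfadjoint G : Prop :=
  [/\ is_linear_operator G, densely_defined G, symmetric_operator G &
      selfadjoint (graph_closure G)].

End UnboundedOperators.

Section DifferenceOperator.
Variable R : realType.
Local Notation mu := (@lebesgue_measure R).

(* |Gamma(i s)|^-2 = s sinh(pi s) / pi *)
Definition weight (s : R) : R :=
  pi^-1 * s * ((expR (pi * s) - expR (- (pi * s))) / 2).

Definition complex_measurable (f : R -> R[i]) : Prop :=
  measurable_fun setT (fun s => complex.Re (f s)) /\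
  measurable_fun setT (fun s => complex.Im (f s)).

Definition complex_integral (f : R -> R[i]) : R[i] :=
  Complex (\int[mu]_s complex.Re (f s)) (\int[mu]_s complex.Im (f s)).

Definition even_L2 : set (R -> R[i]) :=
  [set f | [/\ complex_measurable f,
               (forall s, f (- s) = f s) &
               (\int[mu]_s (normc (f s) ^+ 2 * weight s)%:E < +oo)%E]].

Definition even_L2_inner (f g : R -> R[i]) : R[i] :=
  (2 / pi)%:C%C *
  complex_integral (fun s => f s * (g s)^*%C * (weight s)%:C%C).

(* Holomorphic functions on the strip are total functions on [R[i]] whose
   values outside the strip are irrelevant.  [derivable f z 1] over the field
   [R[i]] is complex differentiability at [z]. *)
Definition domain_Hw : set (R[i] -> R[i]) :=
  [set f |
    (exists delta : R, 0 < delta /\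
       forall z : R[i], `|complex.Im z| < 1 + delta ->
         derivable (f : R[i]^o -> R[i]^o) z 1 /\ f (- z) = f z) /\
    (exists eps : R, 0 < eps /\ exists C M : R,
       forall z : R[i], `|complex.Im z| <= 1 -> M <= `|complex.Re z| ->
         normc (f z) <= C * (normc z `^ (- 1 - eps)
                             * expR (- (pi * `|complex.Re z| / 2))))].

Definition restrict_line (f : R[i] -> R[i]) : R -> R[i] := fun s => f s%:C%C.

(* At [s = 0] division by zero yields 0; a single point is negligible. *)
Definition opL (f : R[i] -> R[i]) : R -> R[i] :=
  fun s => ('i%C * s%:C%C)^-1 * (f (s%:C%C + 'i%C) - f (s%:C%C - 'i%C)).

Definition graph_L : set ((R -> R[i]) * (R -> R[i])) :=
  [set (restrict_line f, opL f) | f in domain_Hw].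

End DifferenceOperator.

(* Main.v *)
Require Import Defs.
From mathcomp Require Import all_boot all_order all_algebra.
From mathcomp Require Import all_classical all_reals all_analysis.
From mathcomp Require Import complex.
From mathcomp Require Import measurable_realfun ring lra.

(** Write [L] for the operator. Shifting the contour of integration across the
    strip by Goursat's theorem shows that [L] is symmetric, so it suffices that a
    vector [h] orthogonal to the range of [L - l], [l = i] or [l = -i], vanishes.
    For [t > 0] the function
      F_t(z) = (z cos(tz) sinh t - sin(tz) cosh t) / sinh(pi z)
    has removable singularities at [0], [i] and [-i] and decays exponentially in the
    strip, so it belongs to the domain, and on the real line
      L F_t(s) = 2 (sinh t)^2 sin(ts) / sinh(pi s).
    Put [P(t) = \int sin(ts) s conj(h(s)) ds]. Orthogonality to [(L - l) F_t] reads
      2 (sinh t)^2 P = l (P' sinh t - P cosh t),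
    so [P / sinh t] has constant modulus on [t > 0]; as [P] is bounded, [P = 0].
    Injectivity of the sine transform on odd integrable functions gives [h = 0].
    The latter is obtained from [\int_0^oo e^(-et) cos(tu) dt = e / (e^2 + u^2)] by
    integrating in the position parameter (an arctangent) and letting [e -> 0].
    Density of the domain follows from the same functions: [h] orthogonal to all the
    [F_t] gives [P' sinh t = P cosh t]. *)
Set Implicit Arguments.
Unset Strict Implicit.
Unset Printing Implicit Defensive.

Import Order.TTheory GRing.Theory Num.Theory.
Import numFieldNormedType.Exports.

Local Open Scope classical_set_scope.
Local Open Scope ring_scope.

(** * Essential self-adjointness from dense ranges *)

(** The symmetry rests on one fact: [weight s / s] is [sinh (pi s) / pi], which changes sign under
    [s -> s + i] and so matches the minus sign in [f (s + i) - f (s - i)]. The shape of F_t is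
    forced. Dividing by [sinh (pi z)] supplies the decay, but in the closed strip this function
    vanishes at 0, i and -i. Any linear combination of [z cos(tz)] and [sin(tz)] vanishes at 0; it
    vanishes at i and -i exactly when its coefficients are proportional to [sinh t] and [- cosh t].
    All uses of orthogonality share one identity. For [l = i] or [l = -i] the quantity P' sinh t - P
    cosh t is an imaginary multiple of P, and for the density of the domain it is zero; in each case
    the real part of conj(P) (P' sinh t - P cosh t) vanishes, and this alone makes the modulus of P
    / sinh t constant. No quotient space is formed: vectors are functions, and h = 0 always means
    that the norm of h is zero. The abstract part therefore works with approximation throughout. *)

Lemma quadratic_ge0_discr (R : realFieldType) (a b c : R) :
  (forall r, 0 <= r ^+ 2 * a + 2 * r * b + c) -> b ^+ 2 <= a * c.
Proof.
move=> q.
have c0 : 0 <= c by have := q 0; rewrite expr2 !(mul0r, mulr0) !add0r.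
have [aE|a0] := eqVneq a 0.
  move: q; rewrite aE => q.
  rewrite mul0r; have [->|b0] := eqVneq b 0; first by rewrite expr2 mul0r.
  (* At this point the affine function [2 * r * b + c] takes the value -1. *)
  have := q (- (c + 1) / (2 * b)).
  have -> : 2 * (- (c + 1) / (2 * b)) * b = - (c + 1) by field.
  by rewrite mulr0 => h; exfalso; lra.
have agt0 : 0 < a.
  rewrite lt_neqAle eq_sym a0 /= leNgt; apply/negP => an.
  (* Adding the values at [r] and [- r] removes the linear term, while [1 <= r] gives
     [r ^+ 2 * a <= r * a = a - c < - c]. *)
  pose r := c / - a + 1.
  have r1 : 1 <= r by rewrite lerDr divr_ge0 // oppr_ge0 ltW.
  have ra : r * a = - c + a by rewrite /r; field.
  have := q r; have := q (- r); rewrite sqrrN => h1 h2.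
  have : r ^+ 2 * a <= r * a by rewrite ler_nM2r // ler_eXnr.
  lra.
have := q (- b / a).
have -> : (- b / a) ^+ 2 * a + 2 * (- b / a) * b + c = (a * c - b ^+ 2) / a by field.
by rewrite pmulr_lge0 ?invr_gt0 // subr_ge0.
Qed.

Lemma ReD (R : realType) (x y : R[i]) :
  complex.Re (x + y) = complex.Re x + complex.Re y.
Proof. by case: x; case: y. Qed.

Lemma ReB (R : realType) (x y : R[i]) :
  complex.Re (x - y) = complex.Re x - complex.Re y.
Proof. by case: x; case: y. Qed.

Record semi_inner_product (R : realType) (V : lmodType R[i]) (H : set V)
    (ip : V -> V -> R[i]) : Prop := SemiInnerProduct_ {
  sh_0 : H 0;
  sh_lin : forall a u v, H u -> H v -> H (a *: u + v);
  sh_linl : forall a u v w, H u -> H v -> H w ->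
    ip (a *: u + v) w = a * ip u w + ip v w;
  sh_conj : forall u v, H u -> H v -> ip u v = (ip v u)^*%C;
  sh_ge0 : forall u, H u -> 0 <= complex.Re (ip u u) }.

(** Geometric steps are enough: minimizing sequences can be chosen with such steps, and in the
    weighted space they make the successive differences summable almost everywhere. *)
Definition ip_complete (R : realType) (V : lmodType R[i]) (H : set V)
    (ip : V -> V -> R[i]) : Prop :=
  forall f : nat -> V, (forall n, H (f n)) ->
    (forall n, ip_norm ip (f n.+1 - f n) <= 2^-1 ^+ n) ->
    exists2 p, H p & forall eps : R, 0 < eps ->
      exists n0, forall n, (n0 <= n)%N -> ip_norm ip (f n - p) < eps.

Section SemiInnerProduct.
Context {R : realType} {V : lmodType R[i]}.
Variables (H : set V) (ip : V -> V -> R[i]).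
Hypothesis sh : semi_inner_product H ip.
Implicit Types (u v w : V) (a : R[i]) (r : R).
Local Notation B u v := (complex.Re (ip u v)).
Local Notation N := (ip_norm ip).

Lemma shZ a u : H u -> H (a *: u).
Proof. by move=> Hu; rewrite -[_ *: _]addr0; exact: (sh_lin sh _ Hu (sh_0 sh)). Qed.
Lemma shD u v : H u -> H v -> H (u + v).
Proof. by move=> Hu Hv; rewrite -[u]scale1r; apply: (sh_lin sh). Qed.
Lemma shB u v : H u -> H v -> H (u - v).
Proof. by move=> Hu Hv; rewrite addrC -scaleN1r; apply: (sh_lin sh). Qed.

Lemma ip0l w : H w -> ip 0 w = 0.
Proof.
move=> Hw; have h0 := sh_0 sh.
have := sh_linl sh 1 h0 h0 Hw; rewrite scale1r addr0 mul1r => /eqP.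
by rewrite -subr_eq subrr eq_sym => /eqP.
Qed.

Lemma ipZl a u w : H u -> H w -> ip (a *: u) w = a * ip u w.
Proof.
by move=> Hu Hw; rewrite -[a *: u]addr0 (sh_linl sh) // ?ip0l ?addr0 //; exact: (sh_0 sh).
Qed.

Lemma ipDl u v w : H u -> H v -> H w -> ip (u + v) w = ip u w + ip v w.
Proof. by move=> *; rewrite -{1}[u]scale1r (sh_linl sh) // mul1r. Qed.

Lemma ipBl u v w : H u -> H v -> H w -> ip (u - v) w = ip u w - ip v w.
Proof. by move=> *; rewrite addrC -scaleN1r (sh_linl sh) // mulN1r addrC. Qed.

Lemma ipDr u v w : H u -> H v -> H w -> ip w (u + v) = ip w u + ip w v.
Proof.
move=> Hu Hv Hw; have Hs := shD Hu Hv.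
by rewrite (sh_conj sh Hw Hs) (sh_conj sh Hw Hu) (sh_conj sh Hw Hv) ipDl // rmorphD.
Qed.

Lemma ipBr u v w : H u -> H v -> H w -> ip w (u - v) = ip w u - ip w v.
Proof.
move=> Hu Hv Hw; have Hs := shB Hu Hv.
by rewrite (sh_conj sh Hw Hs) (sh_conj sh Hw Hu) (sh_conj sh Hw Hv) ipBl // rmorphB.
Qed.

Lemma ipZr a u w : H u -> H w -> ip w (a *: u) = a^*%C * ip w u.
Proof.
move=> Hu Hw; have Hs := shZ a Hu.
by rewrite (sh_conj sh Hw Hs) (sh_conj sh Hw Hu) ipZl // rmorphM.
Qed.

Lemma reipC u v : H u -> H v -> B u v = B v u.
Proof. by move=> Hu Hv; rewrite (sh_conj sh) //; case: (ip v u). Qed.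

Lemma reipZi u v : H u -> H v -> B ('i%C *: u) v = - complex.Im (ip u v).
Proof. by move=> Hu Hv; rewrite ipZl //; case: (ip u v) => x y /=; rewrite mul0r mul1r sub0r. Qed.

Lemma ip_normE u : H u -> N u ^+ 2 = B u u.
Proof. by move=> Hu; rewrite /ip_norm sqr_sqrtr // (sh_ge0 sh). Qed.

Lemma ip_norm_ge0 u : 0 <= N u. Proof. exact: sqrtr_ge0. Qed.

Lemma reip_quadratic r u v : H u -> H v ->
  B (r%:C%C *: u + v) (r%:C%C *: u + v) = r ^+ 2 * B u u + 2 * r * B u v + B v v.
Proof.
move=> Hu Hv; have Hz := shZ r%:C%C Hu.
have Hs := shD Hz Hv.
rewrite ipDl // !ipDr // !ipZl // !ipZr //.
have := reipC Hv Hu; case: (ip v u) => x y; case: (ip u v) => x' y'.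
case: (ip u u) => s t; case: (ip v v) => z w /= ->; ring.
Qed.

Lemma reipZZ r u v : H u -> H v ->
  B (r%:C%C *: u) (r%:C%C *: v) = r ^+ 2 * B u v.
Proof.
move=> Hu Hv; have Hz := shZ r%:C%C Hv.
by rewrite ipZl // ipZr //; case: (ip u v) => x y /=; ring.
Qed.

Lemma cauchy_schwarz u v : H u -> H v -> `|B u v| <= N u * N v.
Proof.
move=> Hu Hv; rewrite -ler_sqr ?nnegrE ?mulr_ge0 ?ip_norm_ge0 //.
rewrite real_normK ?num_real // exprMn !ip_normE //.
by apply: quadratic_ge0_discr => r; rewrite -reip_quadratic // (sh_ge0 sh) //; apply: (sh_lin sh).
Qed.

Lemma ip_normZ_i u : H u -> N ('i%C *: u) = N u.
Proof.
move=> Hu; have Hz := shZ 'i%C Hu; rewrite /ip_norm ipZl // ipZr //; case: (ip u u) => x y /=.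
by congr Num.sqrt; ring.
Qed.

Lemma ip_normN u : H u -> N (- u) = N u.
Proof.
move=> Hu; have Hz := shZ (-1) Hu; rewrite -scaleN1r /ip_norm ipZl // ipZr //; case: (ip u u) => x y /=.
by congr Num.sqrt; ring.
Qed.

Lemma ip_normBC u v : H u -> H v -> N (u - v) = N (v - u).
Proof. by move=> Hu Hv; rewrite -opprB ip_normN //; apply: shB. Qed.

Lemma ip_norm0 : N 0 = 0.
Proof. by rewrite /ip_norm ip0l ?Num.Theory.sqrtr0 //; exact: (sh_0 sh). Qed.

Lemma ip_normD u v : H u -> H v -> N (u + v) <= N u + N v.
Proof.
move=> Hu Hv; rewrite -ler_sqr ?nnegrE ?addr_ge0 ?ip_norm_ge0 //.
have Hs := shD Hu Hv; have := reip_quadratic 1 Hu Hv.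
rewrite rmorph1 scale1r sqrrD !ip_normE // => ->.
have := cauchy_schwarz Hu Hv; have := ler_norm (B u v); lra.
Qed.

Lemma ip_normB u v : H u -> H v -> N (u - v) <= N u + N v.
Proof.
move=> Hu Hv; rewrite -scaleN1r -[N v]ip_normN // -scaleN1r; apply: ip_normD => //.
exact: shZ.
Qed.

Lemma ip_norm_tri w u v : H u -> H v -> H w -> N (u - v) <= N (u - w) + N (w - v).
Proof.
move=> Hu Hv Hw; rewrite -[u in X in X <= _](subrK w) -addrA.
by apply: ip_normD; apply: shB.
Qed.

Lemma ip_normZ a u : H u -> N (a *: u) = normc a * N u.
Proof.
move=> Hu; have Hz := shZ a Hu; rewrite /ip_norm ipZl // ipZr // mulrA -sqr_normc normc_def.
case: a {Hz} => p q /=; rewrite -Num.Theory.sqrtrM ?addr_ge0 ?sqr_ge0 //; congr Num.sqrt.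
case: (ip u u) => x y /=; rewrite !(mul0r, mulr0, oppr0, subr0, addr0, mul0r).
by rewrite -expr2 sqr_sqrtr ?addr_ge0 ?sqr_ge0.
Qed.

Lemma ip_eq0_re u v : H u -> H v -> B u v = 0 -> B ('i%C *: u) v = 0 -> ip u v = 0.
Proof.
move=> Hu Hv; rewrite reipZi //; case: (ip u v) => x y /= -> /eqP.
by rewrite oppr_eq0 => /eqP ->.
Qed.

Lemma ip_null u v : H u -> H v -> N v = 0 -> ip u v = 0.
Proof.
move=> Hu Hv v0; have h w : H w -> B w v = 0.
  move=> Hw; apply/eqP; rewrite -normr_le0; apply: le_trans (cauchy_schwarz Hw Hv) _.
  by rewrite v0 mulr0.
by apply: ip_eq0_re => //; apply: h => //; apply: shZ.
Qed.

Lemma le0_eps (x : R) (c : R) : 0 <= c -> (forall e, 0 < e -> x <= c * e) -> x <= 0.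
Proof.
move=> c0 h; rewrite leNgt; apply/negP => x0.
have := h (x / (2 * (c + 1))) ltac:(by rewrite divr_gt0 //; lra).
rewrite leNgt => /negP; apply.
rewrite mulrA ltr_pdivrMr; nra.
Qed.

Lemma half_pow_small (e : R) : 0 < e -> exists n : nat, 2^-1 ^+ n < e.
Proof.
move=> e0.
have : (fun n => (2^-1 : R) ^+ n) @ \oo --> (0:R).
  by apply: cvg_expr; rewrite ger0_norm ?invr_ge0 ?ler0n // invf_lt1 ?ltr1n.
move/cvgrPdist_lt => /(_ _ e0) [n _ /(_ n (leqnn n))]; rewrite sub0r normrN.
by rewrite ger0_norm ?exprn_ge0 ?invr_ge0 ?ler0n // => ?; exists n.
Qed.

Hypothesis shc : ip_complete H ip.

(** Orthogonal projection without a closed subspace: a sequence in [S] minimizing the distance to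
    [u] converges to some [p] in [H], and [u - p] is orthogonal to [S], hence of norm zero. The
    approximants of [u] are the terms of the sequence; [p] itself may lie outside [S]. *)
Lemma dense_of_orthogonal (S : set V) : S `<=` H -> S 0 ->
  (forall a u v, S u -> S v -> S (a *: u + v)) ->
  (forall h, H h -> (forall f, S f -> ip f h = 0) -> N h = 0) ->
  forall u, H u -> forall eps : R, 0 < eps -> exists2 f, S f & N (u - f) < eps.
Proof.
move=> SH S0 Slin Sorth u Hu eps eps0.
pose E := [set B (u - f) (u - f) | f in S].
have E0 : has_inf E.
  split; first by exists (B (u - 0) (u - 0)), 0.
  by exists 0 => _ [f Sf <-]; apply: (sh_ge0 sh); apply: shB => //; apply: SH.
pose d := inf E.
have dle f : S f -> d <= B (u - f) (u - f).
  by move=> Sf; apply: ge_inf => //; [case: E0|exists f].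
(* The tolerance is tuned to the parallelogram law, which then bounds the square of the n-th step by
   [(1/2 + 1/8) * 4^-n]. *)
have ex n : exists f, S f /\ B (u - f) (u - f) < d + 4^-1 * (2^-1 ^+ n) ^+ 2.
  have e0 : 0 < 4^-1 * (2^-1 ^+ n) ^+ 2 :> R by rewrite mulr_gt0 ?invr_gt0 ?exprn_gt0 ?invr_gt0.
  by have [_ [f Sf <-] fd] := inf_adherent e0 E0; exists f.
have {ex} [f fP] := choice ex.
have Sf n : S (f n) by case: (fP n).
have Hf n : H (f n) by apply: SH.
have fd n : B (u - f n) (u - f n) < d + 4^-1 * (2^-1 ^+ n) ^+ 2 by case: (fP n).
have Hd n : H (u - f n) by apply: shB.
have cau n : N (f n.+1 - f n) <= 2^-1 ^+ n.
  rewrite -ler_sqr ?nnegrE ?ip_norm_ge0 ?exprn_ge0 ?invr_ge0 ?ler0n //.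
  rewrite ip_normE; last exact: shB.
  have -> : f n.+1 - f n = (-1)%:C%C *: (u - f n.+1) + (u - f n).
    by rewrite rmorphN1 scaleN1r opprB addrA subrK.
  (* The midpoint of two terms stays in [S], so it is no closer to [u] than the infimum allows; the
     parallelogram law turns this into a bound on the step. *)
  have mid : d <= B (u - (2^-1 *: f n.+1 + 2^-1 *: f n)) (u - (2^-1 *: f n.+1 + 2^-1 *: f n)).
    by apply: dle; apply: (Slin) => //; rewrite -[_ *: _]addr0; apply: (Slin).
  have e2 : (2^-1)%:C%C = 2^-1 :> R[i] by rewrite fmorphV rmorphMn rmorph1.
  have := reip_quadratic 1 (shZ 2^-1 (Hd n.+1)) (shZ 2^-1 (Hd n)).
  have -> : 1%:C%C *: (2^-1 *: (u - f n.+1)) + 2^-1 *: (u - f n) =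
      u - (2^-1 *: f n.+1 + 2^-1 *: f n).
    rewrite rmorph1 scale1r !scalerBr addrACA -scalerDl -opprD.
    have -> : 2^-1 + 2^-1 = 1 :> R[i] by field.
    by rewrite scale1r.
  rewrite reip_quadratic // -e2 !reipZZ //.
  move: mid (fd n) (fd n.+1); rewrite -e2 [_ ^+ n.+1]exprSr exprMn.
  have := sqr_ge0 ((2^-1 : R) ^+ n); lra.
have [p Hp pf] := shc Hf cau.
have Hup : H (u - p) by apply: shB.
have orth g : S g -> B g (u - p) = 0.
  move=> Sg; have Hg := SH _ Sg.
  (* Moving [f n] along [g] stays in [S], so the squared distance to [u], a quadratic in [r], never
     drops below [d]; its discriminant gives the bound. *)
  have est n : `|B g (u - f n)| <= N g * (2^-1 ^+ n).
    rewrite -ler_sqr ?nnegrE ?mulr_ge0 ?ip_norm_ge0 ?exprn_ge0 ?invr_ge0 ?ler0n //.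
    rewrite real_normK ?num_real // exprMn ip_normE //.
    apply: quadratic_ge0_discr => r.
    have : d <= B (u - ((- r%:C%C) *: g + f n)) (u - ((- r%:C%C) *: g + f n)).
      by apply: dle; apply: (Slin).
    have -> : u - ((- r%:C%C) *: g + f n) = r%:C%C *: g + (u - f n).
      by rewrite opprD scaleNr opprK addrCA.
    rewrite reip_quadratic //; have := fd n.
    have := sqr_ge0 ((2^-1 : R) ^+ n); lra.
  apply/eqP; rewrite -normr_le0; apply: (@le0_eps _ (2 * N g)).
    by rewrite mulr_ge0 ?ip_norm_ge0.
  move=> e e0; have [n1 h1] := half_pow_small e0.
  have [n2 h2] := pf _ e0.
  have h1' : (2^-1 : R) ^+ maxn n1 n2 < e.
    apply: le_lt_trans h1; rewrite ler_wiXn2l ?invr_ge0 ?ler0n ?invf_le1 ?ler1n //.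
    exact: leq_maxl.
  have {}h2 := h2 _ (leq_maxr n1 n2).
  set n := maxn n1 n2 in h1' h2.
  have -> : u - p = (u - f n) + (f n - p) by rewrite addrA subrK.
  have Hfp := shB (Hf n) Hp; rewrite ipDr // ReD.
  apply: le_trans (ler_normD _ _) _.
  have := est n; have := cauchy_schwarz Hg Hfp.
  have := ip_norm_ge0 g; nra.
have up0 : N (u - p) = 0.
  apply: Sorth => // g Sg; apply: ip_eq0_re => //; [exact: SH|exact: orth|].
  by apply: orth; rewrite -[_ *: _]addr0; apply: (Slin).
have [n /(_ n (leqnn n)) fn] := pf _ eps0.
exists (f n) => //.
apply: le_lt_trans (ip_norm_tri Hu (Hf n) Hp) _.
by rewrite up0 add0r ip_normBC.
Qed.

(** * Symmetric operators whose defect ranges are dense *)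

Section EssentialSelfAdjointness.
Variable G : set (V * V).
Hypothesis GH : G `<=` H `*` H.
Hypothesis G0 : G (0, 0).
Hypothesis Glin : forall a u v u' v',
  G (u, v) -> G (u', v') -> G (a *: u + u', a *: v + v').
Hypothesis Gsym : symmetric_operator ip G.
Hypothesis Gdense : forall h, H h ->
  (forall f g, G (f, g) -> ip f h = 0) -> N h = 0.
Hypothesis Gdefect : forall l : R[i], l = 'i%C \/ l = - 'i%C -> forall h, H h ->
  (forall f g, G (f, g) -> ip (g - l *: f) h = 0) -> N h = 0.

Let GHl u v : G (u, v) -> H u. Proof. by move=> /GH []. Qed.
Let GHr u v : G (u, v) -> H v. Proof. by move=> /GH []. Qed.

Lemma domain_dense u : H u -> forall eps : R, 0 < eps ->
  exists f g, G (f, g) /\ N (u - f) < eps.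
Proof.
move=> Hu eps e0.
have [||||f [g Gfg] ufe] := @dense_of_orthogonal [set f | exists g, G (f, g)] _ _ _ _ u Hu eps e0.
- by move=> f [g /GHl].
- by exists 0.
- by move=> a v w [v' Gv] [w' Gw]; exists (a *: v' + w'); apply: Glin.
- by move=> h Hh ho; apply: Gdense => // f g Gfg; apply: ho; exists g.
- by exists f, g.
Qed.

Lemma defect_range_dense l u : l = 'i%C \/ l = - 'i%C -> H u ->
  forall eps : R, 0 < eps -> exists f g, G (f, g) /\ N (u - (g - l *: f)) < eps.
Proof.
move=> li Hu eps e0.
have [||||_ [f [g [Gfg ->]]] ufe] :=
  @dense_of_orthogonal [set w | exists f g, G (f, g) /\ w = g - l *: f] _ _ _ _ u Hu eps e0.
- by move=> _ [f [g [Gfg ->]]]; apply: shB; [exact: GHr Gfg|exact: shZ (GHl Gfg)].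
- by exists 0, 0; rewrite scaler0 subr0.
- move=> a _ _ [f [g [Gfg ->]]] [f' [g' [Gfg' ->]]].
  exists (a *: f + f'), (a *: g + g'); split; first exact: Glin.
  by rewrite scalerBr scalerDr !scalerA [l * a]mulrC addrACA opprD.
- move=> h Hh ho; apply: (Gdefect li) => // f g Gfg; apply: ho.
  by exists f, g.
- by exists f, g.
Qed.

Lemma graph_sub_adjoint : G `<=` graph_adjoint H ip G.
Proof.
move=> [u v] Guv; split=> //=; [exact: GHl Guv|exact: GHr Guv|].
by move=> f g Gfg; apply: Gsym Gfg Guv.
Qed.

Lemma graph_sub_closure : G `<=` graph_closure H ip G.
Proof.
move=> [u v] Guv; split=> //=; [exact: GHl Guv|exact: GHr Guv|].
by move=> e e0; exists u, v; rewrite !subrr ip_norm0.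
Qed.

Lemma adjoint_lin a u v u' v' : graph_adjoint H ip G (u, v) ->
  graph_adjoint H ip G (u', v') ->
  graph_adjoint H ip G (a *: u + u', a *: v + v').
Proof.
move=> [/= Hu Hv uv] [/= Hu' Hv' uv']; split=> /=; [exact: (sh_lin sh)|exact: (sh_lin sh)|].
move=> f g Gfg; have Hf := GHl Gfg; have Hg := GHr Gfg.
have Hau := shZ a Hu; have Hav := shZ a Hv.
by rewrite !ipDr // !ipZr // (uv _ _ Gfg) (uv' _ _ Gfg).
Qed.

Lemma closure_lin a u v u' v' : graph_closure H ip G (u, v) ->
  graph_closure H ip G (u', v') ->
  graph_closure H ip G (a *: u + u', a *: v + v').
Proof.
move=> [/= Hu Hv uv] [/= Hu' Hv' uv']; split=> /=; [exact: (sh_lin sh)|exact: (sh_lin sh)|].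
move=> e e0; pose c := normc a + 1.
have a0 : 0 <= normc a by case: (a) => x y; exact: sqrtr_ge0.
have c0 : 0 < c by rewrite ltr_wpDl.
have e1 : 0 < e / (2 * c) by rewrite divr_gt0 // mulr_gt0.
have e2 : 0 < e / 2 by rewrite divr_gt0.
have [f [g [Gfg uf vg]]] := uv _ e1.
have [f' [g' [Gfg' uf' vg']]] := uv' _ e2.
have est x y x' y' : H x -> H y -> H x' -> H y' -> N (x - y) < e / (2 * c) ->
    N (x' - y') < e / 2 -> N (a *: x + x' - (a *: y + y')) < e.
  move=> Hx Hy Hx' Hy' d1 d2.
  have -> : a *: x + x' - (a *: y + y') = a *: (x - y) + (x' - y').
    by rewrite scalerBr opprD addrACA.
  have Hxy := shB Hx Hy.
  apply: le_lt_trans (ip_normD (shZ a Hxy) (shB Hx' Hy')) _.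
  rewrite ip_normZ // [ltRHS]splitr; apply: ler_ltD => //.
  have -> : e / 2 = c * (e / (2 * c)) by field; rewrite gt_eqF.
  apply: ler_pM => //; [exact: ip_norm_ge0|by rewrite lerDl|exact: ltW].
exists (a *: f + f'), (a *: g + g'); split; first exact: Glin.
  by apply: est => //; [exact: GHl Gfg|exact: GHl Gfg'].
by apply: est => //; [exact: GHr Gfg|exact: GHr Gfg'].
Qed.

(** For fixed [u'] and [v'] the relation is continuous in [(f, g)] for the graph norm, so it
    survives limits. Real parts come first because Cauchy-Schwarz is available for them;
    [ip_closure] recovers the imaginary part from the pair multiplied by [i]. *)
Lemma reip_closure u v u' v' : H u' -> H v' ->
  (forall f g, G (f, g) -> ip g u' = ip f v') ->
  graph_closure H ip G (u, v) -> B v u' = B u v'.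
Proof.
move=> Hu' Hv' a [/= Hu Hv c].
apply/eqP; rewrite -subr_eq0 -normr_le0; apply: (@le0_eps _ (N u' + N v')).
  by rewrite addr_ge0 ?ip_norm_ge0.
move=> e e0; have [f [g [Gfg uf vg]]] := c _ e0.
have Hf := GHl Gfg; have Hg := GHr Gfg.
have Hvg := shB Hv Hg; have Huf := shB Hu Hf.
have -> : B v u' - B u v' = B (v - g) u' - B (u - f) v'.
  by rewrite !ipBl // !ReB (a _ _ Gfg); ring.
apply: le_trans (ler_normB _ _) _.
have := cauchy_schwarz Hvg Hu'; have := cauchy_schwarz Huf Hv'.
have := ip_norm_ge0 u'; have := ip_norm_ge0 v'; nra.
Qed.

Lemma ip_closure u v u' v' : H u' -> H v' ->
  (forall f g, G (f, g) -> ip g u' = ip f v') ->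
  graph_closure H ip G (u, v) -> ip v u' = ip u v'.
Proof.
move=> Hu' Hv' a c; have [/= Hu Hv _] := c.
have re := reip_closure Hu' Hv' a c.
have ci : graph_closure H ip G ('i%C *: u, 'i%C *: v).
  by rewrite -['i%C *: u]addr0 -['i%C *: v]addr0; apply: closure_lin => //; exact: graph_sub_closure.
have im := reip_closure Hu' Hv' a ci.
move: im; rewrite !reipZi // => /eqP; rewrite eqr_opp => /eqP im.
by move: re im; case: (ip v u') => ? ?; case: (ip u v') => ? ? /= -> ->.
Qed.

Lemma closure_sub_adjoint : graph_closure H ip G `<=` graph_adjoint H ip G.
Proof.
move=> [u v] c; have [/= Hu Hv _] := c; split=> //= f g Gfg.
have Hf := GHl Gfg; have Hg := GHr Gfg.
have := @ip_closure u v f g Hf Hg _ c.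
rewrite (sh_conj sh Hv Hf) (sh_conj sh Hu Hg) => h.
apply: esym; apply: (can_inj (@conjcK R)); apply: h => f' g' Gfg'.
exact: Gsym Gfg' Gfg.
Qed.

(** The difference of the two pairs has a first component of norm zero, so its second component is
    orthogonal to the whole domain, and density concludes. *)
Lemma adjoint_well_defined u v u' v' : graph_adjoint H ip G (u, v) ->
  graph_adjoint H ip G (u', v') -> ip_eq ip u u' -> ip_eq ip v v'.
Proof.
move=> auv auv' uu'; have [/= Hu Hv _] := auv; have [/= Hu' Hv' _] := auv'.
have := adjoint_lin (-1) auv' auv; rewrite !scaleN1r ![- _ + _]addrC.
move=> [/= Hd Hd' ad]; apply: Gdense => // f g Gfg.
by rewrite -(ad f g Gfg) ip_null //; exact: GHr Gfg.
Qed.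

(** Symmetry makes [ip g f] real, so the cross terms cancel:
    [N (g - i f) ^+ 2 = N g ^+ 2 + N f ^+ 2]. *)
Lemma norm_le_defect f g : G (f, g) -> N f <= N (g - 'i%C *: f).
Proof.
move=> Gfg; have Hf := GHl Gfg; have Hg := GHr Gfg; have Hi := shZ 'i%C Hf.
rewrite -ler_sqr ?nnegrE ?ip_norm_ge0 // !ip_normE //; last exact: shB.
rewrite ipBl ?ipBr //; last exact: shB.
have := Gsym Gfg Gfg; rewrite (sh_conj sh Hf Hg) !ipZl // !ipZr //.
rewrite (sh_conj sh Hf Hg); have := sh_ge0 sh Hg.
case: (ip g f) => x y; case: (ip g g) => p q; case: (ip f f) => z w /=.
move=> p0 [] /eqP; rewrite -addr_eq0 -mulr2n mulrn_eq0 /= => /eqP y0; subst y.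
rewrite -subr_ge0; set X := (X in 0 <= X).
by have -> : X = p by rewrite /X; ring.
Qed.

(* If [(h, k)] is in the adjoint of [T] and [(T + i) f] is close to [k + i h], then
   [h - f] is nearly orthogonal to the range of [T - i], which is dense. *)
Lemma adjoint_sub_closure : graph_adjoint H ip G `<=` graph_closure H ip G.
Proof.
move=> [h k] ahk; have [/= Hh Hk _] := ahk; split=> //= eps eps0.
(* A third is enough: the two distances come out as at most [d] and less than [2 * d]. *)
pose d := eps / 3; have d0 : 0 < d by rewrite divr_gt0.
have Hi := shZ 'i%C Hh.
have [f [g [Gfg]]] := defect_range_dense (or_intror erefl) (shD Hk Hi) d0.
have Hf := GHl Gfg; have Hg := GHr Gfg.
have -> : k + 'i%C *: h - (g - (- 'i%C) *: f) = (k - g) + 'i%C *: (h - f).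
  by rewrite scaleNr opprK opprD addrACA scalerBr.
have := adjoint_lin (-1) (graph_sub_adjoint Gfg) ahk.
rewrite !scaleN1r ![- _ + _]addrC.
set a := h - f; set b := k - g => -[/= Ha Hb ab] bia.
have Hia := shZ 'i%C Ha; have Hbia := shD Hb Hia.
(* The adjoint relation and conjugate linearity rewrite the left pairing as [ip f' (b + i a)], where
   the second vector is shorter than [d]; [norm_le_defect] then bounds [N f']. *)
have est f' g' : G (f', g') -> `|B (g' - 'i%C *: f') a| <= N (g' - 'i%C *: f') * d.
  move=> Gfg'; have Hf' := GHl Gfg'; have Hg' := GHr Gfg'; have Hif := shZ 'i%C Hf'.
  have -> : ip (g' - 'i%C *: f') a = ip f' (b + 'i%C *: a).
    rewrite ipBl // ipDr // ipZl // ipZr // (ab _ _ Gfg').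
    by case: (ip f' b) => x y; case: (ip f' a) => z w; congr Complex; ring.
  apply: le_trans (cauchy_schwarz Hf' Hbia) _.
  by apply: ler_pM; rewrite ?ip_norm_ge0 ?norm_le_defect // ltW.
have Na : N a <= d.
  have [->|N0] := eqVneq (N a) 0; first exact: ltW.
  have Ngt : 0 < N a by rewrite lt_neqAle eq_sym N0 ip_norm_ge0.
  (* Approximating [a] itself by an element [s] of the range, with error [e], yields
     [N a * N a <= e * N a + (N a + e) * d]. *)
  rewrite -(ler_pM2l Ngt) -subr_le0.
  apply: (@le0_eps _ (N a + d)); first by rewrite addr_ge0 // ltW.
  move=> e e0; have [f' [g' [Gfg' af]]] := defect_range_dense (or_introl erefl) Ha e0.
  have := est _ _ Gfg'; set s := g' - _ in af *.
  have Hs : H s by apply: shB; [exact: GHr Gfg'|exact: shZ (GHl Gfg')].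
  have Has := shB Ha Hs.
  have : N s <= N a + e.
    have -> : s = a - (a - s) by rewrite opprB addrC subrK.
    by apply: le_trans (ip_normB Ha Has) _; rewrite lerD2l ltW.
  have : N a * N a = B (a - s) a + B s a.
    by rewrite -expr2 ip_normE // ipBl // ReB subrK.
  have := cauchy_schwarz Has Ha; have := ler_norm (B (a - s) a); have := ler_norm (B s a).
  nra.
exists f, g; split=> //; first by apply: le_lt_trans Na _; rewrite /d; lra.
have -> : k - g = (b + 'i%C *: a) - 'i%C *: a by rewrite addrK.
apply: le_lt_trans (ip_normB Hbia Hia) _; rewrite ip_normZ_i //.
move: bia; rewrite /d in Na *; lra.
Qed.

Theorem essentially_selfadjoint_of_defect : essentially_selfadjoint H ip G.
Proof.
split => //.
- split=> // u v u' v' Guv Guv'.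
  by apply: adjoint_well_defined; apply: graph_sub_adjoint.
- by move=> u Hu e e0; exact: domain_dense.
split.
- split.
  + by move=> [u v] [].
  + exact: graph_sub_closure.
  + exact: closure_lin.
  + move=> u v u' v' /closure_sub_adjoint c /closure_sub_adjoint c'.
    exact: adjoint_well_defined c c'.
- move=> u Hu e e0; have [f [g [Gfg ?]]] := domain_dense Hu e0.
  by exists f, g; split=> //; exact: graph_sub_closure.
(* The adjoint of the closure lies in the adjoint of [G], hence in the closure. Conversely, symmetry
   is extended to limits in both arguments. *)
apply/seteqP; split.
- move=> [h k] [/= Hh Hk hk]; apply: adjoint_sub_closure; split=> //= f g Gfg.
  by apply: hk; exact: graph_sub_closure.
- move=> [u v] c; have [/= Hu Hv _] := c; split=> //= f g c'.
  apply: (ip_closure _ _ _ c') => //.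
  by have [_ _] := closure_sub_adjoint c.
Qed.

End EssentialSelfAdjointness.
End SemiInnerProduct.

(** * Goursat's theorem for rectangles *)

Section IntervalIntegral.
Context {R : realType}.
Local Notation mu := (@lebesgue_measure R).
Implicit Types (f g F : R -> R) (a b m : R).

Lemma integrable_continuous_itv f a b :
  {in `[a, b], continuous f} -> mu.-integrable `[a, b] (EFin \o f).
Proof.
move=> cf; apply: continuous_compact_integrable; first exact: segment_compact.
by apply: continuous_in_subspaceT => x /set_mem /cf.
Qed.

Lemma Rintegral_FTC2 f F a b : a <= b -> {in `[a, b], continuous f} ->
  {in `[a, b], forall x : R, is_derive x 1 F (f x)} ->
  \int[mu]_(x in `[a, b]) f x = F b - F a.
Proof.
rewrite le_eqVlt => /predU1P[<-|ab] cf dF.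
  by rewrite set_itv1 Rintegral_set1 subrr.
rewrite /Rintegral (@continuous_FTC2 _ f F) //.
- by apply: continuous_in_subspaceT => x /set_mem /cf.
- have cF x : x \in `[a, b] -> {for x, continuous F}.
    by move=> /dF [d _]; apply: differentiable_continuous; apply/derivable1_diffP.
  split.
  + by move=> x /subset_itv_oo_cc /dF [].
  + by apply: cvg_at_right_filter; apply: cF; rewrite bound_itvE ltW.
  + by apply: cvg_at_left_filter; apply: cF; rewrite bound_itvE ltW.
- by move=> x /subset_itv_oo_cc /dF dFx; rewrite derive1E; apply: derive_val.
Qed.

Lemma Rintegral_affine (p q a b : R) : a <= b ->
  \int[mu]_(x in `[a, b]) (p + q * x) = p * (b - a) + q * (b ^+ 2 - a ^+ 2) / 2.
Proof.
move=> ab; rewrite (@Rintegral_FTC2 _ (fun x => p * x + q / 2 * (x * x))) //.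
- by field.
- move=> x _; apply: cvgD; first exact: cvg_cst.
  by apply: cvgM; [exact: cvg_cst|exact: cvg_id].
- move=> x _; apply: is_derive_eq; rewrite /GRing.scale /=; by field.
Qed.

Lemma Rintegral_itv_split f a b m : a <= m -> m <= b ->
  {in `[a, b], continuous f} ->
  \int[mu]_(x in `[a, b]) f x =
  \int[mu]_(x in `[a, m]) f x + \int[mu]_(x in `[m, b]) f x.
Proof.
move=> am mb cf; have fi := integrable_continuous_itv cf.
have fmb : mu.-integrable `[m, b] (EFin \o f).
  by apply: integrable_continuous_itv => x; rewrite in_itv /= => /andP[mx xb];
    apply: cf; rewrite in_itv /= xb (le_trans am).
rewrite -(@Rintegral_itv_obnd_cbnd _ m) //; last first.
  by apply: integrableS fmb => //; apply: subset_itv => //; rewrite bnd_simp.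
by rewrite -(Rintegral_itvB fi) ?bnd_simp // addrC subrK.
Qed.

Lemma Rintegral_near_affine f (p q eta a b : R) : a <= b -> {in `[a, b], continuous f} ->
  (forall x, a <= x <= b -> `|f x - (p + q * x)| <= eta) ->
  `|\int[mu]_(x in `[a, b]) f x - (p * (b - a) + q * (b ^+ 2 - a ^+ 2) / 2)|
    <= eta * (b - a).
Proof.
move=> ab cf fpq.
have cl : {in `[a, b], continuous (fun x : R => p + q * x)}.
  move=> x _; apply: cvgD; first exact: cvg_cst.
  by apply: cvgM; [exact: cvg_cst|exact: cvg_id].
have cd : {in `[a, b], continuous (fun x : R => f x - (p + q * x))}.
  by move=> x xab; apply: cvgB; [exact: cf|exact: cl].
have ca : {in `[a, b], continuous (fun x : R => `|f x - (p + q * x)|)}.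
  by move=> x xab; apply: cvg_norm; exact: cd.
have cc : {in `[a, b], continuous (fun x : R => eta)} by move=> x _; exact: cvg_cst.
rewrite -Rintegral_affine // -RintegralB //; [|exact: integrable_continuous_itv..].
apply: le_trans (le_normr_Rintegral _ _) _ => //; first exact: integrable_continuous_itv.
have -> : eta * (b - a) = \int[mu]_(x in `[a, b]) eta.
  by rewrite Rintegral_cst //= lebesgue_measure_itv /= lte_fin;
    case: ltP => [_|ba] //=; have -> : b - a = 0 by lra.
apply: le_Rintegral => //; try exact: integrable_continuous_itv.
Qed.

End IntervalIntegral.

(** * Additive rectangle functions and repeated quartering *)

Section Bisection.
Context {R : realType}.
Variable Phi : R -> R -> R -> R -> R.
Variables A B C D : R.
Hypotheses (AB : A <= B) (CD : C <= D).
Hypothesis Phi_split : forall a b c d, A <= a -> a <= b -> b <= B ->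
  C <= c -> c <= d -> d <= D ->
  let m := (a + b) / 2 in let n := (c + d) / 2 in
  Phi a b c d = Phi a m c n + Phi a m n d + Phi m b c n + Phi m b n d.
Hypothesis Phi_small : forall x y, A <= x <= B -> C <= y <= D ->
  forall e : R, 0 < e -> exists2 dl : R, 0 < dl & forall a b c d,
    A <= a -> b <= B -> C <= c -> d <= D ->
    a <= x <= b -> c <= y <= d -> b - a < dl -> d - c < dl ->
    `|Phi a b c d| <= e * (b - a + (d - c)) ^+ 2.

Let valid (r : (R * R) * (R * R)) :=
  [/\ A <= r.1.1, r.1.1 <= r.1.2, r.1.2 <= B, C <= r.2.1 & r.2.1 <= r.2.2 <= D].
Let sub (r r' : (R * R) * (R * R)) :=
  [/\ valid r', r.1.1 <= r'.1.1, r'.1.2 <= r.1.2, r.2.1 <= r'.2.1 & r'.2.2 <= r.2.2]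
  /\ r'.1.2 - r'.1.1 = (r.1.2 - r.1.1) / 2 /\ r'.2.2 - r'.2.1 = (r.2.2 - r.2.1) / 2.
Let Ph (r : (R * R) * (R * R)) := Phi r.1.1 r.1.2 r.2.1 r.2.2.

(** One of the four quarters carries at least a quarter of the value. Validity is a premise inside
    the existential so that [choice] yields a total function, which can be iterated. *)
Let step r : exists r', valid r -> sub r r' /\ `|Ph r| <= 4 * `|Ph r'|.
Proof.
case: (pselect (valid r)); last by exists r.
case: r => [[a b] [c d]] [/= Aa ab bB Cc /andP[cd dD]].
pose m := (a + b) / 2; pose n := (c + d) / 2.
have am : a <= m by rewrite /m; lra.
have mb : m <= b by rewrite /m; lra.
have cn : c <= n by rewrite /n; lra.
have nd : n <= d by rewrite /n; lra.
have e1 : m - a = (b - a) / 2 by rewrite /m; field.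
have e2 : b - m = (b - a) / 2 by rewrite /m; field.
have e3 : n - c = (d - c) / 2 by rewrite /n; field.
have e4 : d - n = (d - c) / 2 by rewrite /n; field.
have s1 : sub ((a, b), (c, d)) ((a, m), (c, n)) by split=> //; split=> //; split=> /=; lra.
have s2 : sub ((a, b), (c, d)) ((a, m), (n, d)) by split=> //; split=> //; split=> /=; lra.
have s3 : sub ((a, b), (c, d)) ((m, b), (c, n)) by split=> //; split=> //; split=> /=; lra.
have s4 : sub ((a, b), (c, d)) ((m, b), (n, d)) by split=> //; split=> //; split=> /=; lra.
have := Phi_split Aa ab bB Cc cd dD; rewrite -/m -/n /= => E.
have [h1|h1] := leP `|Phi a b c d| (4 * `|Phi a m c n|); first by exists ((a, m), (c, n)).
have [h2|h2] := leP `|Phi a b c d| (4 * `|Phi a m n d|); first by exists ((a, m), (n, d)).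
have [h3|h3] := leP `|Phi a b c d| (4 * `|Phi m b c n|); first by exists ((m, b), (c, n)).
exists ((m, b), (n, d)) => _; split=> //; rewrite /Ph /=.
have : `|Phi a b c d| <= `|Phi a m c n| + `|Phi a m n d| + `|Phi m b c n| + `|Phi m b n d|.
  rewrite E; apply: le_trans (ler_normD _ _) _; rewrite lerD2r.
  apply: le_trans (ler_normD _ _) _; rewrite lerD2r; exact: ler_normD.
lra.
Qed.

(** The core of Goursat's argument. Quartering n times keeps a rectangle with at least [4^-n] of the
    total value, while its squared size is also divided by [4^n]. The rectangles shrink to a common
    point, where the smallness hypothesis makes the ratio of the two as small as desired. *)
Lemma bisection_eq0 : Phi A B C D = 0.
Proof.
have [next nextP] := choice step.
pose u n := iter n next ((A, B), (C, D)).
have u0 : valid (u 0%N) by split=> //=; rewrite ?lexx ?CD ?AB.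
have uv n : valid (u n).
  by elim: n => // n IH; have [[[]]] := nextP _ IH.
have us n : sub (u n) (u n.+1) by have [] := nextP _ (uv n).
have uP n : `|Phi A B C D| <= 4 ^+ n * `|Ph (u n)|.
  elim: n => [|n IH]; first by rewrite expr0 mul1r.
  apply: le_trans IH _; rewrite exprSr -mulrA ler_wpM2l ?exprn_ge0 //.
  by have [] := nextP _ (uv n).
have uw1 n : (u n).1.2 - (u n).1.1 = (B - A) * 2^-1 ^+ n.
  elim: n => [|n IH]; first by rewrite expr0 mulr1.
  by have [_ [-> _]] := us n; rewrite IH exprSr mulrA.
have uw2 n : (u n).2.2 - (u n).2.1 = (D - C) * 2^-1 ^+ n.
  elim: n => [|n IH]; first by rewrite expr0 mulr1.
  by have [_ [_ ->]] := us n; rewrite IH exprSr mulrA.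
have mono n k : (n <= k)%N -> [/\ (u n).1.1 <= (u k).1.1, (u k).1.2 <= (u n).1.2,
    (u n).2.1 <= (u k).2.1 & (u k).2.2 <= (u n).2.2].
  elim: k => [|k IH]; first by rewrite leqn0 => /eqP ->.
  rewrite leq_eqVlt => /predU1P[->//|]; rewrite ltnS => /IH [h1 h2 h3 h4].
  have [[_ g1 g2 g3 g4] _] := us k.
  by split; [exact: le_trans h1 g1|exact: le_trans g2 h2|exact: le_trans h3 g3|exact: le_trans g4 h4].
have cross n k : (u n).1.1 <= (u k).1.2 /\ (u n).2.1 <= (u k).2.2.
  have [h1 h2 h3 h4] := mono _ _ (leq_maxl n k).
  have [g1 g2 g3 g4] := mono _ _ (leq_maxr n k).
  have [_ v1 _ _ /andP[v2 _]] := uv (maxn n k).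
  by split; lra.
pose X := [set (u n).1.1 | n in setT]; pose Y := [set (u n).2.1 | n in setT].
have X0 : X !=set0 by exists (u 0%N).1.1, 0%N.
have Y0 : Y !=set0 by exists (u 0%N).2.1, 0%N.
have Xb k : ubound X (u k).1.2 by move=> _ [n _ <-]; case: (cross n k).
have Yb k : ubound Y (u k).2.2 by move=> _ [n _ <-]; case: (cross n k).
have Xs k : (u k).1.1 <= sup X <= (u k).1.2.
  by rewrite ge_sup // andbT; apply: ub_le_sup; [exists (u 0%N).1.2|exists k].
have Ys k : (u k).2.1 <= sup Y <= (u k).2.2.
  by rewrite ge_sup // andbT; apply: ub_le_sup; [exists (u 0%N).2.2|exists k].
apply/eqP; rewrite -normr_le0 leNgt; apply/negP => P0.
pose s : R := B - A + (D - C); have s0 : 0 <= s by rewrite addr_ge0 ?subr_ge0.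
(* Chosen so that the final estimate, total value at most [e * s ^+ 2], is contradictory; the added
   1 covers a degenerate rectangle with [s = 0]. *)
pose e := `|Phi A B C D| / (2 * (s ^+ 2 + 1)).
have s1 : 0 < s ^+ 2 + 1 by rewrite ltr_wpDl ?sqr_ge0.
have e0 : 0 < e by rewrite divr_gt0 // mulr_gt0.
have [dl dl0 dlP] := Phi_small (Xs 0%N) (Ys 0%N) e0.
have s2 : 0 < dl / (s + 1) by rewrite divr_gt0 // ltr_wpDl.
have [n hn] : exists n : nat, 2^-1 ^+ n < dl / (s + 1).
  have : (fun n => (2^-1 : R) ^+ n) @ \oo --> (0:R).
    by apply: cvg_expr; rewrite ger0_norm ?invr_ge0 ?ler0n // invf_lt1 ?ltr1n.
  move/cvgrPdist_lt => /(_ _ s2) [n _ /(_ n (leqnn n))]; rewrite sub0r normrN.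
  by rewrite ger0_norm ?exprn_ge0 ?invr_ge0 ?ler0n // => ?; exists n.
have p0 : 0 <= 2^-1 ^+ n :> R by rewrite exprn_ge0 ?invr_ge0.
have {}hn : (s + 1) * 2^-1 ^+ n < dl by rewrite mulrC -ltr_pdivlMr // ltr_wpDl.
have [v1 v2 v3 v4 /andP[v5 v6]] := uv n.
have := dlP _ _ _ _ v1 v3 v4 v6 (Xs n) (Ys n); rewrite uw1 uw2 => /(_ _)/wrap[].
  by apply: le_lt_trans hn; rewrite ler_wpM2r // /s; lra.
move=> /(_ _)/wrap[]; first by apply: le_lt_trans hn; rewrite ler_wpM2r // /s; lra.
rewrite -mulrDl -/s exprMn => h.
have h4 : (2^-1 ^+ n) ^+ 2 * 4 ^+ n = 1 :> R.
  have h5 : 2^-1 ^+ 2 * 4 = 1 :> R by field.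
  by rewrite -exprM mulnC exprM -exprMn h5 expr1n.
have : `|Phi A B C D| <= e * s ^+ 2.
  apply: le_trans (uP n) _.
  have -> : e * s ^+ 2 = 4 ^+ n * (e * (s ^+ 2 * (2^-1 ^+ n) ^+ 2)).
    have -> : 4 ^+ n * (e * (s ^+ 2 * (2^-1 ^+ n) ^+ 2)) =
        e * s ^+ 2 * ((2^-1 ^+ n) ^+ 2 * 4 ^+ n).
      by rewrite mulrC -!mulrA.
    by rewrite h4 mulr1.
  by rewrite ler_wpM2l // exprn_ge0.
have : e * (2 * (s ^+ 2 + 1)) = `|Phi A B C D| by rewrite /e; field; rewrite gt_eqF.
have := sqr_ge0 s; nra.
Qed.

End Bisection.

Section Goursat.
Context {R : realType}.
Local Notation mu := (@lebesgue_measure R).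
Implicit Types (P Q : R -> R -> R).

(** Total differentiability in the plane, spelled out in coordinates; [p] and [q] are the partial
    derivatives. *)
Definition differentiable2 P (x y p q : R) := forall e : R, 0 < e ->
  exists2 d : R, 0 < d & forall h k : R, `|h| < d -> `|k| < d ->
    `|P (x + h) (y + k) - P x y - (p * h + q * k)| <= e * (`|h| + `|k|).

Lemma differentiable2_cont P x y p q : differentiable2 P x y p q ->
  forall e : R, 0 < e -> exists2 d : R, 0 < d & forall h k : R,
    `|h| < d -> `|k| < d -> `|P (x + h) (y + k) - P x y| < e.
Proof.
move=> dP e e0; have [d d0 dd] := dP 1 ltr01.
pose M := `|p| + `|q| + 1.
have p0 := normr_ge0 p; have q0 := normr_ge0 q.
have M0 : 0 < M by rewrite /M; lra.
have e1 : 0 < e / (2 * M) by rewrite divr_gt0 // mulr_gt0.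
exists (Num.min d (e / (2 * M))); first by rewrite lt_min d0.
move=> h k; rewrite !lt_min => /andP[hd he] /andP[kd ke].
have := dd h k hd kd; rewrite mul1r => est.
have : `|P (x + h) (y + k) - P x y| <= M * (`|h| + `|k|).
  have -> : P (x + h) (y + k) - P x y =
    (P (x + h) (y + k) - P x y - (p * h + q * k)) + (p * h + q * k) by ring.
  apply: le_trans (ler_normD _ _) _.
  have : `|p * h + q * k| <= `|p| * `|h| + `|q| * `|k|.
    by rewrite -!normrM; exact: ler_normD.
  have := normr_ge0 h; have := normr_ge0 k; rewrite /M; nra.
move/le_lt_trans; apply.
have -> : e = M * (e / (2 * M) + e / (2 * M)) by field; rewrite gt_eqF.
by rewrite ltr_pM2l // ltrD.
Qed.

Lemma differentiable2_cont1 P x y p q : differentiable2 P x y p q ->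
  {for x, continuous (P^~ y)}.
Proof.
move=> /differentiable2_cont c; apply/cvgrPdist_lt => e /c [d d0 dP].
apply/nbhs_ballP; exists d => //= t; rewrite /ball /= distrC => xt; rewrite distrC.
have := dP (t - x) 0; rewrite addr0 [x + _]addrC subrK; apply; rewrite ?normr0 //.
Qed.

Lemma differentiable2_cont2 P x y p q : differentiable2 P x y p q ->
  {for y, continuous (P x)}.
Proof.
move=> /differentiable2_cont c; apply/cvgrPdist_lt => e /c [d d0 dP].
apply/nbhs_ballP; exists d => //= t; rewrite /ball /= distrC => xt; rewrite distrC.
have := dP 0 (t - y); rewrite addr0 [y + _]addrC subrK; apply; rewrite ?normr0 //.
Qed.

(** The shared coefficient [q] says that the form [P dx + Q dy] is closed at each point. Near a
    point [P] and [Q] are affine up to a small multiple of the distance, and the affine parts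
    integrate to zero around a rectangle precisely because the two mixed coefficients agree;
    bisection does the rest. *)
Theorem goursat_rectangle P Q (A B C D : R) : A <= B -> C <= D ->
  (forall x y, A <= x <= B -> C <= y <= D -> exists p q r,
     differentiable2 P x y p q /\ differentiable2 Q x y q r) ->
  \int[mu]_(x in `[A, B]) P x C - \int[mu]_(x in `[A, B]) P x D
  + \int[mu]_(y in `[C, D]) Q B y - \int[mu]_(y in `[C, D]) Q A y = 0.
Proof.
move=> AB CD PQ.
pose Phi a b c d := \int[mu]_(x in `[a, b]) P x c - \int[mu]_(x in `[a, b]) P x d
  + \int[mu]_(y in `[c, d]) Q b y - \int[mu]_(y in `[c, d]) Q a y.
have cP a b y : A <= a -> b <= B -> C <= y <= D -> {in `[a, b], continuous (P^~ y)}.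
  move=> Aa bB yCD x; rewrite in_itv /= => /andP[ax xb].
  have xAB : A <= x <= B by rewrite (le_trans Aa) // (le_trans xb).
  by have [p [q [r [dP _]]]] := PQ x y xAB yCD; exact: differentiable2_cont1 dP.
have cQ c d x : C <= c -> d <= D -> A <= x <= B -> {in `[c, d], continuous (Q x)}.
  move=> Cc dD xAB y; rewrite in_itv /= => /andP[cy yd].
  have yCD : C <= y <= D by rewrite (le_trans Cc) // (le_trans yd).
  by have [p [q [r [_ dQ]]]] := PQ x y xAB yCD; exact: differentiable2_cont2 dQ.
apply: (@bisection_eq0 R Phi) => //.
- move=> a b c d Aa ab bB Cc cd dD m n.
  have am : a <= m by rewrite /m; lra.
  have mb : m <= b by rewrite /m; lra.
  have cn : c <= n by rewrite /n; lra.
  have nd : n <= d by rewrite /n; lra.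
  have cCD : C <= c <= D by rewrite Cc (le_trans cd).
  have dCD : C <= d <= D by rewrite dD (le_trans Cc).
  have aAB : A <= a <= B by rewrite Aa (le_trans ab).
  have bAB : A <= b <= B by rewrite bB (le_trans Aa).
  rewrite /Phi (Rintegral_itv_split am mb (cP _ _ _ Aa bB cCD)).
  rewrite (Rintegral_itv_split am mb (cP _ _ _ Aa bB dCD)).
  rewrite (Rintegral_itv_split cn nd (cQ _ _ _ Cc dD aAB)).
  rewrite (Rintegral_itv_split cn nd (cQ _ _ _ Cc dD bAB)).
  by ring.
- move=> x y xAB yCD e e0.
  have [p [q [r [dP dQ]]]] := PQ x y xAB yCD.
  (* Each side is integrated with error [e / 2 * s] times its length, and the four lengths add up to
     [2 * s]. *)
  have e2 : 0 < e / 2 by rewrite divr_gt0.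
  have [d1 d10 h1] := dP _ e2; have [d2 d20 h2] := dQ _ e2.
  exists (Num.min d1 d2); first by rewrite lt_min d10.
  move=> a b c d Aa bB Cc dD /andP[ax xb] /andP[cy yd]; rewrite !lt_min.
  move=> /andP[ba1 ba2] /andP[dc1 dc2].
  have ab : a <= b by lra.
  have cd : c <= d by lra.
  set s := b - a + (d - c).
  have estP x' y' : a <= x' <= b -> c <= y' <= d ->
      `|P x' y' - (P x y - p * x + q * (y' - y) + p * x')| <= e / 2 * s.
    move=> /andP[ax' xb'] /andP[cy' yd'].
    have hx : `|x' - x| <= b - a by rewrite ler_norml; lra.
    have hy : `|y' - y| <= d - c by rewrite ler_norml; lra.
    have := h1 (x' - x) (y' - y) (le_lt_trans hx ba1) (le_lt_trans hy dc1).
    have -> : x + (x' - x) = x' by ring.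
    have -> : y + (y' - y) = y' by ring.
    have -> : P x' y' - P x y - (p * (x' - x) + q * (y' - y)) =
      P x' y' - (P x y - p * x + q * (y' - y) + p * x') by ring.
    by move/le_trans; apply; rewrite ler_pM2l // lerD.
  have estQ x' y' : a <= x' <= b -> c <= y' <= d ->
      `|Q x' y' - (Q x y + q * (x' - x) - r * y + r * y')| <= e / 2 * s.
    move=> /andP[ax' xb'] /andP[cy' yd'].
    have hx : `|x' - x| <= b - a by rewrite ler_norml; lra.
    have hy : `|y' - y| <= d - c by rewrite ler_norml; lra.
    have := h2 (x' - x) (y' - y) (le_lt_trans hx ba2) (le_lt_trans hy dc2).
    have -> : x + (x' - x) = x' by ring.
    have -> : y + (y' - y) = y' by ring.
    have -> : Q x' y' - Q x y - (q * (x' - x) + r * (y' - y)) =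
      Q x' y' - (Q x y + q * (x' - x) - r * y + r * y') by ring.
    by move/le_trans; apply; rewrite ler_pM2l // lerD.
  have cc : c <= c <= d by rewrite lexx.
  have dd : c <= d <= d by rewrite lexx andbT.
  have aa : a <= a <= b by rewrite lexx.
  have bb : a <= b <= b by rewrite lexx andbT.
  have cCD : C <= c <= D by rewrite Cc (le_trans cd).
  have dCD : C <= d <= D by rewrite dD (le_trans Cc).
  have aAB : A <= a <= B by rewrite Aa (le_trans ab).
  have bAB : A <= b <= B by rewrite bB (le_trans Aa).
  have := Rintegral_near_affine ab (cP _ _ _ Aa bB cCD) (fun x' h => estP x' c h cc).
  have := Rintegral_near_affine ab (cP _ _ _ Aa bB dCD) (fun x' h => estP x' d h dd).
  have := Rintegral_near_affine cd (cQ _ _ _ Cc dD aAB) (fun y' h => estQ a y' aa h).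
  have := Rintegral_near_affine cd (cQ _ _ _ Cc dD bAB) (fun y' h => estQ b y' bb h).
  rewrite /Phi; set I1 := Rintegral _ _ _; set I2 := Rintegral _ _ _.
  set I3 := Rintegral _ _ _; set I4 := Rintegral _ _ _.
  rewrite !ler_norml => /andP[u1 v1] /andP[u2 v2] /andP[u3 v3] /andP[u4 v4].
  have -> : e * s ^+ 2 = 2 * (e / 2 * s * (d - c)) + 2 * (e / 2 * s * (b - a)).
    by rewrite /s; field.
  move: u1 v1 u2 v2 u3 v3 u4 v4.
  set E1 := e / 2 * s * (d - c); set E2 := e / 2 * s * (b - a).
  by move=> *; apply/andP; split; lra.
Qed.

End Goursat.

(** * The weighted Hilbert space *)

Section WeightedL2.
Context {R : realType}.
Local Notation mu := (@lebesgue_measure R).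
Implicit Types (f g : R -> R[i]) (s : R).
Local Notation RE z := (complex.Re z).
Local Notation IM z := (complex.Im z).

Lemma integrable_RZ k (h : R -> R) : mu.-integrable setT (EFin \o h) ->
  mu.-integrable setT (EFin \o (fun s => k * h s)).
Proof. by move=> hi; have := integrableZl measurableT k hi; apply: eq_integrable. Qed.

Lemma integrable_RD (h k : R -> R) : mu.-integrable setT (EFin \o h) ->
  mu.-integrable setT (EFin \o k) ->
  mu.-integrable setT (EFin \o (fun s => h s + k s)).
Proof. by move=> hi ki; have := integrableD measurableT hi ki; apply: eq_integrable. Qed.

Lemma integrable_RB (h k : R -> R) : mu.-integrable setT (EFin \o h) ->
  mu.-integrable setT (EFin \o k) ->
  mu.-integrable setT (EFin \o (fun s => h s - k s)).
Proof. by move=> hi ki; have := integrableB measurableT hi ki; apply: eq_integrable. Qed.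

Lemma integrable_Rdom (h k : R -> R) : measurable_fun setT h ->
  (forall s, `|h s| <= k s) -> mu.-integrable setT (EFin \o k) ->
  mu.-integrable setT (EFin \o h).
Proof.
move=> mh hk; apply: le_integrable => //; first exact/measurable_EFinP.
by move=> s _; rewrite /= lee_fin (le_trans (hk s)) // ler_norm.
Qed.

Lemma sqr_normcE (z : R[i]) : normc z ^+ 2 = RE z ^+ 2 + IM z ^+ 2.
Proof. by case: z => x y /=; rewrite sqr_sqrtr // addr_ge0 ?sqr_ge0. Qed.

Lemma normc_ge0 (z : R[i]) : 0 <= normc z.
Proof. by case: z => x y; exact: sqrtr_ge0. Qed.

Lemma weight_ge0 s : 0 <= weight s.
Proof.
rewrite /weight -mulrA; apply: mulr_ge0; first by rewrite invr_ge0 pi_ge0.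
have [s0|s0] := leP 0 s.
  rewrite mulr_ge0 // divr_ge0 // subr_ge0 ler_expR.
  by have := pi_ge0 R; nra.
rewrite nmulr_rge0 // pmulr_lle0 ?invr_gt0 // subr_le0 ler_expR.
by have := pi_ge0 R; nra.
Qed.

Lemma weight_even s : weight (- s) = weight s.
Proof. rewrite /weight !mulrN opprK; ring. Qed.

Lemma weight_gt0 s : s != 0 -> 0 < weight s.
Proof.
have pos (t : R) : 0 < t -> 0 < weight t.
  move=> t0; rewrite /weight mulr_gt0 ?divr_gt0 ?mulr_gt0 ?invr_gt0 ?pi_gt0 //.
  rewrite subr_gt0 ltr_expR; have pt := mulr_gt0 (pi_gt0 R) t0; lra.
by rewrite neq_lt => /orP[s0|/pos//]; rewrite -weight_even pos // oppr_gt0.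
Qed.

Lemma measurable_weight : measurable_fun setT (@weight R).
Proof.
apply: measurable_funM; first by apply: measurable_funM.
apply: measurable_funM => //; apply: measurable_funB.
  by apply: measurableT_comp => //; apply: measurable_funM.
by do 2 apply: measurableT_comp => //; apply: measurable_funM.
Qed.

Definition weighted_sq f s : R := normc (f s) ^+ 2 * weight s.

Lemma weighted_sq_ge0 f s : 0 <= weighted_sq f s.
Proof. by rewrite mulr_ge0 ?weight_ge0 ?sqr_ge0. Qed.

Lemma measurable_weighted_sq f : complex_measurable f ->
  measurable_fun setT (weighted_sq f).
Proof.
move=> [mr mi]; apply: measurable_funM; last exact: measurable_weight.
rewrite (_ : (fun _ => _) = (fun s => RE (f s) ^+ 2 + IM (f s) ^+ 2)).
  by apply: measurable_funD; exact: measurable_funX.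
by apply/funext => s; rewrite sqr_normcE.
Qed.

Lemma even_L2_integrable f : even_L2 f -> mu.-integrable setT (EFin \o weighted_sq f).
Proof.
move=> [mf _ fi]; apply/integrableP; split.
  by apply/measurable_EFinP; exact: measurable_weighted_sq.
apply: le_lt_trans fi; rewrite le_eqVlt; apply/orP; left; apply/eqP.
apply: eq_integral => s _ /=; by rewrite ger0_norm // weighted_sq_ge0.
Qed.

Lemma even_L2_of_integrable f : complex_measurable f -> (forall s, f (- s) = f s) ->
  mu.-integrable setT (EFin \o weighted_sq f) -> even_L2 f.
Proof.
move=> mf ef /integrableP [_ fi]; split => //.
apply: le_lt_trans fi; rewrite le_eqVlt; apply/orP; left; apply/eqP.
apply: eq_integral => s _ /=; by rewrite ger0_norm // weighted_sq_ge0.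
Qed.

Lemma complex_measurable_lin (a : R[i]) f g :
  complex_measurable f -> complex_measurable g -> complex_measurable (a *: f + g).
Proof.
case: a => a b [mr mi] [mr' mi']; split.
  rewrite (_ : (fun _ => _) = (fun s => a * RE (f s) - b * IM (f s) + RE (g s))).
    apply: measurable_funD => //; apply: measurable_funB; apply: measurable_funM => //; exact: measurable_cst.
  apply/funext => s; rewrite /GRing.scale /GRing.add /=.
  by case: (f s) => x y; case: (g s).
rewrite (_ : (fun _ => _) = (fun s => a * IM (f s) + b * RE (f s) + IM (g s))).
  apply: measurable_funD => //; apply: measurable_funD; apply: measurable_funM => //; exact: measurable_cst.
apply/funext => s; rewrite /GRing.scale /GRing.add /=.
by case: (f s) => x y; case: (g s).
Qed.

Lemma sqr_normcD (z u : R[i]) : normc (z + u) ^+ 2 <= 2 * normc z ^+ 2 + 2 * normc u ^+ 2.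
Proof.
rewrite !sqr_normcE; case: z => x y; case: u => z w /=.
rewrite -subr_ge0; set X := (X in 0 <= X).
have -> : X = (x - z) ^+ 2 + (y - w) ^+ 2 by rewrite /X; ring.
by rewrite addr_ge0 ?sqr_ge0.
Qed.

Lemma even_L2_lin (a : R[i]) f g : even_L2 f -> even_L2 g -> even_L2 (a *: f + g).
Proof.
move=> Hf Hg; have [mf ef _] := Hf; have [mg eg _] := Hg.
have mfg := complex_measurable_lin a mf mg.
apply: even_L2_of_integrable => //.
  by move=> s; rewrite /GRing.add /= /GRing.scale /= ef eg.
have Ii : mu.-integrable setT (EFin \o (fun s => 2 * normc a ^+ 2 * weighted_sq f s
    + 2 * weighted_sq g s)).
  by apply: integrable_RD; apply: integrable_RZ; exact: even_L2_integrable.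
apply: integrable_Rdom Ii; first exact: measurable_weighted_sq.
move=> s; rewrite ger0_norm ?weighted_sq_ge0 //.
rewrite /weighted_sq mulrA [2 * (_ * weight s)]mulrA -mulrDl ler_wpM2r ?weight_ge0 //.
apply: le_trans (sqr_normcD _ _) _; rewrite lerD2r /GRing.scale /=.
by rewrite ComplexField.Normc.normcM exprMn mulrA.
Qed.

Lemma even_L2_0 : even_L2 (0 : R -> R[i]).
Proof.
split=> //.
by rewrite integral0_eq // => s _; rewrite ComplexField.Normc.normc0 expr2 !mul0r.
Qed.

Definition cintegrable f : Prop :=
  mu.-integrable setT (EFin \o (fun s => RE (f s))) /\
  mu.-integrable setT (EFin \o (fun s => IM (f s))).

Lemma complex_integralD f g : cintegrable f -> cintegrable g ->
  complex_integral (fun s => f s + g s) = complex_integral f + complex_integral g.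
Proof.
move=> [fr fi] [gr gi]; rewrite /complex_integral /GRing.add /= -!RintegralD //.
by congr Complex; apply: eq_Rintegral => s _; case: (f s); case: (g s).
Qed.

Lemma complex_integralZ (a : R[i]) f : cintegrable f ->
  complex_integral (fun s => a * f s) = a * complex_integral f.
Proof.
case: a => a b [fr fi]; rewrite /complex_integral /GRing.mul /=.
have ar : mu.-integrable setT (EFin \o (fun s => a * RE (f s))) by exact: integrable_RZ.
have ai : mu.-integrable setT (EFin \o (fun s => a * IM (f s))) by exact: integrable_RZ.
have br : mu.-integrable setT (EFin \o (fun s => b * RE (f s))) by exact: integrable_RZ.
have bi : mu.-integrable setT (EFin \o (fun s => b * IM (f s))) by exact: integrable_RZ.
rewrite -!RintegralZl // -RintegralB // -RintegralD //.
by congr Complex; apply: eq_Rintegral => s _; case: (f s).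
Qed.

Lemma conjcM (x y : R[i]) : (x * y)^*%C = x^*%C * y^*%C.
Proof. exact: rmorphM. Qed.

Lemma complex_integralJ f : cintegrable f ->
  complex_integral (fun s => (f s)^*%C) = (complex_integral f)^*%C.
Proof.
move=> [fr fi]; rewrite /complex_integral /=; congr Complex.
  by apply: eq_Rintegral => s _; case: (f s).
rewrite -[RHS]mulN1r -RintegralZl //.
by apply: eq_Rintegral => s _; case: (f s) => x y /=; rewrite mulN1r.
Qed.

Lemma cintegrableZ (a : R[i]) f : cintegrable f -> cintegrable (fun s => a * f s).
Proof.
case: a => a b [fr fi].
have ar : mu.-integrable setT (EFin \o (fun s => a * RE (f s))) by exact: integrable_RZ.
have ai : mu.-integrable setT (EFin \o (fun s => a * IM (f s))) by exact: integrable_RZ.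
have br : mu.-integrable setT (EFin \o (fun s => b * RE (f s))) by exact: integrable_RZ.
have bi : mu.-integrable setT (EFin \o (fun s => b * IM (f s))) by exact: integrable_RZ.
split.
  have := integrable_RB ar bi; apply: eq_integrable => // s _ /=.
  by case: (f s).
have := integrable_RD ai br; apply: eq_integrable => // s _ /=.
by case: (f s).
Qed.

Lemma ip_cintegrable f g : even_L2 f -> even_L2 g ->
  cintegrable (fun s => f s * (g s)^*%C * (weight s)%:C%C).
Proof.
move=> Hf Hg; have [[mfr mfi] _ _] := Hf; have [[mgr mgi] _ _] := Hg.
have Ii := integrable_RD (even_L2_integrable Hf) (even_L2_integrable Hg).
have mw := measurable_weight.
(* The arithmetic-geometric inequality dominates the product by the two squares. The imaginary part
   is the same bound with [(x, y)] replaced by [(y, - x)]. *)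
have dom (x y z w v : R) : 0 <= v -> `|(x * z + y * w) * v| <= (x^+2 + y^+2) * v + (z^+2+w^+2) * v.
  move=> v0; rewrite normrM [`|v|]ger0_norm // -mulrDl ler_wpM2r //.
  have := sqr_ge0 (x + z); have := sqr_ge0 (x - z); have := sqr_ge0 (y + w); have := sqr_ge0 (y - w).
  by rewrite ler_norml => *; apply/andP; split; nra.
split; apply: integrable_Rdom Ii.
- rewrite (_ : (fun _ => _) = (fun s => (RE (f s) * RE (g s) + IM (f s) * IM (g s)) * weight s)).
    by apply: measurable_funM => //; apply: measurable_funD; exact: measurable_funM.
  by apply/funext => s; case: (f s) => x y; case: (g s) => z w /=; ring.
- move=> s; rewrite /weighted_sq !sqr_normcE; case: (f s) => x y; case: (g s) => z w /=.
  have -> : (x * z - y * - w) * weight s - (x * - w + y * z) * 0 = (x * z + y * w) * weight s by ring.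
  by apply: dom; exact: weight_ge0.
- rewrite (_ : (fun _ => _) = (fun s => (IM (f s) * RE (g s) - RE (f s) * IM (g s)) * weight s)).
    by apply: measurable_funM => //; apply: measurable_funB; exact: measurable_funM.
  by apply/funext => s; case: (f s) => x y; case: (g s) => z w /=; ring.
- move=> s; rewrite /weighted_sq !sqr_normcE; case: (f s) => x y; case: (g s) => z w /=.
  have := dom y (- x) z w _ (weight_ge0 s); rewrite sqrrN [y ^+ 2 + _]addrC.
  have -> : (y * z + - x * w) * weight s = (x * z - y * - w) * 0 + (x * - w + y * z) * weight s by ring.
  by [].
Qed.

Lemma even_L2_inner_norm f : even_L2 f ->
  RE (even_L2_inner f f) = 2 / pi * \int[mu]_s weighted_sq f s.
Proof.
move=> Hf; rewrite /even_L2_inner /complex_integral.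
rewrite /GRing.mul /= mul0r subr0; congr (_ * _); apply: eq_Rintegral => s _.
by rewrite /weighted_sq sqr_normcE; case: (f s) => x y /=; ring.
Qed.

Lemma even_L2_semi_inner : semi_inner_product (@even_L2 R) (@even_L2_inner R).
Proof.
split.
- exact: even_L2_0.
- exact: even_L2_lin.
- move=> a f g h Hf Hg Hh; rewrite /even_L2_inner mulrCA -mulrDr; congr (_ * _).
  rewrite -complex_integralZ; last exact: ip_cintegrable.
  rewrite -complex_integralD; [|exact/cintegrableZ/ip_cintegrable|exact: ip_cintegrable].
  by congr complex_integral; apply/funext => s; rewrite !mulrDl !mulrA.
- move=> f g Hf Hg; rewrite /even_L2_inner conjcM conjc_real; congr (_ * _).
  rewrite -complex_integralJ; last exact: ip_cintegrable.
  by congr complex_integral; apply/funext => s; rewrite !conjcM conjcK conjc_real [_ * f s]mulrC.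
- move=> f Hf; rewrite even_L2_inner_norm // mulr_ge0 ?divr_ge0 ?pi_ge0 //.
  by apply: Rintegral_ge0 => s _; exact: weighted_sq_ge0.
Qed.

Lemma geometric_half_sum n : \sum_(0 <= k < n) 2^-1 ^+ k <= 2 :> R.
Proof.
have : \sum_(0 <= k < n) 2^-1 ^+ k = 2 - 2 * 2^-1 ^+ n :> R.
  elim: n => [|n IH]; first by rewrite big_geq // expr0; ring.
  by rewrite big_nat_recr //= IH exprS; field.
by have := exprn_ge0 n (_ : 0 <= 2^-1 :> R); rewrite invr_ge0 ler0n => /(_ isT); lra.
Qed.

(* [|u_(n+1) - u_n| <= 2^n |u_(n+1) - u_n|^2 + 2^-n], and the weighted integral of
   the sum over n of the first term is finite. *)
Lemma cvg_weighted_sq (u : nat -> R -> R) (C : R) :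
  (forall n, measurable_fun setT (u n)) ->
  (forall n, (\int[mu]_s ((u n.+1 s - u n s) ^+ 2 * weight s)%:E <= (C * (2^-1 ^+ n) ^+ 2)%:E)%E) ->
  {ae mu, forall s, s != 0 -> cvgn (u^~ s)}.
Proof.
move=> mu_ uC.
have C0 : 0 <= C.
  have := uC 0%N; rewrite expr0 expr1n mulr1 -lee_fin; apply: le_trans.
  by apply: integral_ge0 => s _; rewrite lee_fin mulr_ge0 ?sqr_ge0 ?weight_ge0.
pose v n s := 2 ^+ n * ((u n.+1 s - u n s) ^+ 2 * weight s).
have v0 n s : 0 <= v n s by rewrite mulr_ge0 ?exprn_ge0 // mulr_ge0 ?sqr_ge0 ?weight_ge0.
have md n : measurable_fun setT (fun s => (u n.+1 s - u n s) ^+ 2 * weight s).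
  apply: measurable_funM; last exact: measurable_weight.
  by apply: measurable_funX; exact: measurable_funB.
have mv n : measurable_fun setT (v n) by apply: measurable_funM => //; exact: measurable_cst.
have mve n : measurable_fun setT (EFin \o v n) by exact/measurable_EFinP.
pose S : R -> \bar R := fun s => (\sum_(0 <= n <oo) (v n s)%:E)%E.
have mS : measurable_fun setT S.
  apply: (@ge0_emeasurable_sum _ _ _ _ (fun n s => (v n s)%:E) xpredT).
    by move=> n s _ _; rewrite lee_fin.
  by move=> n _; exact: mve.
have S0 s : (0 <= S s)%E by apply: nneseries_ge0 => n _ _; rewrite lee_fin.
have intv n : (\int[mu]_s (v n s)%:E <= (C * 2^-1 ^+ n)%:E)%E.
  under eq_integral do rewrite EFinM.
  rewrite ge0_integralZl //; last 2 first.
    by apply/measurable_EFinP; exact: md.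
    by move=> s _; rewrite lee_fin mulr_ge0 ?sqr_ge0 ?weight_ge0.
  apply: (@le_trans _ _ ((2 ^+ n)%:E * (C * (2^-1 ^+ n) ^+ 2)%:E)%E).
    by apply: lee_wpmul2l; rewrite ?lee_fin ?exprn_ge0.
  rewrite -EFinM lee_fin.
  have -> : 2 ^+ n * (C * (2^-1 ^+ n) ^+ 2) = C * 2^-1 ^+ n * (2 ^+ n * 2^-1 ^+ n) by rewrite expr2; ring.
  by rewrite -exprMn divff // expr1n mulr1.
have intS : (\int[mu]_s S s <= (C * 2)%:E)%E.
  rewrite integral_nneseries // => [|n s _]; last by rewrite lee_fin.
  apply: lime_le.
    by apply: is_cvg_nneseries => n _ _; apply: integral_ge0 => s _; rewrite lee_fin.
  apply: nearW => n; apply: (@le_trans _ _ (\sum_(0 <= k < n) (C * 2^-1 ^+ k)%:E)%E).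
    exact: lee_sum.
  by rewrite sumEFin lee_fin -mulr_sumr ler_wpM2l // geometric_half_sum.
have iS : mu.-integrable setT S.
  apply/integrableP; split => //.
  under eq_integral do rewrite gee0_abs //.
  by apply: le_lt_trans intS _; rewrite ltry.
have := integrable_ae measurableT iS; apply: filterS => s /(_ I) Sfin s0.
(* The bound on the differences divides by the weight, which vanishes at 0; this is why that point
   is set apart. *)
have w0 := weight_gt0 s0.
pose d n := u n.+1 s - u n s.
have dS n : \sum_(0 <= k < n) `|d k| <= fine (S s) / weight s + 2.
  apply: (@le_trans _ _ (\sum_(0 <= k < n) (v k s / weight s + 2^-1 ^+ k))).
    apply: ler_sum => k _; rewrite /v mulrA mulfK ?gt_eqF // -/(d k).
    rewrite -(real_normK (num_real (d k))).
    have h0 : 0 < 2 ^+ k :> R by rewrite exprn_gt0.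
    rewrite exprVn -(ler_pM2l h0) mulrDr divff ?gt_eqF // .
    have := normr_ge0 (d k); set x := `|d k|; set h := 2 ^+ k in h0 *.
    have := sqr_ge0 (h * x - 1); nra.
  rewrite big_split /=; apply: lerD; last exact: geometric_half_sum.
  rewrite -mulr_suml ler_wpM2r ?invr_ge0 ?weight_ge0 //.
  rewrite -lee_fin fineK // -sumEFin.
  by apply: nneseries_lim_ge => k _; rewrite lee_fin.
have cd : cvgn (series d).
  apply: normed_cvg; apply: nondecreasing_is_cvgn.
    by apply: nondecreasing_series => n _ _; exact: normr_ge0.
  by exists (fine (S s) / weight s + 2) => _ [n _ <-]; exact: dS.
have -> : u^~ s = (fun n => u 0%N s + series d n).
  apply/funext => n; rewrite /series /=.
  by elim: n => [|n IH]; [rewrite big_geq // addr0|rewrite big_nat_recr //= addrA -IH /d addrC subrK].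
by apply: is_cvgD => //; exact: is_cvg_cst.
Qed.

Lemma even_L2_normE f : even_L2 f ->
  (\int[mu]_s (weighted_sq f s)%:E = (pi / 2 * ip_norm (@even_L2_inner R) f ^+ 2)%:E)%E.
Proof.
move=> Hf; rewrite (ip_normE even_L2_semi_inner) // even_L2_inner_norm //.
have p0 : pi != 0 :> R := lt0r_neq0 (pi_gt0 R).
rewrite mulrA; have -> : pi / 2 * (2 / pi) = 1 :> R by rewrite mulrA divfK // divff.
by rewrite mul1r /Rintegral fineK //; apply: integrable_fin_num => //; exact: even_L2_integrable.
Qed.

Lemma limn_einf_le (u : (\bar R)^nat) c : (forall n, (u n <= c)%E) -> (limn_einf u <= c)%E.
Proof.
move=> uc; rewrite limn_einf_lim; apply: lime_le; first exact: is_cvg_einfs.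
apply: nearW => n; apply: le_trans (uc n); apply: ereal_inf_lbound.
by exists n => //=.
Qed.

Lemma fine_limn_esup_cvg (u : R^nat) : cvgn u ->
  u @ \oo --> fine (limn_esup (fun n => (u n)%:E)).
Proof.
move=> cu; have cE : (fun n => (u n)%:E) @ \oo --> (limn u)%:E by apply: cvg_EFin => //; exact: nearW.
by have [_ ->] := cvg_limn_einf_sup cE.
Qed.

(** The Riesz-Fischer argument: geometric steps give convergence almost everywhere, and Fatou's
    lemma turns the tail bounds into a bound on the distance to the pointwise limit. *)
Lemma even_L2_complete : ip_complete (@even_L2 R) (@even_L2_inner R).
Proof.
move=> f Hf fN; pose N := ip_norm (@even_L2_inner R).
have sip := even_L2_semi_inner.
have Hd n m : even_L2 (f n - f m) := shB sip (Hf n) (Hf m).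
have fm n : complex_measurable (f n) by have [] := Hf n.
(* An upper limit exists at every point, so measurability and evenness hold without reference to
   convergence; where the sequence converges it is the limit. *)
pose p s := Complex (fine (limn_esup (fun n => (RE (f n s))%:E)))
  (fine (limn_esup (fun n => (IM (f n s))%:E))).
have mp : complex_measurable p.
  split; apply: (measurableT_comp (fine_measurable measurableT));
  apply: measurable_fun_limn_esup => n; apply/measurable_EFinP; by have [] := fm n.
have ep s : p (- s) = p s.
  rewrite /p; congr (Complex (fine (limn_esup _)) (fine (limn_esup _)));
  by apply/funext => n; have [_ -> _] := Hf n.
have intd n : (\int[mu]_s (weighted_sq (f n.+1 - f n) s)%:E <= (pi / 2 * (2^-1 ^+ n) ^+ 2)%:E)%E.
  rewrite even_L2_normE // lee_fin ler_wpM2l ?divr_ge0 ?pi_ge0 //.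
  by rewrite lerXn2r ?nnegrE ?ip_norm_ge0 ?exprn_ge0 // invr_ge0.
have mre n : measurable_fun setT (fun s => RE (f n s)) by have [] := fm n.
have mim n : measurable_fun setT (fun s => IM (f n s)) by have [] := fm n.
have cre : {ae mu, forall s, s != 0 -> cvgn (fun n => RE (f n s))}.
  apply: (@cvg_weighted_sq (fun n s => RE (f n s)) (pi / 2)) => // n.
  apply: le_trans (intd n); apply: ge0_le_integral => //.
  - by move=> s _; rewrite lee_fin mulr_ge0 ?sqr_ge0 ?weight_ge0.
  - apply/measurable_EFinP; apply: measurable_funM; last exact: measurable_weight.
    by apply: measurable_funX; exact: (measurable_funB (mre n.+1) (mre n)).
  - by apply/measurable_EFinP; apply: measurable_weighted_sq; have [] := Hd n.+1 n.
  - move=> s _; rewrite lee_fin /weighted_sq ler_wpM2r ?weight_ge0 // sqr_normcE -ReB.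
    by rewrite lerDl sqr_ge0.
have cim : {ae mu, forall s, s != 0 -> cvgn (fun n => IM (f n s))}.
  apply: (@cvg_weighted_sq (fun n s => IM (f n s)) (pi / 2)) => // n.
  apply: le_trans (intd n); apply: ge0_le_integral => //.
  - by move=> s _; rewrite lee_fin mulr_ge0 ?sqr_ge0 ?weight_ge0.
  - apply/measurable_EFinP; apply: measurable_funM; last exact: measurable_weight.
    by apply: measurable_funX; exact: (measurable_funB (mim n.+1) (mim n)).
  - by apply/measurable_EFinP; apply: measurable_weighted_sq; have [] := Hd n.+1 n.
  - move=> s _; rewrite lee_fin /weighted_sq ler_wpM2r ?weight_ge0 // sqr_normcE.
    rewrite -[X in X <= _]add0r; apply: lerD; rewrite ?sqr_ge0 //.
    by rewrite /GRing.add /= /GRing.opp /=; case: (f n.+1 s) => ? ?; case: (f n s).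
have tail n m : N (f (n + m)%N - f n) <= 2 * 2^-1 ^+ n.
  have : N (f (n + m)%N - f n) <= 2^-1 ^+ n * \sum_(0 <= k < m) 2^-1 ^+ k.
    elim: m => [|m IH].
      by rewrite addn0 subrr /N (ip_norm0 sip) big_geq // mulr0.
    rewrite big_nat_recr //= mulrDr addnS.
    apply: le_trans (ip_norm_tri sip (Hf _) (Hf _) (Hf (n + m)%N)) _.
    by rewrite addrC lerD // -exprD.
  by move/le_trans; apply; rewrite mulrC ler_wpM2r ?geometric_half_sum //.
have mfp n : complex_measurable (f n - p).
  have := complex_measurable_lin (-1) mp (fm n).
  by rewrite scaleN1r addrC.
have mdn n m : complex_measurable (f n - f m) by have [] := Hd n m.
(* Fatou's lemma for the sequence [weighted_sq (f n - f (n + m))] in [m], whose integrals are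
   bounded by [tail] uniformly in [m]. *)
have est n : (\int[mu]_s (weighted_sq (f n - p) s)%:E <= (pi / 2 * (2 * 2^-1 ^+ n) ^+ 2)%:E)%E.
  have -> : (\int[mu]_s (weighted_sq (f n - p) s)%:E =
    \int[mu]_s limn_einf (fun m => (weighted_sq (f n - f (n + m)%N) s)%:E))%E.
    apply: ge0_ae_eq_integral => //.
    - by apply/measurable_EFinP; exact: measurable_weighted_sq.
    - under eq_fun do rewrite -[limn_einf _]oppeK -limn_esupN.
      apply: measurableT_comp => //; apply: measurable_fun_limn_esup => m /=.
      have mw := measurable_weighted_sq (mdn n (n + m)%N).
      by apply/measurable_EFinP; apply: measurableT_comp.
    - by move=> s _; rewrite lee_fin weighted_sq_ge0.
    - move=> s _; rewrite limn_einf_lim; apply: lime_ge; first exact: is_cvg_einfs.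
      by apply: nearW => k; apply: le_ereal_inf_tmp => _ [m _ <-]; rewrite lee_fin weighted_sq_ge0.
    - move: cre cim; apply: (@filterS2 _ _ (ae_filter_ringOfSetsType mu)) => s cr ci _.
      (* At 0 convergence is unknown, but both sides carry the factor [weight 0 = 0]. *)
      have [->|s0] := eqVneq s 0.
        have w0 : weight 0 = 0 :> R by rewrite /weight mulr0 mul0r.
        rewrite /weighted_sq w0 mulr0; under eq_fun do rewrite mulr0.
        by apply/esym; apply: (cvg_limn_einf_sup _).1; exact: cvg_cst.
      have {}cr := fine_limn_esup_cvg (cr s0).
      have {}ci := fine_limn_esup_cvg (ci s0).
      have sh (u : R^nat) (l : R) : u @ \oo --> l -> (fun m => u (n + m)%N) @ \oo --> l.
        by move=> ul; under eq_fun do rewrite addnC; move: ul; rewrite -(cvg_shiftn n).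
      have hr : (fun m => RE (f n s) - RE (f (n + m)%N s)) @ \oo --> RE (f n s) - RE (p s).
        by apply: cvgB; [exact: cvg_cst|exact: (sh (fun m => RE (f m s)) _ cr)].
      have hi : (fun m => IM (f n s) - IM (f (n + m)%N s)) @ \oo --> IM (f n s) - IM (p s).
        by apply: cvgB; [exact: cvg_cst|exact: (sh (fun m => IM (f m s)) _ ci)].
      apply/esym; apply: (cvg_limn_einf_sup _).1; apply: cvg_EFin; first exact: nearW.
      rewrite /weighted_sq /=; under eq_fun do rewrite sqr_normcE; rewrite sqr_normcE.
      apply: cvgM; last exact: cvg_cst.
      have E1 m : RE ((f n - f (n + m)%N) s) = RE (f n s) - RE (f (n + m)%N s) by rewrite -ReB.
      have E2 g : IM ((f n - g) s) = IM (f n s) - IM (g s).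
        by rewrite /GRing.add /= /GRing.opp /=; case: (f n s) => ? ?; case: (g s).
      have E3 : RE ((f n - p) s) = RE (f n s) - RE (p s) by rewrite -ReB.
      under eq_fun do rewrite E1 E2; rewrite E2 E3.
      apply: cvgD; rewrite !expr2; under eq_fun do rewrite expr2.
        exact: (cvgM hr hr).
      exact: (cvgM hi hi).
  apply: le_trans (fatou _ _ _ _) _ => //.
  - by move=> m; apply/measurable_EFinP; exact: measurable_weighted_sq.
  - by move=> m s _; rewrite lee_fin weighted_sq_ge0.
  apply: limn_einf_le => m; rewrite even_L2_normE // lee_fin ler_wpM2l ?divr_ge0 ?pi_ge0 //.
  have := tail n m; rewrite /N (ip_normBC sip) // => t.
  by rewrite lerXn2r ?nnegrE ?ip_norm_ge0 ?mulr_ge0 ?exprn_ge0 // invr_ge0.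
have Hfp n : even_L2 (f n - p).
  split=> //.
    by move=> s; have [_ e _] := Hf n; rewrite /GRing.add /= /GRing.opp /= e ep.
  by apply: le_lt_trans (est n) _; rewrite ltry.
have Hp : even_L2 p.
  by have := shB sip (Hf 0%N) (Hfp 0%N); rewrite opprB addrC subrK.
exists p => // eps e0.
have [n0 hn0] := half_pow_small (divr_gt0 e0 (ltr0n _ 2)).
exists n0 => n n0n.
have : N (f n - p) <= 2 * 2^-1 ^+ n.
  have := est n; rewrite even_L2_normE // lee_fin ler_pM2l ?divr_gt0 ?pi_gt0 //.
  by rewrite ler_sqr ?nnegrE ?ip_norm_ge0 // mulr_ge0 // exprn_ge0 // invr_ge0.
move/le_lt_trans; apply; rewrite mulrC -ltr_pdivlMr //; apply: le_lt_trans hn0.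
by rewrite ler_wiXn2l // ?invr_ge0 // invf_le1 // ler1n.
Qed.

End WeightedL2.

(** * Integrability from power decay at infinity *)

Section PowerDecay.
Context {R : realType}.
Local Notation mu := (@lebesgue_measure R).

Lemma powR_onem_cvgy0 (e : R) : 0 < e -> (1 + x) `^ (- e) @[x --> +oo] --> (0 : R).
Proof.
move=> e0; apply/cvgrPdist_le => d d0; near=> x.
rewrite sub0r normrN ger0_norm ?powR_ge0 // powRN.
have xX : d^-1 `^ e^-1 <= x by near: x; apply: nbhs_pinfty_ge; rewrite num_real.
have X0 : 0 < d^-1 `^ e^-1 by rewrite powR_gt0 // invr_gt0.
rewrite invf_ple ?posrE ?powR_gt0 //; last lra.
have -> : d^-1 = (d^-1 `^ e^-1) `^ e.
  by rewrite -powRrM mulVf ?gt_eqF // powRr1 // invr_ge0 ltW.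
by apply: ge0_ler_powR; rewrite ?nnegrE; lra.
Unshelve. all: by end_near. Qed.

Lemma is_derive_powR_shift (a x : R) : 0 <= x ->
  is_derive x 1 (fun x : R => (1 + x) `^ a) (a * (1 + x) `^ (a - 1)).
Proof.
move=> x0; have x1 : 0 < 1 + x by lra.
have h := is_derive1_powR a x1.
have h1 : is_derive x 1 (fun x : R => 1 + x) 1.
  by rewrite -[X in is_derive _ _ _ X]add0r; apply: is_deriveD.
by have := is_derive1_comp h h1; rewrite mulr1.
Qed.

Lemma continuous_powR_abs (a : R) : continuous (fun x : R => (1 + `|x|) `^ a).
Proof.
move=> x; have x1 : 0 < 1 + `|x| by rewrite ltr_pwDl.
have h := is_derive1_powR a x1.
have c : {for (1 + `|x|), continuous (fun y : R => y `^ a)}.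
  by apply: differentiable_continuous; apply/derivable1_diffP; case: h.
apply: (@continuous_comp _ _ _ (fun x : R => 1 + `|x|) (fun y : R => y `^ a)) => //.
by apply: cvgD; [exact: cvg_cst|exact: norm_continuous].
Qed.

Lemma integrable_power_decay (e : R) : 0 < e ->
  mu.-integrable setT (EFin \o (fun x : R => (1 + `|x|) `^ (- 1 - e))).
Proof.
move=> e0; have cont := @continuous_powR_abs (- 1 - e).
have k0 (x : R) : 0 <= (1 + `|x|) `^ (- 1 - e) by exact: powR_ge0.
apply/integrableP; split.
  by apply/measurable_EFinP; exact: continuous_measurable_fun.
under eq_integral do rewrite /= ger0_norm //.
rewrite ge0_symfun_integralT //; last by move=> x /=; rewrite normrN.
have -> : [set x : R | 0 <= x] = `[0, +oo[%classic.
  by apply/seteqP; split=> x /=; rewrite in_itv /= andbT.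
rewrite (@ge0_continuous_FTC2y _ _ (fun x => - e^-1 * (1 + x) `^ (- e)) 0 0) //.
- by rewrite -EFinB -EFinM ltry.
- by apply: continuous_subspaceT.
- rewrite -(mulr0 (- e^-1)); apply: cvgM; first exact: cvg_cst.
  exact: powR_onem_cvgy0.
- move=> x x0; have [h _] := is_derive_powR_shift (- e) (ltW x0).
  by apply: derivableM => //; exact: derivable_cst.
- have [h _] := is_derive_powR_shift (- e) (lexx 0).
  have c : {for 0, continuous (fun x : R => (1 + x) `^ (- e))}.
    by apply: differentiable_continuous; apply/derivable1_diffP.
  by apply: cvg_at_right_filter; apply: cvgM; [exact: cvg_cst|exact: c].
- move=> x; rewrite in_itv /= andbT => x0; rewrite derive1E.
  have h := is_derive_powR_shift (- e) (ltW x0).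
  rewrite derive_val ?scaler0 ?add0r.
  rewrite /GRing.scale /= ger0_norm ?ltW //.
  have -> : - e - 1 = - 1 - e by ring.
  by field; rewrite gt_eqF.
Qed.

(** One multiple of [(1 + |x|)^(-1-e)], which has no singularity at 0, dominates everywhere: [K']
    takes care of the compact part, and [C'] of the tail, where [1 + |x| <= 2 |x|] accounts for the
    factor [2^(1+e)]. *)
Lemma continuous_decay_integrable (f : R -> R) (C M e : R) : 0 < e -> continuous f ->
  (forall x, M <= `|x| -> `|f x| <= C * `|x| `^ (- 1 - e)) ->
  mu.-integrable setT (EFin \o f).
Proof.
move=> e0 cf fC; pose m := Num.max M 1.
have m1 : 1 <= m by rewrite /m le_max lexx orbT.
have mM : M <= m by rewrite /m le_max lexx.
have [K K0 fK] : exists2 K, 0 <= K & forall x, `|x| <= m -> `|f x| <= K.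
  have [||c _ cP] := @EVT_max R (fun x => `|f x|) (- m) m; first lra.
    by apply: continuous_subspaceT => x; apply: cvg_norm; exact: cf.
  exists `|f c| => // x; rewrite ler_norml => xm; apply: cP; by rewrite in_itv.
have p1 : 0 < (1 + m) `^ (- 1 - e) by rewrite powR_gt0; lra.
pose K' := K / (1 + m) `^ (- 1 - e).
pose C' := `|C| * 2 `^ (1 + e).
apply: (@integrable_Rdom _ _ (fun x => (K' + C') * (1 + `|x|) `^ (- 1 - e))).
- exact: continuous_measurable_fun.
- have K'0 : 0 <= K' by rewrite divr_ge0 // ltW.
  have C'0 : 0 <= C' by rewrite mulr_ge0 ?powR_ge0.
  move=> x; have px : 0 <= (1 + `|x|) `^ (- 1 - e) by exact: powR_ge0.
  have x0 := normr_ge0 x.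
  have [xm|xm] := leP `|x| m.
    apply: le_trans (fK x xm) _.
    rewrite mulrDl -[K]addr0; apply: lerD; last exact: mulr_ge0.
    rewrite /K' mulrAC ler_pdivlMr // ler_wpM2l //.
    have -> : - 1 - e = - (1 + e) by ring.
    rewrite !powRN lef_pV2 ?posrE ?powR_gt0 //; try lra.
    by apply: ge0_ler_powR; rewrite ?nnegrE; lra.
  have Mx : M <= `|x| by lra.
  apply: le_trans (fC x Mx) _.
  rewrite mulrDl -[C * _]add0r; apply: lerD; first exact: mulr_ge0.
  apply: (@le_trans _ _ (`|C| * `|x| `^ (- 1 - e))).
    by rewrite ler_wpM2r ?powR_ge0 // ler_norm.
  rewrite /C' -mulrA ler_wpM2l //.
  have -> : - 1 - e = - (1 + e) by ring.
  have p2 : 0 < (1 + `|x|) `^ (1 + e) by rewrite powR_gt0; lra.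
  have p3 : 0 < `|x| `^ (1 + e) by rewrite powR_gt0; lra.
  rewrite !powRN ler_pdivlMr // mulrC ler_pdivrMr //.
  rewrite -powRM; try lra.
  by apply: ge0_ler_powR; rewrite ?nnegrE; lra.
- by apply: integrable_RZ; exact: integrable_power_decay.
Qed.

Lemma Rintegral_dominated_cvg (f_ : nat -> R -> R) (f g : R -> R) :
  (forall n, measurable_fun setT (f_ n)) -> measurable_fun setT f ->
  {ae mu, forall x, f_ n x @[n --> \oo] --> f x} ->
  mu.-integrable setT (EFin \o g) -> (forall n x, `|f_ n x| <= g x) ->
  \int[mu]_x f_ n x @[n --> \oo] --> \int[mu]_x f x.
Proof.
move=> mf_ mf fcv gi dom.
have [|||||fi _ cv] := @dominated_convergence _ _ _ mu setT measurableT (fun n => EFin \o f_ n)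
  (EFin \o f) (EFin \o g).
- by move=> n; apply/measurable_EFinP; exact: mf_.
- exact/measurable_EFinP.
- apply: (@filterS _ _ (ae_filter_ringOfSetsType mu)) fcv => x cx _.
  by apply/cvg_EFin; [exact: nearW|].
- exact: gi.
- by apply: aeW => x n _; rewrite /= lee_fin dom.
have fin : (\int[mu]_x (EFin \o f) x)%E \is a fin_num by exact: integrable_fin_num.
by move: cv; rewrite -(fineK fin) => /fine_cvg.
Qed.

Lemma Rintegral_itv_cvg (f : R -> R) : mu.-integrable setT (EFin \o f) ->
  \int[mu]_(x in `[- n%:R, n%:R]) f x @[n --> \oo] --> \int[mu]_x f x.
Proof.
move=> fi; have fm : measurable_fun setT f.
  by apply/measurable_EFinP; case/integrableP : fi.
under eq_fun do rewrite Rintegral_mkcond.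
apply: (@Rintegral_dominated_cvg _ _ (fun x => `|f x|)) => //.
- by move=> n; apply/measurable_restrict => //; apply: measurable_funS fm.
- apply: aeW => x; apply/cvgrPdist_lt => e e0; near=> n.
  rewrite patchE ifT ?subrr ?normr0 //; apply/mem_set => /=.
  by rewrite in_itv /= -ler_norml; near: n; exact: nbhs_infty_ger.
- by have := integrable_abse fi; apply: eq_integrable.
- by move=> n x; rewrite patchE; case: ifP => // _; rewrite normr0.
Unshelve. all: by end_near. Qed.

End PowerDecay.

(** * Complex differentiation and contour shifts *)

Section ComplexDerivative.
Context {R : realType}.
Implicit Types (z w h l : R[i]) (F : R[i] -> R[i]).
Local Notation RE z := (complex.Re z).
Local Notation IM z := (complex.Im z).

Lemma normrcE z : `|z| = (normc z)%:C%C.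
Proof. by case: z. Qed.

Lemma normcM z w : normc (z * w) = normc z * normc w.
Proof. exact: ComplexField.Normc.normcM. Qed.

Lemma normcN z : normc (- z) = normc z.
Proof. by case: z => x y /=; rewrite !sqrrN. Qed.

Lemma normcD z w : normc (z + w) <= normc z + normc w.
Proof. by have := ler_normD z w; rewrite !normrcE -rmorphD lecR. Qed.

Lemma normcB z w : normc (z - w) <= normc z + normc w.
Proof. by rewrite -(normcN w); exact: normcD. Qed.

Lemma normcV z : normc z^-1 = (normc z)^-1.
Proof. exact: ComplexField.Normc.normcV. Qed.

Lemma normc_conj z : normc z^*%C = normc z.
Proof. by case: z => x y /=; rewrite sqrrN. Qed.

Lemma normc_real (x : R) : normc x%:C%C = `|x|.
Proof. by rewrite /= expr0n addr0 sqrtr_sqr. Qed.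

Lemma normc_i : normc ('i%C : R[i]) = 1.
Proof. by rewrite /= expr0n add0r expr1n sqrtr1. Qed.

Lemma normc_eq0 z : (normc z == 0) = (z == 0).
Proof.
apply/eqP/eqP => [|->]; first exact: ComplexField.Normc.eq0_normc.
exact: ComplexField.Normc.normc0.
Qed.

Lemma normc_gt0 z : (0 < normc z) = (z != 0).
Proof. by rewrite lt_neqAle normc_ge0 andbT eq_sym normc_eq0. Qed.

Lemma normRe_le z : `|RE z| <= normc z.
Proof. by have := normc_ge_Re z; rewrite normrcE lecR. Qed.

Lemma normIm_le z : `|IM z| <= normc z.
Proof.
case: z => x y /=; rewrite -(sqrtr_sqr y) ler_wsqrtr // lerDr sqr_ge0 //.
Qed.

Lemma normc_le_add z : normc z <= `|RE z| + `|IM z|.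
Proof.
rewrite [z in X in X <= _]complexE; apply: le_trans (normcD _ _) _.
by rewrite normcM normc_i mul1r !normc_real.
Qed.

(** Complex differentiability with real tolerances: the norm of [R[i]] takes its values in [R[i]],
    whereas [normc] is real and fits the estimates by real functions. *)
Definition cdiff F z l := forall e : R, 0 < e -> exists2 d : R, 0 < d &
  forall h, normc h < d -> normc (F (z + h) - F z - l * h) <= e * normc h.

Lemma derivable_cdiff F z :
  derivable (F : R[i]^o -> R[i]^o) z 1 <-> exists l, cdiff F z l.
Proof.
split.
- case/cvg_ex => l /cvgrPdist_le lF; exists l => e e0.
  have e0' : 0 < e%:C%C :> R[i] by rewrite ltcR.
  have /nbhs_ballP [d /= d0 dF] := lF _ e0'.
  have dE : d = (RE d)%:C%C by move: d0; rewrite ltcE => /andP[/eqP d1 _]; case: (d) d1 => x y /= ->.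
  exists (RE d); first by move: d0; rewrite ltcE => /andP[].
  move=> h hd; have [->|h0] := eqVneq h 0.
    by rewrite addr0 subrr mulr0 subr0 ComplexField.Normc.normc0 mulr0.
  have := dF h; rewrite /ball /= sub0r normrN normrcE dE ltcR => /(_ hd h0).
  rewrite normrcE lecR => {}dF.
  have -> : F (z + h) - F z - l * h = - (h * (l - h^-1 *: (F (h *: 1 + z) - F z))).
    rewrite /GRing.scale /= mulr1 [h + z]addrC mulrBr mulrA divff // mul1r.
    by rewrite [l * h]mulrC opprB.
  by rewrite normcN normcM mulrC ler_wpM2r ?normc_ge0.
- case=> l lF; apply/cvg_ex; exists l; apply/cvgrPdist_le => e e0.
  (* Positivity in [R[i]] includes a vanishing imaginary part, so [e] is a real number in
     disguise. *)
  have eE : e = (RE e)%:C%C by move: e0; rewrite ltcE => /andP[/eqP d1 _]; case: (e) d1 => x y /= ->.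
  have e1 : 0 < RE e by move: e0; rewrite ltcE => /andP[].
  have [d d0 dF] := lF _ e1.
  apply/nbhs_ballP; exists d%:C%C => /=; first by rewrite ltcR.
  move=> h; rewrite /ball /= sub0r normrN normrcE ltcR => hd h0.
  rewrite eE normrcE lecR.
  have hp : 0 < normc h by rewrite normc_gt0.
  rewrite -(ler_pM2r hp); apply: le_trans (dF h hd).
  rewrite -normcM -normcN le_eqVlt; apply/orP; left; apply/eqP; congr (normc _).
  rewrite /GRing.scale /= mulr1 [h + z]addrC mulrBl mulrAC mulVf // mul1r.
  by rewrite opprB.
Qed.

Lemma cdiff_eq_near F G z l (d : R) : 0 < d ->
  (forall h, normc h < d -> F (z + h) = G (z + h)) -> cdiff G z l -> cdiff F z l.
Proof.
move=> d0 FG dG e e0; have [d' d'0 h'] := dG e e0.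
exists (Num.min d d'); first by rewrite lt_min d0.
move=> h; rewrite lt_min => /andP[hd hd'].
have := FG 0; rewrite ComplexField.Normc.normc0 addr0 => /(_ d0) ->.
by rewrite FG //; exact: h'.
Qed.

Lemma cdiff_shift F z a l : cdiff F (z + a) l -> cdiff (fun w => F (w + a)) z l.
Proof.
move=> dF e e0; have [d d0 h0] := dF e e0; exists d => // h hd.
have -> : z + h + a = z + a + h by ring.
exact: h0.
Qed.

Lemma cdiff_opp F z l : cdiff F (- z) l -> cdiff (fun w => F (- w)) z (- l).
Proof.
move=> dF e e0; have [d d0 h0] := dF e e0; exists d => // h hd.
by have := h0 (- h); rewrite normcN -opprD mulrN mulNr => /(_ hd).
Qed.

Lemma cdiff_scale F z a l : cdiff F (a * z) l -> cdiff (fun w => F (a * w)) z (a * l).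
Proof.
move=> dF e e0; pose c := normc a + 1.
have c0 : 0 < c by have := normc_ge0 a; rewrite /c; lra.
have [d d0 h0] := dF (e / c) (divr_gt0 e0 c0).
exists (d / c); first exact: divr_gt0.
move=> h; rewrite ltr_pdivlMr // => hd.
have ah : normc (a * h) <= normc h * c.
  by rewrite normcM mulrC ler_wpM2l ?normc_ge0 // /c lerDl.
have := h0 (a * h) (le_lt_trans ah hd); rewrite -mulrDr [a * l * h]mulrAC [a * h * l]mulrC.
move/le_trans; apply; apply: le_trans (ler_wpM2l _ ah) _; first by rewrite divr_ge0 ?ltW.
by rewrite [normc h * c]mulrC mulrA divfK ?gt_eqF.
Qed.

Lemma cdiff_conj F z l : cdiff F z^*%C l -> cdiff (fun w => (F w^*%C)^*%C) z l^*%C.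
Proof.
move=> dF e e0; have [d d0 h0] := dF e e0; exists d => // h hd.
have cB (x y : R[i]) : (x - y)^*%C = x^*%C - y^*%C by exact: rmorphB.
have cD (x y : R[i]) : (x + y)^*%C = x^*%C + y^*%C by exact: rmorphD.
have := h0 h^*%C; rewrite normc_conj => /(_ hd).
by rewrite -normc_conj !cB conjcM conjcK cD.
Qed.

Lemma cdiffM F G z l m : cdiff F z l -> cdiff G z m ->
  exists k, cdiff (fun w => F w * G w) z k.
Proof.
move=> dF dG; apply/derivable_cdiff.
by apply: derivableM; apply/derivable_cdiff; [exists l|exists m].
Qed.

Lemma cdiffD F G z l m : cdiff F z l -> cdiff G z m ->
  exists k, cdiff (fun w => F w + G w) z k.
Proof.
move=> dF dG; apply/derivable_cdiff.
by apply: derivableD; apply/derivable_cdiff; [exists l|exists m].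
Qed.

Lemma cdiffV F z l : F z != 0 -> cdiff F z l -> exists k, cdiff (fun w => (F w)^-1) z k.
Proof.
move=> Fz dF; apply/derivable_cdiff.
by apply: (@derivableV _ (R[i]^o)) => //; apply/derivable_cdiff; exists l.
Qed.

Lemma cdiff_cst c z : cdiff (fun=> c) z 0.
Proof.
move=> e e0; exists 1 => // h _.
by rewrite subrr mul0r subr0 ComplexField.Normc.normc0 mulr_ge0 ?normc_ge0 // ltW.
Qed.

Lemma cdiff_id z : cdiff id z 1.
Proof.
move=> e e0; exists 1 => // h _.
have -> : z + h - z - 1 * h = 0 by ring.
by rewrite ComplexField.Normc.normc0 mulr_ge0 ?normc_ge0 // ltW.
Qed.

(** One half of the Cauchy-Riemann equations, read off from the real part of [l (h + i k)];
    [cdiff_im] is the other half. *)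
Lemma cdiff_re F (x y : R) l : cdiff F (Complex x y) l ->
  differentiable2 (fun x y => RE (F (Complex x y))) x y (RE l) (- IM l).
Proof.
move=> dF e e0; have [d d0 hd] := dF e e0.
exists (d / 2); first by rewrite divr_gt0.
move=> h k hh kk; have n := normc_le_add (Complex h k); rewrite /= in n.
have := hd (Complex h k) (le_lt_trans n _) => /(_ _)/wrap[]; first by lra.
move=> est; apply: le_trans (_ : e * normc (Complex h k) <= _); last first.
  by rewrite ler_wpM2l // ltW.
apply: le_trans est; apply: le_trans (normRe_le _).
rewrite le_eqVlt; apply/orP; left; apply/eqP; congr (`|_|).
have -> : Complex x y + Complex h k = Complex (x + h) (y + k) by [].
case: (F _) => a b; case: (F _) => a' b'; case: (l) => p q /=; ring.
Qed.

Lemma cdiff_im F (x y : R) l : cdiff F (Complex x y) l ->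
  differentiable2 (fun x y => IM (F (Complex x y))) x y (IM l) (RE l).
Proof.
move=> dF e e0; have [d d0 hd] := dF e e0.
exists (d / 2); first by rewrite divr_gt0.
move=> h k hh kk; have n := normc_le_add (Complex h k); rewrite /= in n.
have := hd (Complex h k) (le_lt_trans n _) => /(_ _)/wrap[]; first by lra.
move=> est; apply: le_trans (_ : e * normc (Complex h k) <= _); last first.
  by rewrite ler_wpM2l // ltW.
apply: le_trans est; apply: le_trans (normIm_le _).
rewrite le_eqVlt; apply/orP; left; apply/eqP; congr (`|_|).
have -> : Complex x y + Complex h k = Complex (x + h) (y + k) by [].
case: (F _) => a b; case: (F _) => a' b'; case: (l) => p q /=; ring.
Qed.

Lemma differentiable2_opp (P : R -> R -> R) x y p q :
  differentiable2 P x y p q -> differentiable2 (fun x y => - P x y) x y (- p) (- q).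
Proof.
move=> dP e e0; have [d d0 hd] := dP e e0; exists d => // h k hh kk.
have := hd h k hh kk; rewrite -normrN; apply: le_trans.
by rewrite le_eqVlt; apply/orP; left; apply/eqP; congr (`|_|); ring.
Qed.

End ComplexDerivative.

(** * Moving the line of integration by i *)

Section ContourShift.
Context {R : realType}.
Local Notation mu := (@lebesgue_measure R).
Local Notation RE z := (complex.Re z).
Local Notation IM z := (complex.Im z).

(** Goursat's theorem on [[-n, n] x [0, 1]]: the two vertical sides together contribute at most
    [2 |C| / n^2], which tends to 0, and the horizontal sides tend to the two integrals. *)
Lemma closed_form_shift (P Q : R -> R -> R) (C M : R) :
  (forall x y, 0 <= y <= 1 -> exists p q r,
     differentiable2 P x y p q /\ differentiable2 Q x y q r) ->
  (forall x y, 0 <= y <= 1 -> M <= `|x| ->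
     `|P x y| <= C / x ^+ 2 /\ `|Q x y| <= C / x ^+ 2) ->
  [/\ mu.-integrable setT (EFin \o P^~ 0), mu.-integrable setT (EFin \o P^~ 1) &
      \int[mu]_x P x 0 = \int[mu]_x P x 1].
Proof.
move=> PQ PC.
have i0 : 0 <= (0 : R) <= 1 by rewrite lexx ler01.
have i1 : 0 <= (1 : R) <= 1 by rewrite lexx ler01.
have ci y : 0 <= y <= 1 -> mu.-integrable setT (EFin \o P^~ y).
  move=> y1; apply: (@continuous_decay_integrable _ _ C M 1) => //.
    by move=> x; have [p [q [r [dP _]]]] := PQ x y y1; exact: differentiable2_cont1 dP.
  move=> x Mx; have [h _] := PC x y y1 Mx; apply: le_trans h _.
  have -> : - 1 - 1 = - 2%:R :> R by ring.
  by rewrite powRN powR_mulrn // real_normK // num_real.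
split; [exact: ci|exact: ci|].
pose I n y := \int[mu]_(x in `[- n%:R, n%:R]) P x y : R.
have c0 : I n 0 @[n --> \oo] --> \int[mu]_x P x 0 by exact/Rintegral_itv_cvg/ci.
have c1 : I n 1 @[n --> \oo] --> \int[mu]_x P x 1 by exact/Rintegral_itv_cvg/ci.
have c2 : I n 0 - I n 1 @[n --> \oo] --> \int[mu]_x P x 0 - \int[mu]_x P x 1 by exact: cvgB.
apply/eqP; rewrite -subr_eq0; apply/eqP; apply: (cvg_unique _ c2) => //.
apply/cvgrPdist_le => e e0; near=> n.
have n1 : 1 <= n%:R :> R by near: n; exact: nbhs_infty_ger.
have nM : M <= n%:R by near: n; exact: nbhs_infty_ger.
have nC : 2 * `|C| / e <= n%:R by near: n; exact: nbhs_infty_ger.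
have nn : - n%:R <= n%:R :> R by lra.
have := goursat_rectangle nn ler01 (fun x y _ => PQ x y).
rewrite -/(I n 0) -/(I n 1).
have side (x : R) : `|x| = n%:R -> `|\int[mu]_(y in `[0, 1]) Q x y| <= `|C| / n%:R ^+ 2.
  move=> xn; have cQ : {in `[0, 1], continuous (Q x)}.
    move=> y; rewrite in_itv /= => y1; have [p [q [r [_ dQ]]]] := PQ x y y1.
    exact: differentiable2_cont2 dQ.
  have := @Rintegral_near_affine _ (Q x) 0 0 (`|C| / n%:R ^+ 2) 0 1 ler01 cQ.
  rewrite !mul0r !addr0 !subr0 mulr1; apply => y y1.
  rewrite mul0r addr0 subr0; have [|_ h] := PC x y y1; first by rewrite xn.
  apply: le_trans h _; rewrite -[x ^+ 2]real_normK ?num_real // xn.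
  by rewrite ler_wpM2r ?invr_ge0 ?sqr_ge0 // ler_norm.
have s1 := side _ (normr_nat R n).
have s2 := side (- n%:R) (etrans (normrN _) (normr_nat R n)).
move=> /eqP E.
have -> : 0 - (I n 0 - I n 1) =
  \int[mu]_(y in `[0, 1]) Q n%:R y - \int[mu]_(y in `[0, 1]) Q (- n%:R) y.
  by move/eqP: E; lra.
apply: le_trans (ler_normB _ _) _; apply: le_trans (lerD s1 s2) _.
have n0 : 0 < n%:R :> R by lra.
have -> : `|C| / n%:R ^+ 2 + `|C| / n%:R ^+ 2 = 2 * `|C| / n%:R ^+ 2 by ring.
apply: (@le_trans _ _ (2 * `|C| / n%:R)); last first.
  by rewrite ler_pdivrMr // [e * _]mulrC -ler_pdivrMr.
rewrite ler_wpM2l ?mulr_ge0 // lef_pV2 ?posrE ?exprn_gt0 //.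
by rewrite expr2 ler_peMl // ltW.
Unshelve. all: by end_near. Qed.

(** With [F = U + i V], the real and imaginary parts of [F dz] are [U dx - V dy] and [V dx + U dy];
    both are closed forms by the Cauchy-Riemann equations. *)
Theorem contour_shift (F : R[i] -> R[i]) (C M : R) :
  (forall z, 0 <= IM z <= 1 -> exists l, cdiff F z l) ->
  (forall z, 0 <= IM z <= 1 -> M <= `|RE z| -> normc (F z) <= C / RE z ^+ 2) ->
  [/\ cintegrable (fun s : R => F s%:C%C), cintegrable (fun s : R => F (s%:C%C + 'i%C)) &
   complex_integral (fun s : R => F s%:C%C) = complex_integral (fun s : R => F (s%:C%C + 'i%C))].
Proof.
move=> dF FC.
have [||r0 r1 rE] := @closed_form_shift (fun x y => RE (F (Complex x y)))
    (fun x y => - IM (F (Complex x y))) C M.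
- move=> x y y1; have [l dl] := dF (Complex x y) y1.
  exists (RE l), (- IM l), (- RE l); split; first exact: cdiff_re.
  exact/differentiable2_opp/cdiff_im.
- move=> x y y1 Mx; have h := FC (Complex x y) y1 Mx; rewrite normrN.
  by split; apply: le_trans h; [exact: normRe_le|exact: normIm_le].
have [||j0 j1 jE] := @closed_form_shift (fun x y => IM (F (Complex x y)))
    (fun x y => RE (F (Complex x y))) C M.
- move=> x y y1; have [l dl] := dF (Complex x y) y1.
  by exists (IM l), (RE l), (- IM l); split; [exact: cdiff_im|exact: cdiff_re].
- move=> x y y1 Mx; have h := FC (Complex x y) y1 Mx.
  by split; apply: le_trans h; [exact: normIm_le|exact: normRe_le].
have E (s : R) : s%:C%C + 'i%C = Complex s 1 by rewrite /GRing.add /= addr0 add0r.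
have FE : (fun s : R => F (s%:C%C + 'i%C)) = (fun s : R => F (Complex s 1)).
  by apply/funext => s; rewrite E.
by split; rewrite ?FE // /complex_integral rE jE.
Qed.

End ContourShift.

(** * Complex hyperbolic functions *)

Section ComplexExponential.
Context {R : realType}.
Implicit Types (z w h l : R[i]) (F : R[i] -> R[i]).
Local Notation RE z := (complex.Re z).
Local Notation IM z := (complex.Im z).

Definition cexp z : R[i] := Complex (expR (RE z) * cos (IM z)) (expR (RE z) * sin (IM z)).

Lemma cexpD z w : cexp (z + w) = cexp z * cexp w.
Proof.
case: z => x y; case: w => a b; rewrite /cexp /= expRD cosD sinD.
by congr Complex; ring.
Qed.

Lemma cexp0 : cexp 0 = 1.
Proof. by rewrite /cexp /= expR0 cos0 sin0 mulr0 mulr1. Qed.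

Lemma normc_cexp z : normc (cexp z) = expR (RE z).
Proof.
rewrite /cexp /= !exprMn -mulrDr cos2Dsin2 mulr1 sqrtr_sqr ger0_norm ?expR_ge0 //.
Qed.

Lemma cexp_real (x : R) : cexp x%:C%C = (expR x)%:C%C.
Proof. by rewrite /cexp /= cos0 sin0 mulr1 mulr0. Qed.

Lemma mvt_bound (f df : R -> R) (K t : R) : 0 <= t ->
  (forall x, 0 <= x <= t -> is_derive x 1 f (df x)) ->
  (forall x, 0 <= x <= t -> `|df x| <= K) -> `|f t - f 0| <= K * t.
Proof.
rewrite le_eqVlt => /predU1P[<-|t0] dF dK; first by rewrite subrr normr0 mulr0.
have [||c] := @MVT R f df 0 t t0.
- by move=> x; rewrite in_itv /= => /andP[x0 xt]; apply: dF; rewrite !ltW.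
- apply: continuous_in_subspaceT => x /set_mem /=; rewrite in_itv /= => xt.
  have [h _] := dF x xt.
  by apply: differentiable_continuous; apply/derivable1_diffP.
rewrite in_itv /= subr0 => /andP[c0 ct] ->; rewrite normrM [`|t|]gtr0_norm //.
by apply: ler_wpM2r; [exact: ltW|apply: dK; rewrite !ltW].
Qed.

(** A mean value inequality for complex-valued [G] with derivative [w * H]. The real and imaginary
    parts are estimated separately, which costs the factor 2. *)
Lemma path_bound (w : R[i]) (G H : R -> R[i]) (K t : R) : 0 <= t <= 1 -> G 0 = 0 ->
  (forall x : R, is_derive x 1 (fun x : R => RE (G x)) (RE (w * H x))) ->
  (forall x : R, is_derive x 1 (fun x : R => IM (G x)) (IM (w * H x))) ->
  (forall x, 0 <= x <= 1 -> normc (H x) <= K) -> normc (G t) <= 2 * normc w * K.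
Proof.
move=> /andP[t0 t1] G0 dr di HK.
have K0 : 0 <= K by apply: le_trans (HK 0 _); rewrite ?normc_ge0 // lexx ler01.
have wK : 0 <= normc w * K by rewrite mulr_ge0 ?normc_ge0.
have wH x : 0 <= x <= t -> normc (w * H x) <= normc w * K.
  move=> /andP[x0 xt]; rewrite normcM ler_wpM2l ?normc_ge0 // HK //.
  by rewrite x0 (le_trans xt).
have br : `|RE (G t) - RE (G 0)| <= normc w * K * t.
  apply: mvt_bound => // x xt; apply: le_trans (wH x xt); exact: normRe_le.
have bi : `|IM (G t) - IM (G 0)| <= normc w * K * t.
  apply: mvt_bound => // x xt; apply: le_trans (wH x xt); exact: normIm_le.
rewrite G0 /= !subr0 in br bi.
apply: le_trans (normc_le_add _) _.
have : normc w * K * t <= normc w * K by rewrite ler_piMr.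
lra.
Qed.

Lemma is_derive_re_cexp w (t : R) :
  is_derive t 1 (fun t : R => RE (cexp (t%:C%C * w))) (RE (w * cexp (t%:C%C * w))).
Proof.
case: w => a b.
have -> : (fun t : R => RE (cexp (t%:C%C * Complex a b))) = (fun t => expR (a * t) * cos (b * t)).
  by apply/funext => s; rewrite /cexp /= !mul0r subr0 addr0 ![s * _]mulrC.
have da : is_derive t (1:R) (fun t : R => a * t) a.
  by apply: is_derive_eq; rewrite /GRing.scale /= ?mulr1 ?mulr0 ?addr0.
have db : is_derive t (1:R) (fun t : R => b * t) b.
  by apply: is_derive_eq; rewrite /GRing.scale /= ?mulr1 ?mulr0 ?addr0.
have dE := is_derive1_comp (is_derive_expR (a * t)) da.
have dC := is_derive1_comp (is_derive_cos (b * t)) db.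
apply: is_derive_eq; rewrite /GRing.scale /= !mul0r subr0 addr0 ![t * _]mulrC.
by ring.
Qed.

Lemma is_derive_im_cexp w (t : R) :
  is_derive t 1 (fun t : R => IM (cexp (t%:C%C * w))) (IM (w * cexp (t%:C%C * w))).
Proof.
case: w => a b.
have -> : (fun t : R => IM (cexp (t%:C%C * Complex a b))) = (fun t => expR (a * t) * sin (b * t)).
  by apply/funext => s; rewrite /cexp /= !mul0r subr0 addr0 ![s * _]mulrC.
have da : is_derive t (1:R) (fun t : R => a * t) a.
  by apply: is_derive_eq; rewrite /GRing.scale /= ?mulr1 ?mulr0 ?addr0.
have db : is_derive t (1:R) (fun t : R => b * t) b.
  by apply: is_derive_eq; rewrite /GRing.scale /= ?mulr1 ?mulr0 ?addr0.
have dE := is_derive1_comp (is_derive_expR (a * t)) da.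
have dS := is_derive1_comp (is_derive_sin (b * t)) db.
apply: is_derive_eq; rewrite /GRing.scale /= !mul0r subr0 addr0 ![t * _]mulrC.
by ring.
Qed.

Lemma is_derive_sub_quadratic (f : R -> R) (df b c k x : R) : is_derive x 1 f df ->
  is_derive x 1 (fun x => f x - (b + c * x + k * (x * x))) (df - (c + 2 * k * x)).
Proof.
move=> d; have i : is_derive x (1:R) (fun x : R => x) 1 by exact: is_derive_id.
have ic : is_derive x (1:R) (fun x : R => c * x) c.
  by apply: is_derive_eq; rewrite /GRing.scale /= ?mulr1 ?mulr0 ?addr0.
have ix : is_derive x (1:R) (fun x : R => x * x) (2 * x).
  by apply: is_derive_eq; rewrite /GRing.scale /=; ring.
have ik : is_derive x (1:R) (fun x : R => k * (x * x)) (2 * k * x).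
  by apply: is_derive_eq; rewrite /GRing.scale /=; ring.
have := is_deriveB d (is_deriveD (is_deriveD (is_derive_cst (b : R) x (1 : R)) ic) ik).
by rewrite add0r.
Qed.

(** Along the path [t -> t w] each Taylor remainder has derivative [w] times the preceding one, so
    [path_bound] passes from order to order; the constants 2, 4, 8 are the powers of its factor 2.
    The second order differentiates [cexp], the third differentiates [cexp_quot] at 0. *)
Lemma cexp_taylor w :
  normc (cexp w - 1) <= 2 * normc w * expR (normc w) /\
  normc (cexp w - 1 - w) <= 4 * normc w ^+ 2 * expR (normc w) /\
  normc (cexp w - 1 - w - w ^+ 2 / 2) <= 8 * normc w ^+ 3 * expR (normc w).
Proof.
pose E := expR (normc w).
pose G0 (t : R) := cexp (t%:C%C * w).
pose G1 (t : R) := G0 t - 1.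
pose G2 (t : R) := G1 t - t%:C%C * w.
pose G3 (t : R) := G2 t - (t ^+ 2 / 2)%:C%C * (w * w).
have b0 x : 0 <= x <= 1 -> normc (G0 x) <= E.
  move=> /andP[x0 x1]; rewrite normc_cexp ler_expR.
  apply: le_trans (ler_norm _) _; apply: le_trans (normRe_le _) _.
  by rewrite normcM normc_real ger0_norm // ler_piMl ?normc_ge0.
have ReB' (x y : R[i]) : RE (x - y) = RE x - RE y by exact: ReB.
have ImB' (x y : R[i]) : IM (x - y) = IM x - IM y by case: x; case: y.
have b1 t : 0 <= t <= 1 -> normc (G1 t) <= 2 * normc w * E.
  move=> t01; apply: (@path_bound w G1 G0) => //.
  - by rewrite /G1 /G0 mul0r cexp0 subrr.
  - move=> x; have d := is_derive_sub_quadratic 1 0 0 (is_derive_re_cexp w x).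
    rewrite mulr0 mul0r addr0 subr0 in d.
    have -> // : (fun x => RE (G1 x)) = (fun x : R => RE (cexp (x%:C%C * w)) - (1 + 0 * x + 0 * (x * x))).
    by apply/funext => s; rewrite ReB' /=; ring.
  - move=> x; have d := is_derive_sub_quadratic 0 0 0 (is_derive_im_cexp w x).
    rewrite mulr0 mul0r addr0 subr0 in d.
    have -> // : (fun x => IM (G1 x)) = (fun x : R => IM (cexp (x%:C%C * w)) - (0 + 0 * x + 0 * (x * x))).
    by apply/funext => s; rewrite ImB' /=; ring.
have b2 t : 0 <= t <= 1 -> normc (G2 t) <= 4 * normc w ^+ 2 * E.
  move=> t01.
  have -> : 4 * normc w ^+ 2 * E = 2 * normc w * (2 * normc w * E) by ring.
  apply: (@path_bound w G2 G1) => //.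
  - by rewrite /G2 /G1 /G0 mul0r cexp0 subrr subr0.
  - move=> x; have d := is_derive_sub_quadratic 1 (RE w) 0 (is_derive_re_cexp w x).
    have -> : (fun x => RE (G2 x)) = (fun x : R => RE (cexp (x%:C%C * w)) - (1 + RE w * x + 0 * (x * x))).
      by apply/funext => s; rewrite !ReB' /=; case: (w) => a b /=; ring.
    have -> // : RE (w * G1 x) = RE (w * cexp (x%:C%C * w)) - (RE w + 2 * 0 * x).
    by rewrite /G1 /G0 mulrBr mulr1 ReB'; ring.
  - move=> x; have d := is_derive_sub_quadratic 0 (IM w) 0 (is_derive_im_cexp w x).
    have -> : (fun x => IM (G2 x)) = (fun x : R => IM (cexp (x%:C%C * w)) - (0 + IM w * x + 0 * (x * x))).
      by apply/funext => s; rewrite !ImB' /=; case: (w) => a b /=; ring.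
    have -> // : IM (w * G1 x) = IM (w * cexp (x%:C%C * w)) - (IM w + 2 * 0 * x).
    by rewrite /G1 /G0 mulrBr mulr1 ImB'; ring.
have b3 t : 0 <= t <= 1 -> normc (G3 t) <= 8 * normc w ^+ 3 * E.
  move=> t01.
  have -> : 8 * normc w ^+ 3 * E = 2 * normc w * (4 * normc w ^+ 2 * E) by ring.
  apply: (@path_bound w G3 G2) => //.
  - by rewrite /G3 /G2 /G1 /G0 expr0n !mul0r cexp0 subrr !subr0.
  - move=> x; have d := is_derive_sub_quadratic 1 (RE w) (RE (w * w) / 2) (is_derive_re_cexp w x).
    have -> : (fun x => RE (G3 x)) = (fun x : R => RE (cexp (x%:C%C * w)) - (1 + RE w * x + RE (w * w) / 2 * (x * x))).
      by apply/funext => s; rewrite !ReB' /=; case: (w) => a b /=; ring.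
    have -> // : RE (w * G2 x) = RE (w * cexp (x%:C%C * w)) - (RE w + 2 * (RE (w * w) / 2) * x).
    by rewrite /G2 /G1 /G0 !mulrBr mulr1 !ReB'; case: (w) => a b /=; field.
  - move=> x; have d := is_derive_sub_quadratic 0 (IM w) (IM (w * w) / 2) (is_derive_im_cexp w x).
    have -> : (fun x => IM (G3 x)) = (fun x : R => IM (cexp (x%:C%C * w)) - (0 + IM w * x + IM (w * w) / 2 * (x * x))).
      by apply/funext => s; rewrite !ImB' /=; case: (w) => a b /=; ring.
    have -> // : IM (w * G2 x) = IM (w * cexp (x%:C%C * w)) - (IM w + 2 * (IM (w * w) / 2) * x).
    by rewrite /G2 /G1 /G0 !mulrBr mulr1 !ImB'; case: (w) => a b /=; field.
have o01 : 0 <= (1 : R) <= 1 by rewrite lexx ler01.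
have := b3 1 o01; have := b2 1 o01; have := b1 1 o01.
rewrite /G3 /G2 /G1 /G0 expr1n rmorph1 !mul1r => h1 h2; split=> //; split=> //.
have -> // : w ^+ 2 / 2 = (2^-1)%:C%C * (w * w).
have -> : (2^-1)%:C%C = 2^-1 :> R[i] by rewrite fmorphV rmorphMn rmorph1.
by field.
Qed.

Lemma cdiff_cexp z : cdiff cexp z (cexp z).
Proof.
move=> e e0; pose C := expR (RE z) * (4 * expR 1).
have C0 : 0 < C by rewrite !mulr_gt0 ?expR_gt0.
exists (Num.min 1 (e / C)); first by rewrite lt_min ltr01 divr_gt0.
move=> h; rewrite lt_min => /andP[h1 he].
have -> : cexp (z + h) - cexp z - cexp z * h = cexp z * (cexp h - 1 - h).
  by rewrite cexpD; ring.
rewrite normcM normc_cexp.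
have [_ [t _]] := cexp_taylor h.
have n0 := normc_ge0 h.
apply: (@le_trans _ _ (expR (RE z) * (4 * normc h ^+ 2 * expR 1))).
  rewrite ler_wpM2l ?expR_ge0 //; apply: le_trans t _.
  by rewrite ler_wpM2l ?mulr_ge0 ?sqr_ge0 // ler_expR ltW.
have -> : expR (RE z) * (4 * normc h ^+ 2 * expR 1) = C * normc h * normc h.
  by rewrite /C; ring.
by rewrite ler_wpM2r // mulrC -ler_pdivlMr // ltW.
Qed.

(** The entire function [(e^z - 1) / z]. Building [csinhc] from it settles the removable singularity
    at 0 once and for all. *)
Definition cexp_quot z : R[i] := if z == 0 then 1 else (cexp z - 1) / z.

Lemma cexp_quotE z : z * cexp_quot z = cexp z - 1.
Proof.
rewrite /cexp_quot; case: eqVneq => [->|z0]; first by rewrite mul0r cexp0 subrr.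
by rewrite mulrC divfK.
Qed.

Lemma cdiff_cexp_quot z : exists l, cdiff cexp_quot z l.
Proof.
have [->|z0] := eqVneq z 0; last first.
  have d1 : exists l, cdiff (fun w => cexp w + (fun=> -1) w) z l.
    exact: (cdiffD (cdiff_cexp z) (cdiff_cst (-1) z)).
  have [l1 d1'] := d1; have [l2 d2] := cdiffV z0 (cdiff_id z).
  have [l3 d3] := cdiffM d1' d2.
  exists l3; apply: (@cdiff_eq_near _ _ (fun w => (cexp w - 1) * w^-1) z l3 (normc z)) => //.
    by rewrite normc_gt0.
  move=> h hz; rewrite /cexp_quot; case: eqVneq => // /eqP.
  by rewrite addr_eq0 => /eqP zh; move: hz; rewrite zh normcN ltxx.
(* The derivative at 0 is the second Taylor coefficient of the exponential; [C] bounds the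
   third-order remainder for [|h| < 1]. *)
exists (1 / 2) => e e0; pose C := 8 * expR 1 : R.
have C0 : 0 < C by rewrite mulr_gt0 ?expR_gt0.
exists (Num.min 1 (e / C)); first by rewrite lt_min ltr01 divr_gt0.
move=> h; rewrite lt_min add0r => /andP[h1 he].
rewrite {2}/cexp_quot eqxx; have [->|h0] := eqVneq h 0.
  by rewrite /cexp_quot eqxx subrr mulr0 subr0 ComplexField.Normc.normc0 mulr0.
have -> : cexp_quot h - 1 - 1 / 2 * h = (cexp h - 1 - h - h ^+ 2 / 2) / h.
  by rewrite /cexp_quot (negbTE h0); field.
have n0 : 0 < normc h by rewrite normc_gt0.
rewrite normcM normcV ler_pdivrMr //.
have [_ [_ t]] := cexp_taylor h; apply: le_trans t _.
apply: (@le_trans _ _ (8 * normc h ^+ 3 * expR 1)).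
  have n1 := ltW n0; rewrite ler_wpM2l ?mulr_ge0 ?exprn_ge0 // ler_expR.
  exact: ltW.
have -> : 8 * normc h ^+ 3 * expR 1 = normc h * C * (normc h * normc h) by rewrite /C; ring.
by rewrite -[leRHS]mulrA ler_wpM2r ?mulr_ge0 ?ltW // -ltr_pdivlMr.
Qed.

Definition csinh z : R[i] := (cexp z - cexp (- z)) / 2.
Definition ccosh z : R[i] := (cexp z + cexp (- z)) / 2.
(* [sinh z / z] *)
Definition csinhc z : R[i] := (cexp_quot z + cexp_quot (- z)) / 2.

Lemma csinhcE z : z * csinhc z = csinh z.
Proof.
have := cexp_quotE z; have := cexp_quotE (- z).
rewrite /csinhc /csinh mulrA mulrDr mulNr => h1 h2.
have -> : z * cexp_quot (- z) = - (cexp (- z) - 1) by rewrite -h1 opprK.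
by rewrite h2; field.
Qed.

Lemma csinhc0 : csinhc 0 = 1.
Proof. by rewrite /csinhc /cexp_quot oppr0 eqxx; field. Qed.

Lemma csinhcN z : csinhc (- z) = csinhc z.
Proof. by rewrite /csinhc opprK [_ + cexp_quot z]addrC. Qed.

Lemma csinhN z : csinh (- z) = - csinh z.
Proof. by rewrite /csinh opprK -mulNr opprB. Qed.

Lemma ccoshN z : ccosh (- z) = ccosh z.
Proof. by rewrite /ccosh opprK [_ + cexp z]addrC. Qed.

Lemma cdiff_csinhc z : exists l, cdiff csinhc z l.
Proof.
have [l1 d1] := cdiff_cexp_quot z; have [l2 d2] := cdiff_cexp_quot (- z).
have [l3 d3] := cdiffD d1 (cdiff_opp d2).
exact: (cdiffM d3 (cdiff_cst (2^-1) z)).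
Qed.

Lemma cdiff_ccosh z : exists l, cdiff ccosh z l.
Proof.
have [l3 d3] := cdiffD (cdiff_cexp z) (cdiff_opp (cdiff_cexp (- z))).
exact: (cdiffM d3 (cdiff_cst (2^-1) z)).
Qed.

Lemma cdiff_csinh z : exists l, cdiff csinh z l.
Proof.
have [l1 d1] := cdiff_csinhc z; have [l2 d2] := cdiffM (cdiff_id z) d1.
exists l2; apply: cdiff_eq_near ltr01 _ d2 => h _ /=.
by rewrite csinhcE.
Qed.

Lemma csinhD z w : csinh (z + w) = csinh z * ccosh w + ccosh z * csinh w.
Proof. by rewrite /csinh /ccosh opprD !cexpD; field. Qed.

Lemma ccoshD z w : ccosh (z + w) = ccosh z * ccosh w + csinh z * csinh w.
Proof. by rewrite /csinh /ccosh opprD !cexpD; field. Qed.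

Lemma csinh0 : csinh 0 = 0.
Proof. by rewrite -csinhcE mul0r. Qed.

Lemma ccosh0 : ccosh 0 = 1.
Proof. by rewrite /ccosh oppr0 cexp0; field. Qed.

Lemma csinh_real (x : R) : csinh x%:C%C = ((expR x - expR (- x)) / 2)%:C%C.
Proof.
rewrite /csinh -rmorphN !cexp_real -rmorphB rmorphM fmorphV rmorphMn rmorph1 //.
Qed.

Lemma ccosh_real (x : R) : ccosh x%:C%C = ((expR x + expR (- x)) / 2)%:C%C.
Proof.
rewrite /ccosh -rmorphN !cexp_real -rmorphD rmorphM fmorphV rmorphMn rmorph1 //.
Qed.

Lemma csinh_im (y : R) : csinh ('i%C * y%:C%C) = 'i%C * (sin y)%:C%C.
Proof.
rewrite /csinh /cexp /= !mul0r !mul1r !subr0 !add0r oppr0 expR0 !mul1r cosN sinN.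
have e2 : 2^-1 = (2^-1)%:C%C :> R[i] by rewrite fmorphV rmorphMn rmorph1.
by rewrite e2; congr Complex => /=; field.
Qed.

Lemma ccosh_im (y : R) : ccosh ('i%C * y%:C%C) = (cos y)%:C%C.
Proof.
rewrite /ccosh /cexp /= !mul0r !mul1r !subr0 !add0r oppr0 expR0 !mul1r cosN sinN.
have e2 : 2^-1 = (2^-1)%:C%C :> R[i] by rewrite fmorphV rmorphMn rmorph1.
by rewrite e2; congr Complex => /=; field.
Qed.

Lemma normc_csinh z : normc (csinh z) <= expR `|RE z|.
Proof.
rewrite /csinh normcM normcV.
have -> : normc 2 = 2 :> R by have := @normc_real R 2; rewrite rmorphMn rmorph1 ger0_norm.
rewrite ler_pdivrMr //; apply: le_trans (normcB _ _) _.
rewrite !normc_cexp.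
have : expR (RE z) <= expR `|RE z| by rewrite ler_expR ler_norm.
have : expR (RE (- z)) <= expR `|RE z|.
  by rewrite ler_expR; case: z => x y /=; rewrite -normrN ler_norm.
lra.
Qed.

Lemma normc_ccosh z : normc (ccosh z) <= expR `|RE z|.
Proof.
rewrite /ccosh normcM normcV.
have -> : normc 2 = 2 :> R by have := @normc_real R 2; rewrite rmorphMn rmorph1 ger0_norm.
rewrite ler_pdivrMr //; apply: le_trans (normcD _ _) _.
rewrite !normc_cexp.
have : expR (RE z) <= expR `|RE z| by rewrite ler_expR ler_norm.
have : expR (RE (- z)) <= expR `|RE z|.
  by rewrite ler_expR; case: z => x y /=; rewrite -normrN ler_norm.
lra.
Qed.

End ComplexExponential.

(** * The difference operator and its symmetry *)

Section Domain.
Context {R : realType}.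
Local Notation mu := (@lebesgue_measure R).
Implicit Types (z w h l : R[i]) (f g F : R[i] -> R[i]) (x y s : R).
Local Notation RE z := (complex.Re z).
Local Notation IM z := (complex.Im z).

Lemma powR_decay_le (a b x : R) : 1 <= x -> a <= b -> x `^ a <= x `^ b.
Proof. by move=> x1 ab; apply: ler_powR. Qed.

Lemma powR_decay_inv (e x : R) : 0 < e -> 1 <= x -> x `^ (- 1 - e) * x <= 1.
Proof.
move=> e0 x1; have x0 : 0 < x by lra.
apply: (@le_trans _ _ (x `^ (- 1) * x)); first by apply: ler_wpM2r; [exact: ltW|apply: powR_decay_le => //; lra].
have x2 : x != 0 by rewrite gt_eqF.
have x3 := ltW x0; by rewrite powRN powRr1 // mulVf.
Qed.

Lemma sinh_le_expR x : `|(expR x - expR (- x)) / 2| <= expR `|x|.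
Proof.
have := @normc_csinh R x%:C%C; rewrite csinh_real normc_real /=; exact.
Qed.

Lemma sinh_le_linear x : `|(expR x - expR (- x)) / 2| <= `|x| * expR `|x|.
Proof.
wlog x0 : x / 0 <= x.
  move=> h; have [/h//|x0] := leP 0 x.
  have -> : (expR x - expR (- x)) / 2 = - ((expR (- x) - expR x) / 2) by field.
  by rewrite normrN; have := h (- x); rewrite normrN opprK; apply; lra.
have e1 : expR (- x) = expR x * expR (- (x + x)) by rewrite -expRD; congr expR; ring.
have e2 : 1 + - (x + x) <= expR (- (x + x)) by exact: expR_ge1Dx.
have e3 := expR_gt0 x.
have e4 : expR (- x) <= expR x by rewrite ler_expR; lra.
rewrite !ger0_norm //; last by lra.
have : expR x * (1 - (x + x)) <= expR (- x) by rewrite e1 ler_wpM2l // ltW.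
lra.
Qed.

Lemma pi_ge1 : 1 <= pi :> R.
Proof. by have := @pi_ge2 R; lra. Qed.

Lemma weight_le s : weight s <= `|s| * expR (pi * `|s|).
Proof.
apply: le_trans (ler_norm _) _; rewrite /weight normrM.
have p := @pi_ge1.
have ps : pi * `|s| = `|pi * s| by rewrite normrM ger0_norm // pi_ge0.
rewrite ps; apply: ler_pM => //; last exact: sinh_le_expR.
rewrite normrM ler_piMl // ger0_norm ?invr_ge0 ?pi_ge0 //.
by rewrite invf_le1 ?pi_gt0.
Qed.

(** The double zero of the weight at 0 absorbs the factor [s^-2] that the division by [i s] in [opL]
    brings into the norm. *)
Lemma weight_div_sq_le s : (s^-1) ^+ 2 * weight s <= expR (pi * `|s|).
Proof.
have [->|s0] := eqVneq s 0.
  by rewrite invr0 expr2 !mul0r expR_ge0.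
have p0 : 0 < pi :> R := pi_gt0 R.
have p1 : pi != 0 :> R by rewrite gt_eqF.
have ps : `|pi * s| = pi * `|s| by rewrite normrM gtr0_norm.
have sn : 0 < `|s| by rewrite normr_gt0.
rewrite -[X in X <= _]ger0_norm; last by rewrite mulr_ge0 ?sqr_ge0 ?weight_ge0.
have -> : s^-1 ^+ 2 * weight s = (pi * s)^-1 * ((expR (pi * s) - expR (- (pi * s))) / 2).
  move: p1; rewrite /weight; generalize (pi : R) => p p1; field.
  by rewrite s0.
rewrite normrM normfV -ler_pdivlMl ?invr_gt0 ?ps ?mulr_gt0 // invrK.
by have := sinh_le_linear (pi * s); rewrite ps.
Qed.

Lemma continuous_weight : continuous (@weight R).
Proof.
have cpi : continuous (fun s : R => pi * s) by move=> s; apply: cvgM; [exact: cvg_cst|exact: cvg_id].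
have cE : continuous (fun s : R => expR (pi * s)).
  move=> s; apply: (@continuous_comp _ _ _ (fun s : R => pi * s) expR); first exact: cpi.
  exact: continuous_expR.
have cE' : continuous (fun s : R => expR (- (pi * s))).
  move=> s; apply: (@continuous_comp _ _ _ (fun s : R => - (pi * s)) expR).
    by apply: cvgN; exact: cpi.
  exact: continuous_expR.
move=> s; apply: cvgM.
  by apply: cvgM; [exact: cvg_cst|exact: cvg_id].
by apply: cvgM; [apply: cvgB; [exact: cE|exact: cE']|exact: cvg_cst].
Qed.

Lemma continuous_sqr_normc (u v : R -> R) : continuous u -> continuous v ->
  continuous (fun s => normc (Complex (u s) (v s)) ^+ 2).
Proof.
move=> cu cv; under eq_fun do rewrite sqr_normcE /=.
move=> s; apply: cvgD; rewrite expr2; under eq_fun do rewrite expr2.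
  by apply: cvgM; exact: cu.
by apply: cvgM; exact: cv.
Qed.

Lemma cdiff_line F (y : R) : (forall x, exists l, cdiff F (Complex x y) l) ->
  continuous (fun x => RE (F (Complex x y))) /\ continuous (fun x => IM (F (Complex x y))).
Proof.
move=> dF; split=> x; have [l dl] := dF x.
  exact: (differentiable2_cont1 (cdiff_re dl)).
exact: (differentiable2_cont1 (cdiff_im dl)).
Qed.

(** A normalized form of the domain. Replacing [|z|] by [|Re z|] weakens the bound, since the
    exponent is negative, but makes it the same on every horizontal line. *)
Lemma domain_HwP f : domain_Hw f -> exists d e C M : R,
  [/\ 0 < d, 0 < e, 0 <= C, 1 <= M &
   (forall z, `|IM z| < 1 + d -> (exists l, cdiff f z l) /\ f (- z) = f z) /\
   (forall z, `|IM z| <= 1 -> M <= `|RE z| ->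
      normc (f z) <= C * (`|RE z| `^ (- 1 - e) * expR (- (pi * `|RE z| / 2))))].
Proof.
move=> [[d [d0 dP]] [e [e0 [C [M CM]]]]].
exists d, e, `|C|, (Num.max M 1); split => //; first by rewrite le_max lexx orbT.
split=> z zi; first by have [/derivable_cdiff ? ?] := dP z zi.
rewrite ge_max => /andP[Mz z1].
apply: le_trans (CM z zi Mz) _.
have zr := normRe_le z.
apply: (@le_trans _ _ (`|C| * (normc z `^ (- 1 - e) * expR (- (pi * `|RE z| / 2))))).
  by rewrite ler_wpM2r ?ler_norm // mulr_ge0 ?powR_ge0 ?expR_ge0.
rewrite ler_wpM2l // ler_wpM2r ?expR_ge0 //.
have -> : - 1 - e = - (1 + e) by ring.
have x0 : 0 < `|RE z| by lra.
rewrite !powRN lef_pV2 ?posrE ?powR_gt0 //; last lra.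
by apply: ge0_ler_powR; rewrite ?nnegrE; lra.
Qed.

Lemma domain_Hw0 : domain_Hw (0 : R[i] -> R[i]).
Proof.
split.
  by exists 1; split=> // z _; split=> //; exact: derivable_cst.
exists 1; split=> //; exists 0, 0 => z _ _.
by rewrite mul0r ComplexField.Normc.normc0.
Qed.

Lemma domain_Hw_lin (a : R[i]) f g : domain_Hw f -> domain_Hw g ->
  domain_Hw (fun z => a * f z + g z).
Proof.
move=> [[d [d0 dP]] [e [e0 [C [M CM]]]]] [[d' [d'0 dP']] [e' [e'0 [C' [M' CM']]]]].
split.
  exists (Num.min d d'); split; first by rewrite lt_min d0.
  move=> z zi; have [|df ef] := dP z.
    by apply: lt_le_trans zi _; rewrite lerD2l ge_min lexx.
  have [|dg eg] := dP' z.
    by apply: lt_le_trans zi _; rewrite lerD2l ge_min lexx orbT.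
  split; last by rewrite ef eg.
  have [l dl] := (derivable_cdiff f z).1 df; have [m dm] := (derivable_cdiff g z).1 dg.
  have [k dk] := cdiffM (cdiff_cst a z) dl.
  exact/derivable_cdiff/(cdiffD dk dm).
pose em := Num.min e e'.
have eme : em <= e by rewrite ge_min lexx.
have eme' : em <= e' by rewrite ge_min lexx orbT.
exists em; split; first by rewrite lt_min e0.
(* For [1 <= |z|] the power with the smaller rate [em] dominates the other two; the absolute values
   allow for negative constants. *)
exists (normc a * `|C| + `|C'|), (Num.max 1 (Num.max M M')) => z zi.
rewrite !ge_max => /and3P[z1 Mz Mz'].
have nz1 : 1 <= normc z by apply: le_trans z1 (normRe_le z).
have := CM z zi Mz; have := CM' z zi Mz'.
set E := expR _; have E0 : 0 < E by exact: expR_gt0.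
have p1 : normc z `^ (- 1 - e) <= normc z `^ (- 1 - em) by apply: powR_decay_le => //; lra.
have p2 : normc z `^ (- 1 - e') <= normc z `^ (- 1 - em) by apply: powR_decay_le => //; lra.
have q1 := powR_ge0 (normc z) (- 1 - e); have q2 := powR_ge0 (normc z) (- 1 - e').
have q3 := powR_ge0 (normc z) (- 1 - em).
set P1 := _ `^ (- 1 - e) in p1 q1 *; set P2 := _ `^ (- 1 - e') in p2 q2 *.
set P := _ `^ (- 1 - em) in p1 p2 q3 *.
move=> h' h; apply: le_trans (normcD _ _) _; rewrite mulrDl; apply: lerD.
  rewrite normcM -mulrA ler_wpM2l ?normc_ge0 //; apply: le_trans h _.
  apply: (@le_trans _ _ (`|C| * (P1 * E))).
    by rewrite ler_wpM2r ?ler_norm // mulr_ge0 // ltW.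
  by rewrite ler_wpM2l // ler_wpM2r // ltW.
apply: le_trans h' _; apply: (@le_trans _ _ (`|C'| * (P2 * E))).
  by rewrite ler_wpM2r ?ler_norm // mulr_ge0 // ltW.
by rewrite ler_wpM2l // ler_wpM2r // ltW.
Qed.

Lemma real_addi s : s%:C%C + 'i%C = Complex s 1.
Proof. by rewrite /GRing.add /= addr0 add0r. Qed.

Lemma real_subi s : s%:C%C - 'i%C = Complex s (- 1).
Proof. by apply/eqP; rewrite eq_complex /= subr0 sub0r !eqxx. Qed.

(** The decay rate of the domain is made for this: the square of [e^(-pi |s| / 2)] cancels the
    exponential growth of the weight, one factor [|s|^(-1-e)] absorbs its factor [|s|], and the
    other one is integrable. *)
Lemma restrict_line_L2 f : domain_Hw f -> even_L2 (restrict_line f).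
Proof.
move=> /domain_HwP [d [e [C [M [d0 e0 C0 M1 [df bf]]]]]].
have i0 s : `|IM s%:C%C| < 1 + d by rewrite /= normr0; lra.
have [cr ci] := @cdiff_line f 0 (fun x => proj1 (df (Complex x 0) (i0 x))).
have mf : complex_measurable (restrict_line f).
  by split; exact: continuous_measurable_fun.
apply: even_L2_of_integrable => //.
  move=> s; rewrite /restrict_line; have [_ <-] := df s%:C%C (i0 s).
  by congr f; rewrite rmorphN.
have c2 : continuous (fun s => normc (restrict_line f s) ^+ 2).
  have -> : (fun s => normc (restrict_line f s) ^+ 2) =
      (fun s => normc (Complex (RE (f (Complex s 0))) (IM (f (Complex s 0)))) ^+ 2).
    by apply/funext => s; rewrite /restrict_line; case: (f _).
  by move=> s; apply: continuous_sqr_normc.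
apply: (@continuous_decay_integrable _ _ (C ^+ 2) M e) => //.
  move=> s; apply: cvgM; last exact: continuous_weight.
  exact: c2.
move=> s Ms; rewrite ger0_norm ?weighted_sq_ge0 //.
have n0 : 0 < `|s| by lra.
have b := bf s%:C%C; rewrite /= normr0 ler01 in b; have {}b := b isT Ms.
rewrite /weighted_sq /restrict_line.
set D := `|s| `^ (- 1 - e) in b *; set E := expR (- (pi * `|s| / 2)) in b.
have D0 : 0 <= D by exact: powR_ge0.
have E0 : 0 <= E by exact: expR_ge0.
have Ds : D * `|s| <= 1 by apply: powR_decay_inv => //; lra.
have EE : E ^+ 2 * expR (pi * `|s|) = 1.
  by rewrite /E expr2 -!expRD -[RHS]expR0; congr expR; field.
have f2 : normc (f s%:C%C) ^+ 2 <= (C * (D * E)) ^+ 2.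
  by rewrite ler_sqr ?nnegrE ?normc_ge0 // !mulr_ge0.
apply: le_trans (ler_pM (sqr_ge0 _) (weight_ge0 s) f2 (weight_le s)) _.
have -> : (C * (D * E)) ^+ 2 * (`|s| * expR (pi * `|s|)) =
    C ^+ 2 * D * (D * `|s|) * (E ^+ 2 * expR (pi * `|s|)) by ring.
by rewrite EE mulr1 ler_piMr // mulr_ge0 ?sqr_ge0.
Qed.

Lemma opLE f s : opL f s = Complex (s^-1 * IM (f (Complex s 1) - f (Complex s (- 1))))
  (- s^-1 * RE (f (Complex s 1) - f (Complex s (- 1)))).
Proof.
rewrite /opL real_addi real_subi.
have -> : ('i%C * s%:C%C)^-1 = Complex 0 (- s^-1) :> R[i].
  have [->|s0] := eqVneq s 0; first by rewrite rmorph0 mulr0 !invr0 oppr0.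
  have s0' : s%:C%C != 0 :> R[i] by rewrite eq_complex /= (negbTE s0).
  have i0 : 'i%C != 0 :> R[i] by rewrite eq_complex /= oner_eq0 andbF.
  apply: (mulIf (_ : 'i%C * s%:C%C != 0)); first by rewrite mulf_neq0.
  rewrite mulVf ?mulf_neq0 //; congr Complex => /=; first by field.
  by ring.
by case: (_ - _) => a b; congr Complex => /=; ring.
Qed.

Lemma measurable_invR : measurable_fun setT (fun s : R => s^-1).
Proof.
have -> : [set: R] = [set 0] `|` ~` [set 0] by rewrite setUCr.
apply/measurable_funU; [exact: measurable_set1|exact: measurableC|split].
  exact: measurable_fun_set1.
apply: open_continuous_measurable_fun; first exact/closed_openC/accessible_closed_set1/hausdorff_accessible/norm_hausdorff.
by move=> s /set_mem /= /eqP s0; exact: inv_continuous.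
Qed.

(** The convention at [s = 0] may break the continuity of [opL f], so integrability comes from the
    continuous majorant [k], in which [weight_div_sq_le] has removed the division by [s]. *)
Lemma opL_L2 f : domain_Hw f -> even_L2 (opL f).
Proof.
move=> /domain_HwP [d [e [C [M [d0 e0 C0 M1 [df bf]]]]]].
have i1 s : `|IM (Complex s 1)| < 1 + d by rewrite /= normr1; lra.
have i1' s : `|IM (Complex s (- 1))| < 1 + d by rewrite /= normrN normr1; lra.
have [cr1 ci1] := @cdiff_line f 1 (fun x => proj1 (df (Complex x 1) (i1 x))).
have [cr2 ci2] := @cdiff_line f (- 1) (fun x => proj1 (df (Complex x (- 1)) (i1' x))).
pose U s := RE (f (Complex s 1) - f (Complex s (- 1))).
pose V s := IM (f (Complex s 1) - f (Complex s (- 1))).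
have ImB (a b : R[i]) : IM (a - b) = IM a - IM b by case: a; case: b.
have cU : continuous U.
  have -> : U = (fun s => RE (f (Complex s 1)) - RE (f (Complex s (- 1)))).
    by apply/funext => s; rewrite /U ReB.
  by move=> s; apply: cvgB; [exact: cr1|exact: cr2].
have cV : continuous V.
  have -> : V = (fun s => IM (f (Complex s 1)) - IM (f (Complex s (- 1)))).
    by apply/funext => s; rewrite /V ImB.
  by move=> s; apply: cvgB; [exact: ci1|exact: ci2].
have mf : complex_measurable (opL f).
  split.
    have -> : (fun s => RE (opL f s)) = (fun s => s^-1 * V s) by apply/funext => s; rewrite opLE.
    by apply: measurable_funM; [exact: measurable_invR|exact: continuous_measurable_fun].
  have -> : (fun s => IM (opL f s)) = (fun s => - (s^-1 * U s)) by apply/funext => s; rewrite opLE mulNr.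
  apply: measurableT_comp => //.
  by apply: measurable_funM; [exact: measurable_invR|exact: continuous_measurable_fun].
apply: even_L2_of_integrable => //.
  move=> s; rewrite !opLE.
  have [_ h1] := df (Complex s 1) (i1 s); have [_ h2] := df (Complex s (- 1)) (i1' s).
  have -> : Complex (- s) 1 = - Complex s (- 1) by rewrite [RHS]/GRing.opp /= opprK.
  have -> : Complex (- s) (- 1) = - Complex s 1 by [].
  rewrite h1 h2 invrN opprK -opprB; case: (f _ - f _) => a b /=.
  by congr Complex; ring.
pose k s := normc (Complex (U s) (V s)) ^+ 2 * expR (pi * `|s|).
have ck : continuous k.
  move=> s; apply: cvgM; first exact: continuous_sqr_normc.
  apply: (@continuous_comp _ _ _ (fun s : R => pi * `|s|) expR); last exact: continuous_expR.
  by apply: cvgM; [exact: cvg_cst|exact: norm_continuous].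
apply: (@integrable_Rdom _ _ k); first exact: measurable_weighted_sq.
  move=> s; rewrite ger0_norm ?weighted_sq_ge0 // /weighted_sq opLE /k.
  rewrite !sqr_normcE /= -/(U s) -/(V s).
  have -> : ((s^-1 * V s) ^+ 2 + (- s^-1 * U s) ^+ 2) * weight s =
    (U s ^+ 2 + V s ^+ 2) * (s^-1 ^+ 2 * weight s) by ring.
  by rewrite ler_wpM2l ?weight_div_sq_le // addr_ge0 ?sqr_ge0.
apply: (@continuous_decay_integrable _ _ ((2 * C) ^+ 2) M e) => //.
move=> s Ms; rewrite ger0_norm; last by apply: mulr_ge0; [exact: sqr_ge0|exact: expR_ge0].
rewrite /k.
have b1 := bf (Complex s 1); rewrite /= normr1 lexx in b1; have {}b1 := b1 isT Ms.
have b2 := bf (Complex s (- 1)); rewrite /= normrN normr1 lexx in b2; have {}b2 := b2 isT Ms.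
set D := `|s| `^ (- 1 - e) in b1 b2 *; set E := expR (- (pi * `|s| / 2)) in b1 b2.
have D0 : 0 <= D by exact: powR_ge0.
have E0 : 0 <= E by exact: expR_ge0.
have D1 : D <= 1.
  have s1 : 1 <= `|s| by lra.
  rewrite -(powRr0 `|s|); apply: powR_decay_le => //; lra.
have EE : E ^+ 2 * expR (pi * `|s|) = 1.
  by rewrite /E expr2 -!expRD -[RHS]expR0; congr expR; field.
have n2 : normc (Complex (U s) (V s)) <= 2 * C * (D * E).
  have -> : Complex (U s) (V s) = f (Complex s 1) - f (Complex s (- 1)).
    by rewrite /U /V; case: (_ - _).
  by apply: le_trans (normcB _ _) _; lra.
have f2 : normc (Complex (U s) (V s)) ^+ 2 <= (2 * C * (D * E)) ^+ 2.
  by have nn := normc_ge0 (Complex (U s) (V s)); rewrite ler_sqr ?nnegrE // !mulr_ge0.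
apply: le_trans (ler_wpM2r (expR_ge0 _) f2) _.
have -> : (2 * C * (D * E)) ^+ 2 * expR (pi * `|s|) =
    (2 * C) ^+ 2 * D * D * (E ^+ 2 * expR (pi * `|s|)) by ring.
by rewrite EE mulr1 ler_piMr // mulr_ge0 ?sqr_ge0.
Qed.

End Domain.

(** The algebra of the symmetry proof over an abstract field: [a], [b], [c] stand for values of the
    two functions, [S] for [sinh (pi s)], and [- S] for its value on the shifted line. *)
Lemma left_integrand_factor (K : fieldType) (i p s a b c S : K) :
  i != 0 -> p != 0 -> s != 0 ->
  (i * s)^-1 * (a - b) * c * (p^-1 * s * S) =
  - (i * p)^-1 * (a * c * - S + b * c * S).
Proof. by move=> i0 p0 s0; rewrite ?mulNr ?invrN; field; rewrite s0 p0 i0. Qed.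

Lemma right_integrand_factor (K : fieldType) (i p s a b c S : K) :
  i != 0 -> p != 0 -> s != 0 ->
  c * ((- i * s)^-1 * (a - b)) * (p^-1 * s * S) =
  - (i * p)^-1 * (c * a * S + c * b * - S).
Proof. by move=> i0 p0 s0; rewrite ?mulNr ?invrN; field; rewrite s0 p0 i0. Qed.

Section Symmetry.
Context {R : realType}.
Local Notation mu := (@lebesgue_measure R).
Implicit Types (z w h l : R[i]) (f g F : R[i] -> R[i]) (x y s : R).
Local Notation RE z := (complex.Re z).
Local Notation IM z := (complex.Im z).

Lemma graph_L_L2 : @graph_L R `<=` @even_L2 R `*` @even_L2 R.
Proof. by move=> _ [f Df <-]; split; [exact: restrict_line_L2|exact: opL_L2]. Qed.

Lemma graph_L0 : @graph_L R (0, 0).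
Proof.
exists (0 : R[i] -> R[i]); first exact: domain_Hw0.
by apply: (congr2 pair); apply/funext => s; rewrite /restrict_line /opL ?subrr ?mulr0.
Qed.

Lemma graph_L_lin (a : R[i]) (u v u' v' : R -> R[i]) : graph_L (u, v) -> graph_L (u', v') ->
  graph_L (a *: u + u', a *: v + v').
Proof.
move=> [f Df [<- <-]] [g Dg [<- <-]].
exists (fun z => a * f z + g z); first exact: domain_Hw_lin.
congr pair; apply/funext => s //.
transitivity (a * opL f s + opL g s); last by [].
rewrite /opL; ring.
Qed.

(** The Schwarz reflection: holomorphic, and on the real line equal to the conjugate of [f]. It
    continues the second factor of the inner product analytically. *)
Definition conj_fun f : R[i] -> R[i] := fun z => (f z^*%C)^*%C.

Lemma conj_fun_real f s : conj_fun f s%:C%C = (f s%:C%C)^*%C.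
Proof. by rewrite /conj_fun conjc_real. Qed.

Lemma csinh_pi_addi s : csinh (pi%:C%C * (s%:C%C + 'i%C)) = - csinh (pi%:C%C * s%:C%C).
Proof.
rewrite mulrDr csinhD [pi%:C%C * 'i%C]mulrC ccosh_im csinh_im cospi sinpi.
by rewrite rmorphN1 mulrN1 mulr0 mulr0 addr0.
Qed.

(** The two factors [e^(-pi |Re z| / 2)] cancel the growth of [sinh (pi z)], and each power is at
    most [1 / |Re z|]. *)
Lemma shift_integrand_bound F G C C' M e e' : 0 < e -> 0 < e' -> 1 <= M -> 0 <= C -> 0 <= C' ->
  (forall z, 0 <= IM z <= 1 -> M <= `|RE z| ->
     normc (F z) <= C * (`|RE z| `^ (- 1 - e) * expR (- (pi * `|RE z| / 2)))) ->
  (forall z, 0 <= IM z <= 1 -> M <= `|RE z| ->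
     normc (G z) <= C' * (`|RE z| `^ (- 1 - e') * expR (- (pi * `|RE z| / 2)))) ->
  forall z, 0 <= IM z <= 1 -> M <= `|RE z| ->
    normc (F z * G z * csinh (pi%:C%C * z)) <= C * C' / RE z ^+ 2.
Proof.
move=> e0 e'0 M1 C0 C'0 bF bG z zi Mz; rewrite normcM [normc (F z * G z)]normcM.
have := bF z zi Mz; have := bG z zi Mz.
have nS : normc (csinh (pi%:C%C * z)) <= expR (pi * `|RE z|).
  apply: le_trans (normc_csinh _) _; rewrite ler_expR.
  by case: (z) => x y /=; rewrite mul0r subr0 normrM ger0_norm // pi_ge0.
have z1 : 1 <= `|RE z| by lra.
have z0 : 0 < `|RE z| by lra.
have d e1 : 0 < e1 -> `|RE z| `^ (- 1 - e1) <= `|RE z|^-1.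
  move=> e10; rewrite -div1r ler_pdivlMr //; exact: powR_decay_inv.
have := d e e0; have := d e' e'0.
have := powR_ge0 (`|RE z|) (- 1 - e); have := powR_ge0 (`|RE z|) (- 1 - e').
set D := _ `^ (- 1 - e); set D' := _ `^ (- 1 - e'); set E := expR (- (pi * `|RE z| / 2)).
have E0 : 0 <= E by exact: expR_ge0.
have EE : E ^+ 2 * expR (pi * `|RE z|) = 1.
  by rewrite /E expr2 -!expRD -[RHS]expR0; congr expR; field.
move=> D'0 D0 dD' dD nG nF.
have zi0 : 0 <= `|RE z|^-1 by rewrite invr_ge0 ltW.
apply: (@le_trans _ _ ((C * (`|RE z|^-1 * E)) * (C' * (`|RE z|^-1 * E)) * expR (pi * `|RE z|))).
  apply: ler_pM; rewrite ?mulr_ge0 ?normc_ge0 //.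
  apply: ler_pM; rewrite ?normc_ge0 //.
    by apply: le_trans nF _; rewrite ler_wpM2l // ler_wpM2r.
  by apply: le_trans nG _; rewrite ler_wpM2l // ler_wpM2r.
have -> : C * (`|RE z|^-1 * E) * (C' * (`|RE z|^-1 * E)) * expR (pi * `|RE z|) =
  C * C' * (`|RE z|^-1 ^+ 2) * (E ^+ 2 * expR (pi * `|RE z|)) by ring.
by rewrite EE mulr1 exprVn real_normK // num_real.
Qed.

Lemma IM_subi z : IM (z - 'i%C) = IM z - 1.
Proof. by case: z. Qed.

Lemma RE_subi z : RE (z - 'i%C) = RE z.
Proof. by case: z => x y /=; rewrite subr0. Qed.

(* The two contour integrals are those of [f z * g^ (z - i) * sinh (pi z)] and
   [f (z - i) * g^ z * sinh (pi z)], where [g^] is [conj_fun g]. *)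
Lemma graph_L_symmetric : symmetric_operator (@even_L2_inner R) (@graph_L R).
Proof.
move=> _ _ _ _ [f Df [<- <-]] [g Dg [<- <-]].
rewrite /even_L2_inner; congr (_ * _).
have [d [e [C [M [d0 e0 C0 M1 [df bf]]]]]] := domain_HwP Df.
have [d' [e' [C' [M' [d'0 e'0 C'0 M'1 [dg bg]]]]]] := domain_HwP Dg.
pose gJ := conj_fun g.
have dgJ z : `|IM z| < 1 + d' -> exists l, cdiff gJ z l.
  move=> zi; have [|[l dl] _] := dg z^*%C; first by case: z zi => x y /=; rewrite normrN.
  by exists l^*%C; exact: cdiff_conj.
have bgJ z : `|IM z| <= 1 -> M' <= `|RE z| ->
    normc (gJ z) <= C' * (`|RE z| `^ (- 1 - e') * expR (- (pi * `|RE z| / 2))).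
  move=> zi Mz; rewrite normc_conj; have := bg z^*%C.
  by case: z zi Mz => x y /= zi Mz; rewrite normrN => /(_ zi Mz).
pose G1 z := f z * gJ (z - 'i%C) * csinh (pi%:C%C * z).
pose G2 z := f (z - 'i%C) * gJ z * csinh (pi%:C%C * z).
have dS z : exists l, cdiff (fun z => csinh (pi%:C%C * z)) z l.
  by have [l dl] := cdiff_csinh (pi%:C%C * z); exists (pi%:C%C * l); exact: cdiff_scale.
pose m := Num.max M M'.
have m1 : 1 <= m by rewrite le_max M1.
have mM x : m <= x -> M <= x by rewrite ge_max => /andP[].
have mM' x : m <= x -> M' <= x by rewrite ge_max => /andP[].
(* For [z] in the upper half of the strip, [z - i] lies in the lower half, so both factors of each
   integrand are controlled by the domain. *)
have strip z : 0 <= IM z <= 1 -> `|IM z| <= 1 /\ `|IM (z - 'i%C)| <= 1.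
  by move=> /andP[z0 z1]; rewrite IM_subi !ler_norml; split; lra.
have [||i1 i1' E1] := @contour_shift R G1 (C * C') m.
- move=> z /strip [z1 z2].
  have [|[l1 d1] _] := df z; first by lra.
  have [|l2 d2] := dgJ (z - 'i%C); first by lra.
  have [l3 d3] := dS z; have [l4 d4] := cdiffM d1 (cdiff_shift d2).
  exact: (cdiffM d4 d3).
- apply: (@shift_integrand_bound f (fun z => gJ (z - 'i%C)) C C' m e e') => //.
    by move=> z /strip [z1 z2] /mM; exact: bf.
  by move=> z /strip [z1 z2] /mM'; have := bgJ (z - 'i%C) z2; rewrite RE_subi.
have [||i2 i2' E2] := @contour_shift R G2 (C * C') m.
- move=> z /strip [z1 z2].
  have [|[l1 d1] _] := df (z - 'i%C); first by lra.
  have [|l2 d2] := dgJ z; first by lra.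
  have [l3 d3] := dS z; have [l4 d4] := cdiffM (cdiff_shift d1) d2.
  exact: (cdiffM d4 d3).
- apply: (@shift_integrand_bound (fun z => f (z - 'i%C)) gJ C C' m e e') => //.
    by move=> z /strip [z1 z2] /mM; have := bf (z - 'i%C) z2; rewrite RE_subi.
  by move=> z /strip [z1 z2] /mM'; exact: bgJ.
have p0 : pi%:C%C != 0 :> R[i] by rewrite eq_complex /= gt_eqF ?pi_gt0.
have ii : 'i%C != 0 :> R[i] by rewrite eq_complex /= oner_eq0 andbF.
pose c0 : R[i] := ('i%C * pi%:C%C)^-1.
have wE s : (weight s)%:C%C = (pi%:C%C)^-1 * s%:C%C * csinh (pi%:C%C * s%:C%C).
  by rewrite -rmorphM csinh_real /weight -fmorphV -!rmorphM.
(* The left inner product uses [G1] on the upper line and [G2] on the real line, the right one the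
   opposite values; shifting both contours exchanges them. *)
have k1 s : opL f s * (restrict_line g s)^*%C * (weight s)%:C%C =
    - c0 * (G1 (s%:C%C + 'i%C) + G2 s%:C%C).
  rewrite /G1 /G2 csinh_pi_addi addrK /gJ conj_fun_real /opL /restrict_line wE /c0.
  have [->|s0] := eqVneq s 0; first by rewrite !mulr0 csinh0 oppr0 !mulr0 addr0 mulr0.
  have s0' : s%:C%C != 0 :> R[i] by rewrite eq_complex /= (negbTE s0).
  exact: left_integrand_factor.
have k2 s : restrict_line f s * (opL g s)^*%C * (weight s)%:C%C =
    - c0 * (G1 s%:C%C + G2 (s%:C%C + 'i%C)).
  rewrite /G1 /G2 csinh_pi_addi addrK /opL /restrict_line wE /c0.
  rewrite conjcM conjc_inv conjcM conjc_real.
  have -> : ('i%C : R[i])^*%C = - 'i%C by rewrite /GRing.opp /= oppr0.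
  have -> : (g (s%:C%C + 'i%C) - g (s%:C%C - 'i%C))^*%C =
      gJ (s%:C%C - 'i%C) - gJ (s%:C%C + 'i%C).
    have -> : (g (s%:C%C + 'i%C) - g (s%:C%C - 'i%C))^*%C =
      (g (s%:C%C + 'i%C))^*%C - (g (s%:C%C - 'i%C))^*%C by exact: rmorphB.
    rewrite /gJ /conj_fun; congr ((g _)^*%C - (g _)^*%C).
      by rewrite real_addi real_subi /= opprK.
    by rewrite real_addi real_subi.
  have [->|s0] := eqVneq s 0; first by rewrite !mulr0 csinh0 oppr0 !mulr0 addr0 mulr0.
  have s0' : s%:C%C != 0 :> R[i] by rewrite eq_complex /= (negbTE s0).
  exact: right_integrand_factor.
have -> : (fun s => opL f s * (restrict_line g s)^*%C * (weight s)%:C%C) =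
  (fun s => - c0 * (G1 (s%:C%C + 'i%C) + G2 s%:C%C)) by apply/funext.
have -> : (fun s => restrict_line f s * (opL g s)^*%C * (weight s)%:C%C) =
  (fun s => - c0 * (G1 s%:C%C + G2 (s%:C%C + 'i%C))) by apply/funext.
have cD (a b : R -> R[i]) : cintegrable a -> cintegrable b -> cintegrable (fun s => a s + b s).
  move=> [ar ai] [br bi]; split.
    have := integrable_RD ar br; apply: eq_integrable => // s _ /=.
    by congr EFin; rewrite ReD.
  have := integrable_RD ai bi; apply: eq_integrable => // s _ /=.
  by congr EFin; case: (a s) => ? ?; case: (b s).
rewrite !complex_integralZ; [|exact: cD..].
by rewrite !complex_integralD // E1 E2.
Qed.

End Symmetry.

(** * Test functions *)

Section TestFunctions.
Context {R : realType}.
Implicit Types (z w h l : R[i]) (F : R[i] -> R[i]) (x y s : R).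
Local Notation RE z := (complex.Re z).
Local Notation IM z := (complex.Im z).
Local Notation I := ('i%C : R[i]).
Local Notation PI := (pi%:C%C : R[i]).

Lemma i_sq : I * I = -1.
Proof. by rewrite -expr2 sqr_i. Qed.

Lemma i_neq0 : I != 0.
Proof. by rewrite eq_complex /= oner_eq0 andbF. Qed.

Lemma cpi_neq0 : PI != 0.
Proof. by rewrite eq_complex /= gt_eqF ?pi_gt0. Qed.

Lemma ccosh_sq_sub z : ccosh z * ccosh z - csinh z * csinh z = 1.
Proof.
have := ccoshD z (- z); rewrite addrN ccosh0 ccoshN csinhN mulrN => E.
by rewrite -E.
Qed.

(** At a zero the exponentials of [PI * z] and of its opposite agree; comparing their moduli forces
    the real part to vanish. *)
Lemma csinh_pi_eq0 z : csinh (PI * z) = 0 -> RE z = 0 /\ sin (pi * IM z) = 0.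
Proof.
case: z => x y /= E.
have e1 : cexp (PI * Complex x y) = cexp (- (PI * Complex x y)).
  apply/eqP; rewrite -subr_eq0; apply/eqP.
  have : csinh (PI * Complex x y) * 2 = 0 by rewrite E mul0r.
  by rewrite /csinh divfK.
have : normc (cexp (PI * Complex x y)) = normc (cexp (- (PI * Complex x y))) by rewrite e1.
rewrite !normc_cexp => /expR_inj /=; rewrite !mul0r subr0 => xE.
have x0 : x = 0.
  have /eqP : pi * x = 0 by lra.
  by rewrite mulf_eq0 gt_eqF ?pi_gt0 //= => /eqP.
split=> //; move: E; rewrite x0.
have -> : PI * Complex 0 y = I * (pi * y)%:C%C.
  by congr Complex => /=; ring.
rewrite csinh_im => /eqP; rewrite mulf_eq0 (negbTE i_neq0) /= => /eqP.
by case.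
Qed.

(** Width 3/2 gives an open neighbourhood of the closed strip that still avoids the next zeros, at
    2i and -2i. *)
Lemma csinhc_pi_neq0 z : `|IM z| < 1 + 1 / 2 -> z != I -> z != - I ->
  csinhc (PI * z) != 0.
Proof.
move=> zi zI zNI; apply/eqP => E.
have [z0|z0] := eqVneq z 0; first by move: E; rewrite z0 mulr0 csinhc0 => /eqP; rewrite oner_eq0.
have [x0 sy] : RE z = 0 /\ sin (pi * IM z) = 0.
  by apply: csinh_pi_eq0; rewrite -csinhcE E mulr0.
have p0 := pi_gt0 R.
have pos y : 0 < y -> y < 1 + 1 / 2 -> y != 1 -> sin (pi * y) != 0.
  move=> y0 y2 y1; have [yl|yg] := ltP y 1.
    by rewrite gt_eqF // sin_gt0_pi // mulr_gt0 //= -[ltRHS]mulr1 ltr_pM2l.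
  have y1' : 1 < y by rewrite lt_neqAle eq_sym y1.
  have -> : pi * y = pi * (y - 1) + pi by ring.
  by rewrite sinDpi oppr_eq0 gt_eqF // sin_gt0_pi // mulr_gt0 ?subr_gt0 //= -[ltRHS]mulr1 ltr_pM2l //; lra.
case: z zi zI zNI x0 sy z0 {E} => x y /=; rewrite ltr_norml !eq_complex /= => yi zI zNI x0 sy.
move: zI zNI; rewrite x0 oppr0 !eqxx /= => y1 yN1 y0.
have [yp|yn] := ltP 0 y.
  by have := pos y yp _ y1; rewrite sy eqxx => h; move: yi => /andP[_ /h].
have yn' : 0 < - y by rewrite oppr_gt0 lt_neqAle y0.
have := pos (- y) yn'; rewrite mulrN sinN sy oppr0 eqxx => h.
have : false by apply: h; [lra|rewrite eqr_oppLR].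
by [].
Qed.

Variable t : R.
Hypothesis t0 : 0 < t.

Definition sh : R := (expR t - expR (- t)) / 2.
Definition ch : R := (expR t + expR (- t)) / 2.
Local Notation csh := (csinh t%:C%C).
Local Notation cch := (ccosh t%:C%C).
Local Notation a := (I * t%:C%C).

(* [z cos(tz) sinh t - sin(tz) cosh t] *)
Definition test_num z : R[i] := z * ccosh (a * z) * csh + I * csinh (a * z) * cch.
(* [test_num z / z] and [test_num (i + w) / w], continued across their zeros. *)
Definition test_num0 z : R[i] := ccosh (a * z) * csh - t%:C%C * csinhc (a * z) * cch.
Definition test_num1 w : R[i] := (cch * ccosh (a * w) - csh * csinh (a * w)) * csh
  - t%:C%C * csinhc (a * w).

Lemma t_csinhc z : z * (t%:C%C * csinhc (a * z)) = - I * csinh (a * z).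
Proof.
rewrite -csinhcE.
have -> : - I * (I * t%:C%C * z * csinhc (a * z)) = - (I * I) * (z * (t%:C%C * csinhc (a * z))) by ring.
by rewrite i_sq opprK mul1r.
Qed.

Lemma test_num0E z : z * test_num0 z = test_num z.
Proof.
rewrite /test_num0 /test_num mulrBr; congr (_ + _); first by rewrite mulrA.
by rewrite mulrA t_csinhc mulNr mulNr opprK.
Qed.

Lemma ai : a * I = - t%:C%C.
Proof. by rewrite mulrAC i_sq mulN1r. Qed.

(** The coefficients [sinh t] and [cosh t] pay off here: in the part without the factor [w] the
    terms in [cosh (a w)] cancel, and [cosh^2 t - sinh^2 t = 1] leaves [I * csinh (a * w)], which is
    itself divisible by [w]. *)
Lemma test_num_addi w : test_num (I + w) = w * test_num1 w.
Proof.
rewrite /test_num /test_num1 mulrBr t_csinhc !mulrDr ai ccoshD csinhD ccoshN csinhN.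
have := ccosh_sq_sub t%:C%C.
set c := cch; set s := csh; set C := ccosh (a * w); set S := csinh (a * w) => E.
transitivity (w * ((c * C - s * S) * s) + I * S * (c * c - s * s)); first by ring.
by rewrite E; ring.
Qed.

Lemma test_numN z : test_num (- z) = - test_num z.
Proof. by rewrite /test_num !mulrN ccoshN csinhN; ring. Qed.

(* The value at [i] and [-i] fills the removable singularity. *)
Definition test_fun z : R[i] :=
  if (z == I) || (z == - I) then - (test_num1 0 / PI) else test_num0 z / (PI * csinhc (PI * z)).

Lemma test_funN z : test_fun (- z) = test_fun z.
Proof.
rewrite /test_fun eqr_oppLR eqr_opp orbC; case: ifP => // _.
by rewrite /test_num0 !mulrN ccoshN !csinhcN.
Qed.

Lemma test_fun_quot z : z != 0 -> z != I -> z != - I ->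
  test_fun z = test_num z / csinh (PI * z).
Proof.
move=> z0 zi zNi; rewrite /test_fun (negbTE zi) (negbTE zNi) /= -test_num0E -csinhcE.
have -> : PI * z * csinhc (PI * z) = z * (PI * csinhc (PI * z)) by ring.
by rewrite -mulf_div divff // mul1r.
Qed.

Lemma cdiff_mul_csinhc b z : exists l, cdiff (fun z => csinhc (b * z)) z l.
Proof. by have [l dl] := cdiff_csinhc (b * z); exists (b * l); exact: cdiff_scale. Qed.

Lemma cdiff_mul_ccosh b z : exists l, cdiff (fun z => ccosh (b * z)) z l.
Proof. by have [l dl] := cdiff_ccosh (b * z); exists (b * l); exact: cdiff_scale. Qed.

Lemma cdiff_mul_csinh b z : exists l, cdiff (fun z => csinh (b * z)) z l.
Proof. by have [l dl] := cdiff_csinh (b * z); exists (b * l); exact: cdiff_scale. Qed.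

Lemma cdiff_test_num0 z : exists l, cdiff test_num0 z l.
Proof.
have [l1 d1] := cdiff_mul_ccosh a z; have [l2 d2] := cdiff_mul_csinhc a z.
have [l3 d3] := cdiffM d1 (cdiff_cst csh z).
have [l4 d4] := cdiffM (cdiff_cst (- (t%:C%C * cch)) z) d2.
have [l5 d5] := cdiffD d3 d4.
exists l5; apply: cdiff_eq_near ltr01 _ d5 => h _; rewrite /test_num0; ring.
Qed.

Lemma cdiff_test_num1 z : exists l, cdiff test_num1 z l.
Proof.
have [l1 d1] := cdiff_mul_ccosh a z; have [l2 d2] := cdiff_mul_csinhc a z.
have [l0 d0] := cdiff_mul_csinh a z.
have [l3 d3] := cdiffM d1 (cdiff_cst (cch * csh) z).
have [l4 d4] := cdiffM (cdiff_cst (- t%:C%C) z) d2.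
have [l6 d6] := cdiffM (cdiff_cst (- (csh * csh)) z) d0.
have [l5 d5] := cdiffD d3 d4; have [l7 d7] := cdiffD d5 d6.
exists l7; apply: cdiff_eq_near ltr01 _ d7 => h _; rewrite /test_num1; ring.
Qed.

Lemma cdiff_quot F z : (exists l, cdiff F z l) -> csinhc (PI * z) != 0 ->
  exists l, cdiff (fun z => F z / (PI * csinhc (PI * z))) z l.
Proof.
move=> [l dF] z0; have [m dm] := cdiff_mul_csinhc PI z.
have [k dk] := cdiffM (cdiff_cst PI z) dm.
have [|n dn] := cdiffV _ dk; first by rewrite mulf_neq0 ?cpi_neq0.
exact: (cdiffM dF dn).
Qed.

(** Near i the function is a quotient whose denominator does not vanish at [w = 0]. The radius 1
    keeps [I + w] away from 0 and from -i. *)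
Lemma test_fun_addi w : normc w < 1 -> test_fun (I + w) = - (test_num1 w / (PI * csinhc (PI * w))).
Proof.
move=> w1; have [->|w0] := eqVneq w 0.
  by rewrite addr0 /test_fun eqxx /= mulr0 csinhc0 mulr1.
have n2 : normc (I * 2) = 2.
  have e2 : 2 = (2 : R)%:C%C :> R[i] by rewrite rmorphMn rmorph1.
  by rewrite normcM normc_i mul1r e2 normc_real ger0_norm.
have q0 : I + w != 0.
  apply/eqP => E; have wE : w = - I by rewrite -[w](addKr I) E addr0.
  by move: w1; rewrite wE normcN normc_i ltxx.
have q1 : I + w != I by rewrite -subr_eq0 addrAC subrr add0r.
have q2 : I + w != - I.
  apply/eqP => E; have wE : w = - (I * 2) by rewrite -[w](addKr I) E; ring.
  by move: w1; rewrite wE normcN n2; lra.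
rewrite test_fun_quot // test_num_addi [PI * (I + w)]mulrDr csinhD [PI * I]mulrC ccosh_im csinh_im cospi sinpi.
rewrite rmorphN1 mulr0 mul0r add0r mulN1r -csinhcE.
rewrite invrN mulrN; congr (- _).
have -> : PI * w * csinhc (PI * w) = w * (PI * csinhc (PI * w)) by ring.
by rewrite -mulf_div divff // mul1r.
Qed.

(** At i this is [test_fun_addi], at -i evenness; elsewhere, 0 included, the quotient by [csinhc]
    has a nonzero denominator. *)
Lemma cdiff_test_fun z : `|IM z| < 1 + 1 / 2 -> exists l, cdiff test_fun z l.
Proof.
move=> zi.
have atI : exists l, cdiff test_fun I l.
  have [|l dl] := @cdiff_quot test_num1 0 (cdiff_test_num1 0).
    by rewrite mulr0 csinhc0 oner_neq0.
  have [m dm] := cdiffM (cdiff_cst (-1) 0) dl.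
  exists m => e e0; have [d d0 hd] := dm e e0.
  exists (Num.min d 1); first by rewrite lt_min d0 ltr01.
  move=> h; rewrite lt_min => /andP[hd' h1].
  have := hd h hd'; rewrite add0r -[X in test_fun X - _]/(I + h).
  have := @test_fun_addi 0; rewrite addr0 ComplexField.Normc.normc0 ltr01 => /(_ isT) ->.
  by rewrite test_fun_addi // !mulN1r.
have [->//|zI] := eqVneq z I.
have [->|zNI] := eqVneq z (- I).
  have [l dl] := atI; exists (- l).
  have dl' : cdiff test_fun (- - I) l by rewrite opprK.
  apply: cdiff_eq_near ltr01 _ (cdiff_opp dl') => h _.
  by rewrite test_funN.
have [|l dl] := @cdiff_quot test_num0 z (cdiff_test_num0 z).
  exact: csinhc_pi_neq0.
exists l; pose d := Num.min (normc (z - I)) (normc (z + I)).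
have d0 : 0 < d by rewrite lt_min !normc_gt0 subr_eq0 zI addr_eq0 zNI.
apply: cdiff_eq_near d0 _ dl => h; rewrite lt_min => /andP[h1 h2].
rewrite /test_fun; case: eqVneq => [E|_] /=.
  by move: h1; rewrite -E opprD addrA subrr add0r normcN ltxx.
case: eqVneq => [E|//].
have E' : I = - (z + h) by rewrite E opprK.
by move: h2; rewrite E' opprD addrA subrr add0r normcN ltxx.
Qed.

(** Away from the imaginary axis the smaller exponential is at most half of the larger one, which
    leaves a quarter of the latter. *)
Lemma csinh_pi_lower z : 1 <= `|RE z| -> expR (pi * `|RE z|) / 4 <= normc (csinh (PI * z)).
Proof.
move=> z1; have p1 : 1 <= pi :> R := pi_ge1.
have key (u v : R[i]) (b : R) : 1 <= b -> normc u = expR (pi * b) -> normc v = expR (- (pi * b)) ->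
    expR (pi * b) / 2 <= normc (u - v).
  move=> b1 nu nv; have := normcD (u - v) v; rewrite subrK nu nv.
  have e1 : expR (- (pi * b)) = expR (pi * b) * expR (- (2 * pi * b)).
    by rewrite -expRD; congr expR; ring.
  have e2 : expR (- (2 * pi * b)) <= 1 / 2.
    rewrite expRN div1r lef_pV2 ?posrE ?expR_gt0 //.
    apply: le_trans (expR_ge1Dx _); nra.
  have e3 := expR_gt0 (pi * b); rewrite e1.
  have : expR (pi * b) * expR (- (2 * pi * b)) <= expR (pi * b) * (1 / 2) by rewrite ler_wpM2l // ltW.
  lra.
have n2 : normc 2^-1 = 2^-1 :> R.
  have e2 : 2^-1 = (2^-1 : R)%:C%C :> R[i] by rewrite fmorphV rmorphMn rmorph1.
  by rewrite e2 normc_real ger0_norm.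
rewrite /csinh normcM n2.
have E1 : RE (PI * z) = pi * RE z by case: z {z1} => x y /=; rewrite mul0r subr0.
have E2 : RE (- (PI * z)) = - (pi * RE z) by rewrite -E1; case: (_ * _).
suff : expR (pi * `|RE z|) / 2 <= normc (cexp (PI * z) - cexp (- (PI * z))) by lra.
have [zp|zn] := leP 0 (RE z).
  by rewrite ger0_norm // in z1 *; apply: key => //; rewrite normc_cexp ?E1 ?E2.
rewrite -normcN opprB ltr0_norm // in z1 *.
by apply: key => //; rewrite normc_cexp ?E1 ?E2; congr expR; ring.
Qed.

Lemma normc_test_num z : `|IM z| <= 1 -> 1 <= normc z ->
  normc (test_num z) <= normc z * (expR t * (normc csh + normc cch)).
Proof.
move=> zi z1; have rb : `|RE (a * z)| <= t.
  case: z zi {z1} => x y /= zi.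
  have -> : (0 * t - 1 * 0) * x - (0 * 0 + 1 * t) * y = - (t * y) by ring.
  by rewrite normrN normrM gtr0_norm // ler_piMr // ltW.
have nC : normc (ccosh (a * z)) <= expR t.
  by apply: le_trans (normc_ccosh _) _; rewrite ler_expR.
have nS : normc (csinh (a * z)) <= expR t.
  by apply: le_trans (normc_csinh _) _; rewrite ler_expR.
rewrite /test_num; apply: le_trans (normcD _ _) _.
rewrite mulrDr mulrDr; apply: lerD.
  rewrite normcM [normc (z * _)]normcM -mulrA ler_wpM2l ?normc_ge0 //.
  by rewrite ler_wpM2r ?normc_ge0.
rewrite normcM [normc (I * _)]normcM normc_i mul1r.
apply: (@le_trans _ _ (expR t * normc cch)); first by rewrite ler_wpM2r ?normc_ge0.
by rewrite ler_peMl // mulr_ge0 ?expR_ge0 ?normc_ge0.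
Qed.

(** The cube of [x <= 3 e^(pi x / 6)], which follows from [1 + y <= e^y] and [2 <= pi]. It trades
    the surplus of exponential decay of the test functions for powers of [|z|]. *)
Lemma cube_le_expR x : 0 <= x -> x ^+ 3 <= 27 * expR (pi * x / 2).
Proof.
move=> x0; have h : x <= 3 * expR (pi * x / 6).
  have := expR_ge1Dx (pi * x / 6); have := @pi_ge2 R; nra.
have -> : 27 * expR (pi * x / 2) = (3 * expR (pi * x / 6)) ^+ 3.
  rewrite exprMn -expRM_natl; congr (_ * expR _); first by ring.
  by field.
by rewrite lerXn2r ?nnegrE // mulr_ge0 ?expR_ge0.
Qed.

Lemma test_fun_domain : domain_Hw test_fun.
Proof.
split.
  exists (1 / 2); split; first by rewrite divr_gt0.
  by move=> z zi; split; [exact/derivable_cdiff/cdiff_test_fun|exact: test_funN].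
pose K := expR t * (normc csh + normc cch).
have K0 : 0 <= K by rewrite mulr_ge0 ?expR_ge0 // addr_ge0 ?normc_ge0.
(* The constant is 4 times 8 times 27: 4 from [csinh_pi_lower], 8 from [|z| <= 2 |Re z|] cubed, 27
   from [cube_le_expR]. *)
exists 1; split=> //; exists (864 * K), 1 => z zi z1.
have nz1 : 1 <= normc z by apply: le_trans z1 (normRe_le z).
have znz : z != 0 by rewrite -normc_gt0; lra.
have reI (w : R[i]) : RE w = 0 -> z != w.
  by move=> w0; apply/eqP => zw; move: z1; rewrite zw w0 normr0; lra.
rewrite test_fun_quot ?reI //=; last by rewrite oppr0.
rewrite normcM normcV.
have e0 := expR_gt0 (pi * `|RE z|).
have lo := csinh_pi_lower z1; have nS : 0 < normc (csinh (PI * z)) by lra.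
rewrite ler_pdivrMr //.
apply: le_trans (normc_test_num zi nz1) _; rewrite -/K.
have -> : - 1 - 1 = - 2%:R :> R by ring.
rewrite powRN powR_mulrn ?normc_ge0 //.
set E := expR (- (pi * `|RE z| / 2)); have E0 : 0 < E by exact: expR_gt0.
apply: (@le_trans _ _ (864 * K * ((normc z ^+ 2)^-1 * E) * (expR (pi * `|RE z|) / 4))); last first.
  apply: ler_wpM2l lo; apply: mulr_ge0; first by rewrite mulr_ge0 ?ler0n.
  by rewrite mulr_ge0 ?(ltW E0) // invr_ge0 sqr_ge0.
have zn0 : 0 < normc z by lra.
have EE : E * expR (pi * `|RE z|) = expR (pi * `|RE z| / 2).
  by rewrite /E -expRD; congr expR; field.
have z3 : normc z ^+ 3 <= 216 * expR (pi * `|RE z| / 2).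
  have z2 : normc z <= 2 * `|RE z| by have := normc_le_add z; lra.
  apply: (@le_trans _ _ ((2 * `|RE z|) ^+ 3)).
    by rewrite lerXn2r ?nnegrE ?normc_ge0 // mulr_ge0.
  by have := cube_le_expR (normr_ge0 (RE z)); rewrite exprMn; lra.
have -> : 864 * K * ((normc z ^+ 2)^-1 * E) * (expR (pi * `|RE z|) / 4) =
   K * (216 * (E * expR (pi * `|RE z|))) * (normc z ^+ 2)^-1 by field; rewrite gt_eqF.
rewrite EE ler_pdivlMr ?exprn_gt0 //.
have -> : normc z * K * normc z ^+ 2 = K * normc z ^+ 3 by ring.
by rewrite ler_wpM2l.
Qed.

Lemma csh_real : csh = sh%:C%C. Proof. exact: csinh_real. Qed.
Lemma cch_real : cch = ch%:C%C. Proof. exact: ccosh_real. Qed.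

Lemma ccosh_real_line s : ccosh (a * s%:C%C) = (cos (t * s))%:C%C.
Proof. by rewrite -mulrA -rmorphM ccosh_im. Qed.

Lemma csinh_real_line s : csinh (a * s%:C%C) = I * (sin (t * s))%:C%C.
Proof. by rewrite -mulrA -rmorphM csinh_im. Qed.

Lemma test_num_real s : test_num s%:C%C = (s * cos (t * s) * sh - sin (t * s) * ch)%:C%C.
Proof.
rewrite /test_num csinh_real_line ccosh_real_line mulrA i_sq csh_real cch_real.
by rewrite mulN1r mulNr rmorphB !rmorphM.
Qed.

Lemma test_fun_line s : s != 0 ->
  restrict_line test_fun s =
  ((s * cos (t * s) * sh - sin (t * s) * ch) / ((expR (pi * s) - expR (- (pi * s))) / 2))%:C%C.
Proof.
move=> s0; have reI (w : R[i]) : IM w != 0 -> s%:C%C != w.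
  by apply: contraNneq => <-.
have s0' : s%:C%C != 0 :> R[i] by rewrite eq_complex /= eqxx andbT.
have sI : s%:C%C != I by apply: reI; rewrite /= oner_eq0.
have sNI : s%:C%C != - I by apply: reI; rewrite /= oppr_eq0 oner_eq0.
rewrite /restrict_line test_fun_quot //.
by rewrite test_num_real -rmorphM csinh_real [RHS]rmorphM fmorphV.
Qed.

(** On both lines the denominator is [- sinh (pi s)], and the numerators are [s] times values of
    [test_num1] at opposite points. Their difference keeps only the odd part of [test_num1], hence
    the lone sine, and the factor [s] cancels the division in [opL]. *)
Lemma opL_test_fun s : s != 0 ->
  opL test_fun s =
  (2 * sh ^+ 2 * sin (t * s) / ((expR (pi * s) - expR (- (pi * s))) / 2))%:C%C.
Proof.
move=> s0; have s0' : s%:C%C != 0 :> R[i] by rewrite eq_complex /= eqxx andbT.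
have reI (z w : R[i]) : RE z != RE w -> z != w by apply: contra_neq => ->.
have q z : RE z = s -> test_fun z = test_num z / csinh (PI * z).
  by move=> zs; apply: test_fun_quot; apply: reI; rewrite zs /= ?oppr0.
rewrite /opL q ?real_addi // q ?real_subi // -real_addi -real_subi.
have S1 := csinh_pi_addi s.
have S2 : csinh (PI * (s%:C%C - I)) = - csinh (PI * s%:C%C).
  have := csinh_pi_addi (- s); rewrite rmorphN mulrN csinhN opprK => <-.
  by rewrite -csinhN; congr csinh; ring.
rewrite S1 S2.
have N1 : test_num (s%:C%C + I) = s%:C%C * test_num1 s%:C%C by rewrite addrC test_num_addi.
have N2 : test_num (s%:C%C - I) = s%:C%C * test_num1 (- s%:C%C).
  have -> : s%:C%C - I = - (I + - s%:C%C) by ring.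
  by rewrite test_numN test_num_addi mulNr opprK.
rewrite N1 N2.
have D : test_num1 s%:C%C - test_num1 (- s%:C%C) = - (2 * (csh * csh) * (I * (sin (t * s))%:C%C)).
  by rewrite /test_num1 !mulrN ccoshN csinhN csinhcN -csinh_real_line; ring.
have -> : s%:C%C * test_num1 s%:C%C / - csinh (PI * s%:C%C) -
    s%:C%C * test_num1 (- s%:C%C) / - csinh (PI * s%:C%C) =
    - (s%:C%C * (test_num1 s%:C%C - test_num1 (- s%:C%C)) / csinh (PI * s%:C%C)).
  by rewrite invrN; ring.
rewrite D.
have -> : (I * s%:C%C)^-1 * - (s%:C%C * - (2 * (csh * csh) * (I * (sin (t * s))%:C%C)) / csinh (PI * s%:C%C))
  = 2 * (csh * csh) * (sin (t * s))%:C%C / csinh (PI * s%:C%C).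
  apply: (mulfI (_ : I * s%:C%C != 0)).
    by rewrite mulf_neq0 // i_neq0.
  by rewrite mulVKf ?mulf_neq0 ?i_neq0 //; ring.
have e2 : 2 = (2 : R)%:C%C :> R[i] by rewrite rmorphMn rmorph1.
have sE : csinh (PI * s%:C%C) = ((expR (pi * s) - expR (- (pi * s))) / 2)%:C%C.
  by rewrite -rmorphM csinh_real.
by rewrite csh_real sE e2 expr2 -fmorphV -!rmorphM mulrA.
Qed.

End TestFunctions.

(** * Uniqueness for the Fourier transform *)

Section SineTransform.
Context {R : realType}.
Local Notation mu := (@lebesgue_measure R).
Implicit Types (f g k : R -> R) (s t x y : R).

Lemma is_derive_Rintegral (f df : R -> R -> R) G (u v a : R) :
  a \in `]u, v[ ->
  (forall x, x \in `]u, v[ -> mu.-integrable setT (EFin \o f x)) ->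
  (forall x s, x \in `]u, v[ -> is_derive x 1 (f ^~ s) (df x s)) ->
  mu.-integrable setT (EFin \o G) ->
  (forall x s, x \in `]u, v[ -> `|df x s| <= G s) ->
  is_derive a 1 (fun x => \int[mu]_s f x s) (\int[mu]_s df a s).
Proof.
move=> auv fi fd Gi dG.
have dE x s : x \in `]u, v[ -> partial1of2 f x s = df x s.
  by move=> xuv; rewrite partial1of2E; have := fd x s xuv => -[_ ->].
have G0 s : 0 <= G s by apply: le_trans (dG a s auv).
have fder x s : x \in `]u, v[ -> setT s -> derivable (f ^~ s) x 1.
  by move=> xuv _; have := fd x s xuv => -[].
have ub x s : x \in `]u, v[ -> setT s -> `|partial1of2 f x s| <= G s.
  by move=> xuv _; rewrite dE // dG.
have D := @derivable_under_integral _ _ _ mu f setT measurableT a u v auv fi fder G G0 Gi ub.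
apply: DeriveDef D _.
have := @differentiation_under_integral _ _ _ mu f setT measurableT a u v auv fi fder G G0 Gi ub.
rewrite derive1E => ->.
by apply: eq_Rintegral => s _; rewrite dE.
Qed.

End SineTransform.

Section FourierUniqueness.
Context {R : realType}.
Local Notation mu := (@lebesgue_measure R).
Implicit Types (f g : R -> R) (s t x y : R).

Lemma integrable_bounded_mul f g (M : R) : mu.-integrable setT (EFin \o f) ->
  measurable_fun setT g -> (forall s, `|g s| <= M) ->
  mu.-integrable setT (EFin \o (fun s => f s * g s)).
Proof.
move=> fi mg gM; have mf : measurable_fun setT f.
  by apply/measurable_EFinP; case/integrableP : fi.
have fa : mu.-integrable setT (EFin \o (fun s => M * `|f s|)).
  by apply: integrable_RZ; have := integrable_abse fi; apply: eq_integrable.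
apply: integrable_Rdom fa; first exact: measurable_funM.
by move=> s; rewrite normrM mulrC ler_wpM2r.
Qed.

Lemma Rintegral_odd f : mu.-integrable setT (EFin \o f) ->
  (forall s, f (- s) = - f s) -> \int[mu]_s f s = 0.
Proof.
move=> fi fo; have mf : measurable_fun setT f.
  by apply/measurable_EFinP; case/integrableP : fi.
have mfE : measurable_fun setT (EFin \o f) by exact/measurable_EFinP.
have fN : mu.-integrable setT ((EFin \o f) \o (-%R : _ -> measurableTypeR R)).
  have := integrable_RZ (-1) fi; apply: eq_integrable => // s _.
  by rewrite /= fo mulN1r.
have mN : measurable_fun setT (-%R : R -> measurableTypeR R).
  by apply: continuous_measurable_fun; exact: opp_continuous.
have := @integral_pushforward _ _ (measurableTypeR R) (measurableTypeR R) R -%R mN mu setT (EFin \o f) mfE fN measurableT.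
rewrite preimage_setT.
have -> : (\int[pushforward mu (-%R : R -> measurableTypeR R)]_y (EFin \o f) y = \int[mu]_y (EFin \o f) y)%E.
  by apply: eq_measure_integral => A mA _; exact: lebesgue_measureN.
move=> E; have : \int[mu]_s f s = \int[mu]_s (-1 * f s).
  rewrite /Rintegral -[in LHS]/(fine (\int[mu]_s (EFin \o f) s)%E) E; congr fine.
  by apply: eq_integral => s _; rewrite /= fo mulN1r.
have aux (x : R) : x = -1 * x -> x = 0 by lra.
by rewrite RintegralZl // => /aux.
Qed.

Variable k : R -> R.
Hypothesis ki : mu.-integrable setT (EFin \o k).
Hypothesis ksin : forall t, \int[mu]_s (k s * sin (t * s)) = 0.
Hypothesis kcos : forall t, \int[mu]_s (k s * cos (t * s)) = 0.

Let mk : measurable_fun setT k.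
Proof. by apply/measurable_EFinP; case/integrableP : ki. Qed.

Let ki_bound (M : R) : mu.-integrable setT (EFin \o (fun s => M * `|k s|)).
Proof. by apply: integrable_RZ; have := integrable_abse ki; apply: eq_integrable. Qed.

(** The cosine integral vanishes about every centre [b], so the position can be used as a parameter
    below. *)
Let kcos_shift t b : \int[mu]_s (k s * cos (t * (s - b))) = 0.
Proof.
have msin : measurable_fun setT (fun s => sin (t * s)).
  by apply: measurableT_comp; [apply: continuous_measurable_fun; exact: continuous_sin|exact: measurable_funM].
have mcos : measurable_fun setT (fun s => cos (t * s)).
  by apply: measurableT_comp; [apply: continuous_measurable_fun; exact: continuous_cos|exact: measurable_funM].
have i1 := integrable_RZ (cos (t * b)) (integrable_bounded_mul ki mcos (fun s => cos_max (t * s))).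
have i2 := integrable_RZ (sin (t * b)) (integrable_bounded_mul ki msin (fun s => sin_max (t * s))).
rewrite (_ : (fun s => _) = (fun s => cos (t * b) * (k s * cos (t * s)) + sin (t * b) * (k s * sin (t * s)))).
  rewrite RintegralD // !RintegralZl //; last 2 first.
  - exact: integrable_bounded_mul ki msin (fun s => sin_max (t * s)).
  - exact: integrable_bounded_mul ki mcos (fun s => cos_max (t * s)).
  by rewrite kcos ksin !mulr0 addr0.
apply/funext => s; rewrite mulrBr cosB; ring.
Qed.

(* The antiderivative in [T] of [exp (- e T) cos (T u)] vanishing at [T = 0]. *)
Definition damped (e T u : R) : R :=
  (e + expR (- (e * T)) * (u * sin (T * u) - e * cos (T * u))) / (e ^+ 2 + u ^+ 2).

(** Uniformity in [u] makes [damped] a bounded multiplier of [k]; it comes from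
    [|u| <= e + u^2 / e]. *)
Lemma damped_bound e T u : 0 < e -> `|damped e T u| <= 3 * (1 + expR (- (e * T))) / e.
Proof.
move=> e0; have D0 : 0 < e ^+ 2 + u ^+ 2 by rewrite ltr_pwDl ?exprn_gt0 ?sqr_ge0.
rewrite /damped normrM normfV [`|_ + u ^+ 2|]gtr0_norm // ler_pdivrMr //.
set E := expR _; have E0 : 0 < E by exact: expR_gt0.
have h1 : `|u * sin (T * u) - e * cos (T * u)| <= `|u| + e.
  apply: le_trans (ler_normB _ _) _; rewrite !normrM (gtr0_norm e0); apply: lerD.
    by rewrite ler_piMr ?sin_max.
  by rewrite ler_piMr ?cos_max // ltW.
have h2 : `|e + E * (u * sin (T * u) - e * cos (T * u))| <= e + E * (`|u| + e).
  apply: le_trans (ler_normD _ _) _; rewrite (gtr0_norm e0) lerD2l normrM (gtr0_norm E0).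
  by rewrite ler_wpM2l // ltW.
apply: le_trans h2 _.
have u2 : u ^+ 2 = `|u| ^+ 2 by rewrite real_normK ?num_real.
have -> : 3 * (1 + E) / e * (e ^+ 2 + u ^+ 2) = (1 + E) * (3 * e + 3 * (u ^+ 2 / e)).
  by field; rewrite gt_eqF.
have h3 : `|u| <= e + u ^+ 2 / e.
  rewrite -(ler_pM2l e0) mulrDr [e * (_ / e)]mulrC divfK ?gt_eqF // u2.
  have := sqr_ge0 (`|u| - e); have := normr_ge0 u; nra.
have h4 : 0 <= u ^+ 2 / e by rewrite divr_ge0 ?sqr_ge0 // ltW.
have h5 : 0 <= E * (3 * e + 3 * (u ^+ 2 / e) - (`|u| + e)) by rewrite mulr_ge0 ?(ltW E0) //; lra.
nra.
Qed.

Lemma is_derive_damped (e T u : R) : 0 < e ->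
  is_derive T 1 (fun T : R => damped e T u) (expR (- (e * T)) * cos (T * u)).
Proof.
move=> e0; have D0 : 0 < e ^+ 2 + u ^+ 2 by rewrite ltr_pwDl ?exprn_gt0 ?sqr_ge0.
have d1 : is_derive T 1 (fun T : R => - (e * T)) (- e).
  by apply: is_derive_eq; rewrite /GRing.scale /=; ring.
have d2 : is_derive T 1 (fun T : R => T * u) u.
  by apply: is_derive_eq; rewrite /GRing.scale /=; ring.
have d3 := @is_derive1_comp R expR (fun T : R => - (e * T)) T _ _ (is_derive_expR _) d1.
have d4 := @is_derive1_comp R sin (fun T : R => T * u) T _ _ (is_derive_sin _) d2.
have d5 := @is_derive1_comp R cos (fun T : R => T * u) T _ _ (is_derive_cos _) d2.
have d6 := is_deriveM d3 (is_deriveB (is_deriveZ u d4) (is_deriveZ e d5)).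
have d7 := is_deriveZ (e ^+ 2 + u ^+ 2)^-1 (is_deriveD (is_derive_cst e T 1) d6).
have -> : (fun T => damped e T u) =
  ((e ^+ 2 + u ^+ 2)^-1 \*: (cst e + (expR \o (fun T => - (e * T))) *
    (u \*: (sin \o (fun T => T * u)) - e \*: (cos \o (fun T => T * u))))).
  by apply/funext => x; rewrite /damped mulrC.
apply: is_derive_eq d7 _; rewrite /GRing.scale /= /GRing.scale /=.
have -> : (u \*: (sin \o *%R^~ u) - e \*: (cos \o *%R^~ u)) T =
  u * sin (T * u) - e * cos (T * u) by [].
by field; rewrite gt_eqF.
Qed.

Let measurable_damped e T b : measurable_fun setT (fun s => damped e T (s - b)).
Proof.
have ms : measurable_fun setT (fun s : R => s - b) by exact: measurable_funB.
have mT : measurable_fun setT (fun s : R => T * (s - b)) by exact: measurable_funM.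
have msin : measurable_fun setT (fun s => sin (T * (s - b))).
  by apply: measurableT_comp mT; apply: continuous_measurable_fun; exact: continuous_sin.
have mcos : measurable_fun setT (fun s => cos (T * (s - b))).
  by apply: measurableT_comp mT; apply: continuous_measurable_fun; exact: continuous_cos.
apply: measurable_funM.
  apply: measurable_funD => //; apply: measurable_funM => //.
  by apply: measurable_funB; exact: measurable_funM.
apply: measurableT_comp; first exact: measurable_invR.
by apply: measurable_funD => //; exact: measurable_funX.
Qed.

(** The integral of [k] against [damped] vanishes at [T = 0], and its derivative in [T] is a
    multiple of a cosine integral, hence 0. Letting [T = n] grow turns [damped] into the Poisson
    kernel. *)
Lemma poisson_integral_eq0 (e b : R) : 0 < e ->
  \int[mu]_s (k s * (e / (e ^+ 2 + (s - b) ^+ 2))) = 0.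
Proof.
move=> e0.
have di T : mu.-integrable setT (EFin \o (fun s => k s * damped e T (s - b))).
  exact: integrable_bounded_mul ki (measurable_damped e T b) (fun s => damped_bound T (s - b) e0).
have D (a : R) : is_derive a 1 (fun T : R => \int[mu]_s (k s * damped e T (s - b))) 0.
  have D0 : \int[mu]_s (k s * (expR (- (e * a)) * cos (a * (s - b)))) = 0.
    rewrite (_ : (fun s => _) = (fun s => expR (- (e * a)) * (k s * cos (a * (s - b))))); last first.
      by apply/funext => s; ring.
    rewrite RintegralZl ?kcos_shift ?mulr0 //.
    apply: integrable_bounded_mul ki _ (fun s => cos_max (a * (s - b))).
    by apply: measurableT_comp; [apply: continuous_measurable_fun; exact: continuous_cos
      |apply: measurable_funM => //; exact: measurable_funB].
  rewrite -[X in is_derive _ _ _ X]D0.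
  (* On this interval [a - 1 < T], which bounds the damping factor by [exp (e (1 - a))]. *)
  apply: (@is_derive_Rintegral _ (fun T s => k s * damped e T (s - b))
    (fun T s => k s * (expR (- (e * T)) * cos (T * (s - b))))
    (fun s => expR (e * (1 - a)) * `|k s|) (a - 1) (a + 1)).
  - by rewrite in_itv /=; apply/andP; split; lra.
  - by move=> T _; exact: di.
  - move=> T s _; exact: (is_deriveZ (k s) (is_derive_damped T (s - b) e0)).
  - exact: ki_bound.
  - move=> T s; rewrite in_itv /= => /andP[aT _].
    rewrite !normrM mulrC ler_wpM2r ?normr_ge0 // ger0_norm ?expR_ge0 //.
    rewrite -[leRHS]mulr1; apply: ler_pM; rewrite ?expR_ge0 ?normr_ge0 ?cos_max //.
    by rewrite ler_expR; nra.
have E n : \int[mu]_s (k s * damped e n%:R (s - b)) = 0.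
  rewrite (is_derive_0_is_cst n%:R 0 D).
  rewrite (_ : (fun s => _) = (fun=> 0)) ?Rintegral_cst ?mul0r //.
  apply/funext => s; rewrite /damped mulr0 oppr0 expR0 !mul0r sin0 cos0 mulr0 sub0r !mulr1 mul1r.
  by rewrite subrr mul0r mulr0.
have q1 : `|expR (- e)| < 1 by rewrite ger0_norm ?expR_ge0 // expR_lt1 oppr_lt0.
have qn : (expR (- e)) ^+ n @[n --> \oo] --> (0 : R) by exact: cvg_expr.
have cv u : damped e n%:R u @[n --> \oo] --> e / (e ^+ 2 + u ^+ 2).
  pose C : R := `|u| + e.
  have bnd n : `|expR (- (e * n%:R)) * (u * sin (n%:R * u) - e * cos (n%:R * u))| <= C * (expR (- e)) ^+ n.
    have En : expR (- (e * n%:R)) = expR (- e) ^+ n by rewrite -expRM_natl; congr expR; ring.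
    rewrite normrM ger0_norm ?expR_ge0 // En [leRHS]mulrC; apply: ler_wpM2l.
      by rewrite -En expR_ge0.
    apply: le_trans (ler_normB _ _) _; rewrite !normrM (gtr0_norm e0); apply: lerD.
      by rewrite ler_piMr ?sin_max.
    by rewrite ler_piMr ?cos_max // ltW.
  rewrite -[e in e / _]addr0; apply: cvgMr_tmp; apply: cvgD; first exact: cvg_cst.
  apply: norm_cvg0; apply: (@squeeze_cvgr _ _ _ _ (fun=> 0) (fun n => C * expR (- e) ^+ n)).
  - by apply: nearW => n; rewrite normr_ge0 bnd.
  - exact: cvg_cst.
  - by rewrite -(mulr0 C); exact: cvgMl_tmp.
(* The majorant [6 / e] is [damped_bound] with its exponential at most 1. *)
have := @Rintegral_dominated_cvg R (fun n s => k s * damped e n%:R (s - b))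
  (fun s => k s * (e / (e ^+ 2 + (s - b) ^+ 2))) (fun s => (6 / e) * `|k s|).
have -> : (fun n => \int[mu]_x (k x * damped e n%:R (x - b))) = (fun=> 0).
  by apply/funext => n; exact: E.
move=> H; apply/esym; apply: (@cvg_unique _ (@Rhausdorff R) ((fun=> 0 : R) @ \oo)); first exact: cvg_cst.
apply: H.
- by move=> n; apply: measurable_funM => //; exact: measurable_damped.
- apply: measurable_funM => //; apply: measurable_funM => //.
  apply: measurableT_comp; first exact: measurable_invR.
  by apply: measurable_funD => //; apply: measurable_funX; exact: measurable_funB.
- by apply: aeW => s; apply: cvgMl_tmp; exact: cv.
- exact: ki_bound.
- move=> n s; rewrite normrM mulrC ler_wpM2r ?normr_ge0 //.
  apply: le_trans (damped_bound _ _ e0) _; rewrite ler_pM2r ?invr_gt0 //.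
  have : expR (- (e * n%:R)) <= 1 by rewrite -expR0 ler_expR oppr_le0 mulr_ge0 // ltW.
  lra.
Qed.

Let measurable_atan e b : measurable_fun setT (fun s : R => atan ((b - s) / e)).
Proof.
apply: measurableT_comp; first by apply: continuous_measurable_fun => x; exact: continuous_atan.
by apply: measurable_funM => //; exact: measurable_funB.
Qed.

Let atan_max (x : R) : `|atan x| <= pi / 2.
Proof. by rewrite ler_norml !ltW ?atan_ltpi2 ?atan_gtNpi2. Qed.

(** The derivative of the left side in [b] is the Poisson integral at [b], which vanishes. *)
Lemma atan_integral_cst (e b : R) : 0 < e ->
  \int[mu]_s (k s * atan ((b - s) / e)) = \int[mu]_s (k s * atan ((0 - s) / e)).
Proof.
move=> e0; have en0 : e != 0 by rewrite gt_eqF.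
apply: (@is_derive_0_is_cst _ (fun b => \int[mu]_s (k s * atan ((b - s) / e)))) => {}b.
rewrite -[X in is_derive _ _ _ X](poisson_integral_eq0 b e0).
apply: (@is_derive_Rintegral _ (fun b s => k s * atan ((b - s) / e))
  (fun b s => k s * (e / (e ^+ 2 + (s - b) ^+ 2))) (fun s => e^-1 * `|k s|) (b - 1) (b + 1)).
- by rewrite in_itv /=; apply/andP; split; lra.
- by move=> x _; exact: integrable_bounded_mul ki (measurable_atan e x) (fun s => atan_max ((x - s) / e)).
- move=> x s _; apply: (@is_deriveZ _ _ _ (fun b : R => atan ((b - s) / e)) (k s)).
  have d1 : is_derive x 1 (fun b : R => (b - s) / e) e^-1.
    by apply: is_derive_eq; rewrite /GRing.scale /=; ring.
  have := @is_derive1_comp R atan (fun b : R => (b - s) / e) x _ _ (is_derive1_atan _) d1.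
  have D0 : 0 < e ^+ 2 + (s - x) ^+ 2 by rewrite ltr_pwDl ?exprn_gt0 ?sqr_ge0.
  have D1 : 0 < 1 + ((x - s) / e) ^+ 2 by rewrite ltr_pwDl ?sqr_ge0.
  have -> // : (1 + ((x - s) / e) ^+ 2)^-1 / e = e / (e ^+ 2 + (s - x) ^+ 2).
  have -> : 1 + ((x - s) / e) ^+ 2 = (e ^+ 2 + (s - x) ^+ 2) / e ^+ 2 by field.
  by field; rewrite en0 gt_eqF.
- exact: ki_bound.
- move=> x s _; rewrite normrM mulrC ler_wpM2r ?normr_ge0 //.
  have D0 : 0 < e ^+ 2 + (s - x) ^+ 2 by rewrite ltr_pwDl ?exprn_gt0 ?sqr_ge0.
  rewrite ger0_norm ?divr_ge0 ?(ltW e0) ?(ltW D0) // ler_pdivrMr // mulrDr.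
  have -> : e^-1 * e ^+ 2 = e by field.
  by rewrite lerDl mulr_ge0 ?sqr_ge0 // invr_ge0 ltW.
Qed.

(** As the width tends to 0, the arctangent centred at [c] tends to [pi] times the indicator of the
    half-line up to [c], minus [pi / 2]. The integrals do not depend on [c], hence neither does the
    integral of [k] over that half-line. *)
Lemma halfline_integral_cst (b : R) :
  \int[mu]_(s in `]-oo, b]) k s = \int[mu]_(s in `]-oo, 0]) k s.
Proof.
have cv (c : R) : \int[mu]_s (k s * atan ((c - s) / (n.+1%:R)^-1)) @[n --> \oo] -->
    pi * \int[mu]_(s in `]-oo, c]) k s - pi / 2 * \int[mu]_s k s.
  have ci : mu.-integrable setT (EFin \o (k \_ `]-oo, c])).
    apply: integrable_Rdom (ki_bound 1).
      by apply/measurable_restrict => //; apply: measurable_funS mk.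
    by move=> s; rewrite patchE mul1r; case: ifP => // _; rewrite normr0.
  rewrite Rintegral_mkcond -!RintegralZl // -RintegralB //; [|exact: integrable_RZ..].
  apply: (@Rintegral_dominated_cvg _ _ _ (fun s => pi / 2 * `|k s|)).
  - by move=> n; exact: measurable_funM.
  - apply: measurable_funB; apply: measurable_funM => //.
    by apply/measurable_restrict => //; apply: measurable_funS mk.
  (* At [s = c] the arctangents are all 0, while the limit formula would give [pi / 2]; the point is
     discarded as a null set. *)
  - have n0 : {ae mu, forall s, s != c}.
      exists [set c]; split => //; first exact: lebesgue_measure_set1.
      by move=> s /= /negP; rewrite negbK => /eqP.
    apply: (@filterS _ _ (ae_filter_ringOfSetsType mu)) n0 => s sc.
    have lim0 (u : R) : 0 < u -> atan (u / (n.+1%:R)^-1) @[n --> \oo] --> (pi / 2 : R).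
      move=> u0; have un : u / (n.+1%:R)^-1 @[n --> \oo] --> +oo%R.
        apply/cvgryPge => A; near=> n; rewrite invrK mulrC -ler_pdivrMr //.
        apply: (@le_trans _ _ n%:R); last by rewrite ler_nat.
        by near: n; exact: nbhs_infty_ger.
      exact: (cvg_comp _ _ un (@cvgy_atan R)).
    rewrite patchE; have [scl|scg] := leP s c.
      have su : 0 < c - s by rewrite subr_gt0 lt_neqAle sc.
      rewrite ifT; last by apply/mem_set; rewrite /= in_itv.
      have -> : pi * k s - pi / 2 * k s = k s * (pi / 2) by field.
      by apply: cvgMl_tmp; exact: lim0.
    rewrite ifF; last by apply/memNset; rewrite /= in_itv /= leNgt scg.
    have -> : pi * 0 - pi / 2 * k s = k s * - (pi / 2) by field.
    apply: cvgMl_tmp.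
    rewrite (_ : (fun n => _) = (fun n => - atan ((s - c) / (n.+1%:R)^-1))).
      by apply: cvgN; apply: lim0; rewrite subr_gt0.
    by apply/funext => n; rewrite -atanN -mulNr opprB.
  - exact: ki_bound.
  - by move=> n s; rewrite normrM mulrC ler_wpM2r ?normr_ge0.
have := cvg_unique (@Rhausdorff R) (cv b).
rewrite (_ : (fun n => _) = (fun n => \int[mu]_s (k s * atan ((0 - s) / (n.+1%:R)^-1)))); last first.
  by apply/funext => n; rewrite atan_integral_cst // invr_gt0.
have p0 : pi != 0 :> R by rewrite gt_eqF ?pi_gt0.
by move=> /(_ _ _ (cv 0)) /addIr /(mulfI p0).
Unshelve. all: by end_near. Qed.

(** Almost everywhere [k] is the derivative of its integral over half-lines, which is constant. *)
Lemma ae_eq0_of_fourier : {ae mu, forall s, k s = 0}.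
Proof.
have li : locally_integrable [set: R] k.
  by have := integrable_locally measurableT ki; rewrite patch_setT.
have iy (y : R) : mu.-integrable `]-oo, y] (EFin \o k).
  by apply: (integrableS _ _ _ ki) => //; exact: measurable_itv.
have := @FTC1Ny R k iy li.
apply: (@filterS _ _ (ae_filter_ringOfSetsType mu)) => s [_ <-].
rewrite (_ : (fun x => _) = (fun=> \int[mu]_(s in `]-oo, 0]) k s)).
  exact: derive1_cst.
by apply/funext => x; exact: halfline_integral_cst.
Qed.

End FourierUniqueness.

(** * The orthogonality relations *)

Section SinhBounds.
Context {R : realType}.
Implicit Types (x s : R).

Lemma sh_ge_half x : 0 <= x -> x / 2 <= sh x.
Proof.
move=> x0; rewrite /sh ler_pM2r ?invr_gt0 //.
have := expR_ge1Dx x; have : expR (- x) <= 1 by rewrite -expR0 ler_expR oppr_le0.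
lra.
Qed.

(** Tripling produces lower bounds of higher degree without power series: a linear bound at [x / 3]
    gives a cubic one at [x], and the cubic bound gives a quintic one. *)
Lemma sh_triple x : sh (3 * x) = 3 * sh x + 4 * sh x ^+ 3.
Proof.
have e3 : expR (3 * x) = expR x ^+ 3 by rewrite -expRM_natl.
have f3 : expR (- (3 * x)) = expR (- x) ^+ 3 by rewrite -expRM_natl; congr expR; ring.
have ef : expR x * expR (- x) = 1 by rewrite -expRD addrN expR0.
rewrite /sh e3 f3; move: ef; set e := expR x; set f := expR (- x) => ef.
have -> : 3 * ((e - f) / 2) + 4 * ((e - f) / 2) ^+ 3 =
  (e ^+ 3 - f ^+ 3) / 2 + 3 / 2 * (e - f) * (1 - e * f) by field.
by rewrite ef; ring.
Qed.

Lemma sh_ge_cube x : 0 <= x -> x / 2 + x ^+ 3 / 54 <= sh x.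
Proof.
move=> x0; have y0 : 0 <= x / 3 by rewrite divr_ge0.
have -> : sh x = sh (3 * (x / 3)) by congr sh; field.
rewrite sh_triple; have h := sh_ge_half y0.
have h3 : (x / 3 / 2) ^+ 3 <= sh (x / 3) ^+ 3 by rewrite lerXn2r ?nnegrE //; lra.
have e3 : (x / 3 / 2) ^+ 3 = x ^+ 3 / 216 by field.
lra.
Qed.

Lemma sh_ge_quint x : 0 <= x -> x ^+ 5 / 4374 <= sh x.
Proof.
move=> x0; have y0 : 0 <= x / 3 by rewrite divr_ge0.
have -> : sh x = sh (3 * (x / 3)) by congr sh; field.
rewrite sh_triple; have h := sh_ge_cube y0; have h' := sh_ge_half y0.
move: (sh (x / 3)) h h' => S h h'.
have c0 : 0 <= x ^+ 3 by exact: exprn_ge0.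
have b0 : 0 <= x ^+ 3 / 1458 by lra.
have e1 : x / 3 / 2 + (x / 3) ^+ 3 / 54 = x / 6 + x ^+ 3 / 1458 by field.
have h3 : (x / 6 + x ^+ 3 / 1458) ^+ 3 <= S ^+ 3 by rewrite lerXn2r ?nnegrE; lra.
(* Four times the cross term [x^5 / 17496] is the desired [x^5 / 4374]; the remaining terms are
   nonnegative. *)
have e3 : (x / 6 + x ^+ 3 / 1458) ^+ 3 = x ^+ 3 / 216 + x ^+ 5 / 17496 +
   x / 2 * (x ^+ 3 / 1458) ^+ 2 + (x ^+ 3 / 1458) ^+ 3 by field.
have e4 : 0 <= x / 2 * (x ^+ 3 / 1458) ^+ 2.
  by apply: mulr_ge0; [exact: divr_ge0|exact: sqr_ge0].
have e5 : 0 <= (x ^+ 3 / 1458) ^+ 3 by exact: exprn_ge0.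
move: h3 e4 e5 c0; rewrite e3; have S0 : 0 <= S by apply: le_trans h'; rewrite divr_ge0.
move: (x / 2 * (x ^+ 3 / 1458) ^+ 2) ((x ^+ 3 / 1458) ^+ 3) (x ^+ 3) (x ^+ 5) (S ^+ 3) S0 => A B C D E; clear; lra.
Qed.

(** The constant is twice 4374: one half of the multiple of [sh] pays for the first two powers
    through [sh_ge_cube], the other for the highest power through [sh_ge_quint]. *)
Lemma weight_lower s : s ^+ 2 + s ^+ 4 + s ^+ 6 <= 8748 * pi * weight s.
Proof.
wlog s0 : s / 0 <= s => [H|].
  have [|sn] := leP 0 s; first exact: H.
  have := H (- s); rewrite weight_even.
  have -> : (- s) ^+ 2 + (- s) ^+ 4 + (- s) ^+ 6 = s ^+ 2 + s ^+ 4 + s ^+ 6 by ring.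
  by apply; rewrite oppr_ge0 ltW.
have wE : weight s = pi^-1 * s * sh (pi * s) by [].
have pp := pi_gt0 R; have p1 := @pi_ge1 R.
rewrite wE; move: pp p1; set p : R := pi => pp p1.
have ps : s <= p * s by rewrite ler_peMl.
have ps0 : 0 <= p * s by apply: le_trans s0 ps.
have h1 := sh_ge_cube ps0; have h2 := sh_ge_quint ps0.
have m3 : s ^+ 3 <= (p * s) ^+ 3 by rewrite lerXn2r ?nnegrE.
have m5 : s ^+ 5 <= (p * s) ^+ 5 by rewrite lerXn2r ?nnegrE.
have z3 : 0 <= s ^+ 3 by rewrite exprn_ge0.
have -> : 8748 * p * (p^-1 * s * sh (p * s)) = s * (8748 * sh (p * s)) * (p / p) by ring.
rewrite divff ?gt_eqF // mulr1.
have -> : s ^+ 2 + s ^+ 4 + s ^+ 6 = s * (s + s ^+ 3 + s ^+ 5) by ring.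
rewrite ler_wpM2l //; lra.
Qed.

(* The constant comes from [sh_ge_quint] through [weight_lower]. *)
Definition decay_majorant s : R := 8748 * pi / (1 + s ^+ 2).

Lemma decay_majorant_ge0 s : 0 <= decay_majorant s.
Proof.
apply: divr_ge0; first by rewrite mulr_ge0 ?ler0n ?pi_ge0.
by have := sqr_ge0 s; lra.
Qed.

Lemma decay_majorant_integrable : (@lebesgue_measure R).-integrable setT (EFin \o decay_majorant).
Proof.
apply: (@continuous_decay_integrable _ _ (8748 * pi) 1 1) => //.
  move=> s; apply: cvgMl_tmp; apply: cvgV; first by rewrite gt_eqF // ltr_pwDl ?sqr_ge0.
  by apply: cvgD; [exact: cvg_cst|exact: exprn_continuous].
move=> s s1; rewrite ger0_norm ?decay_majorant_ge0 // /decay_majorant.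
have -> : - 1 - 1 = - 2%:R :> R by ring.
rewrite powRN powR_mulrn ?normr_ge0 //.
have c0 : 0 <= 8748 * pi :> R by rewrite mulr_ge0 ?ler0n ?pi_ge0.
apply: (ler_wpM2l c0).
have s2 : `|s| ^+ 2 = s ^+ 2 by rewrite real_normK ?num_real.
have sp : 0 < s ^+ 2 by rewrite -s2 exprn_gt0 //; lra.
by rewrite s2 lef_pV2 ?posrE ?ltr_pwDl ?(ltW sp) //; lra.
Qed.

(** The square of [p u] is at most [u^2 weight] times [decay_majorant], so [|p u|] is at most the
    sum of these two integrable functions. The cases [p = s] and [p = s^2] give the sine transform
    and its derivative. *)
Lemma moment_integrable (p u : R -> R) :
  measurable_fun setT p -> measurable_fun setT u ->
  (forall s, p s ^+ 2 * (1 + s ^+ 2) <= s ^+ 2 + s ^+ 4 + s ^+ 6) ->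
  (@lebesgue_measure R).-integrable setT (EFin \o (fun s => u s ^+ 2 * weight s)) ->
  (@lebesgue_measure R).-integrable setT (EFin \o (fun s => p s * u s)).
Proof.
move=> mp mu_ pb ui; apply: integrable_Rdom (integrable_RD ui decay_majorant_integrable).
  exact: measurable_funM.
move=> s; have S0 : 0 < 1 + s ^+ 2 by rewrite ltr_pwDl ?sqr_ge0.
have a0 : 0 <= u s ^+ 2 * weight s by rewrite mulr_ge0 ?sqr_ge0 ?weight_ge0.
have d0 := decay_majorant_ge0 s.
rewrite -ler_sqr ?nnegrE ?addr_ge0 // real_normK ?num_real //.
apply: (@le_trans _ _ (u s ^+ 2 * weight s * decay_majorant s)); last nra.
have -> : u s ^+ 2 * weight s * decay_majorant s = u s ^+ 2 * (8748 * pi * weight s) / (1 + s ^+ 2).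
  by rewrite /decay_majorant; ring.
rewrite ler_pdivlMr // exprMn mulrAC mulrC ler_wpM2l ?sqr_ge0 //.
by apply: le_trans (pb s) (weight_lower s).
Qed.

End SinhBounds.

(** * Bounded solutions of the differential relation in t *)

Section BoundedSolutions.
Context {R : realType}.
Implicit Types (t x : R).

Lemma is_derive_sh t : is_derive t 1 (@sh R) (ch t).
Proof.
have d1 : is_derive t 1 (fun x : R => - x) (- 1) by apply: is_derive_eq.
have d2 := @is_derive1_comp R expR (fun x : R => - x) t _ _ (is_derive_expR _) d1.
have d3 := is_deriveZ 2^-1 (is_deriveB (is_derive_expR t) d2).
have -> : @sh R = 2^-1 \*: (expR - (expR \o (fun x : R => - x))).
  by apply/funext => x; rewrite /sh mulrC.
by apply: is_derive_eq d3 _; rewrite /GRing.scale /= /ch; ring.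
Qed.

(** With [P = A + i B], the function [E = |P|^2 / sinh^2] has as derivative [2 / sinh^3] times the
    expression assumed to vanish. So [E] is constant, while boundedness of [P] forces it to tend to
    0 at infinity. *)
Lemma bounded_wronskian_eq0 (A dA B dB : R -> R) (M : R) :
  (forall t, is_derive t 1 A (dA t)) -> (forall t, is_derive t 1 B (dB t)) ->
  (forall t, `|A t| <= M) -> (forall t, `|B t| <= M) ->
  (forall t, 0 < t -> A t * (sh t * dA t - ch t * A t) + B t * (sh t * dB t - ch t * B t) = 0) ->
  forall t, 0 < t -> A t = 0 /\ B t = 0.
Proof.
move=> hA hB MA MB W t t0.
have shp x : 0 < x -> 0 < sh x by move=> x0; have := sh_ge_half (ltW x0); lra.
pose E x := (A x * A x + B x * B x) * ((sh x)^-1 * (sh x)^-1).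
have dE x : 0 < x -> is_derive x 1 E 0.
  move=> x0; have s0 : sh x != 0 by rewrite gt_eqF ?shp.
  have dV := is_deriveV s0 (is_derive_sh x).
  have d := is_deriveM (is_deriveD (is_deriveM (hA x) (hA x)) (is_deriveM (hB x) (hB x)))
    (is_deriveM dV dV).
  apply: is_derive_eq d _; rewrite /GRing.scale /=.
  rewrite -[RHS](mulr0 (2 * (sh x)^-1 ^+ 3)) -[in RHS](W x x0).
  have -> : (A * A + B * B) x = A x * A x + B x * B x by [].
  have -> : ((fun y => (sh y)^-1) * (fun y => (sh y)^-1)) x = (sh x)^-1 * (sh x)^-1 by [].
  by field.
have Ecst y : t < y -> E y = E t.
  move=> ty; have dE' x : x \in `]t, y[ -> is_derive x 1 E 0.
    by rewrite in_itv /= => /andP[tx _]; apply: dE; lra.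
  have cE : {within `[t, y], continuous E}.
    apply: continuous_in_subspaceT => x /set_mem /=; rewrite in_itv /= => /andP[tx _].
    apply: differentiable_continuous; apply/derivable1_diffP.
    by have [] := dE x (lt_le_trans t0 tx).
  have [c _] := @MVT _ E (fun=> 0) t y ty dE' cE.
  by rewrite mul0r => /eqP; rewrite subr_eq0 => /eqP.
have Et0 : 0 <= E t by rewrite mulr_ge0 ?addr_ge0 // -expr2 sqr_ge0.
have Ele y : t < y -> 1 <= y -> E t * y <= 8 * M ^+ 2.
  move=> ty y1; rewrite -(Ecst y ty) /E; have y0 : 0 < y by lra.
  have sy := sh_ge_half (ltW y0); have sp := shp y y0.
  have n1 : A y * A y <= M ^+ 2 by rewrite -expr2 -real_normK ?num_real // lerXn2r ?nnegrE // (le_trans _ (MA y)).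
  have n2 : B y * B y <= M ^+ 2 by rewrite -expr2 -real_normK ?num_real // lerXn2r ?nnegrE // (le_trans _ (MB y)).
  have ss : 0 < sh y * sh y by exact: mulr_gt0.
  rewrite -invfM mulrAC ler_pdivrMr //.
  apply: (@le_trans _ _ (2 * M ^+ 2 * y)); first by rewrite ler_wpM2r ?(ltW y0) //; lra.
  have m0 := sqr_ge0 M.
  have : y <= 4 * (sh y * sh y) by nra.
  nra.
have E0 : E t = 0.
  apply/eqP; rewrite eq_le Et0 andbT leNgt; apply/negP => Ep.
  (* Far enough that [E t * z] exceeds the bound [8 * M ^+ 2] of [Ele]. *)
  pose z := 8 * M ^+ 2 / E t + t + 1.
  have q0 : 0 <= 8 * M ^+ 2 / E t by apply: divr_ge0 => //; rewrite mulr_ge0 ?sqr_ge0.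
  have ty : t < z by rewrite /z; lra.
  have y1 : 1 <= z by rewrite /z; lra.
  have := Ele z ty y1; rewrite /z !mulrDr mulrC divfK ?gt_eqF //.
  have := mulr_gt0 Ep t0; lra.
have sp := shp t t0.
have /eqP : E t * (sh t * sh t) = 0 by rewrite E0 mul0r.
have sn : sh t * sh t != 0 by rewrite mulf_eq0 negb_or gt_eqF.
rewrite /E -mulrA -invfM mulVf // mulr1 paddr_eq0 -?expr2 ?sqr_ge0 //.
by rewrite !sqrf_eq0 => /andP[/eqP -> /eqP ->].
Qed.

End BoundedSolutions.

(** * Sine transforms of elements of the weighted space *)

Section Moments.
Context {R : realType}.
Local Notation mu := (@lebesgue_measure R).
Implicit Types (s t : R).
Variable u : R -> R.
Hypothesis um : measurable_fun setT u.
Hypothesis u2 : mu.-integrable setT (EFin \o (fun s => u s ^+ 2 * weight s)).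

Lemma moment1_integrable : mu.-integrable setT (EFin \o (fun s => s * u s)).
Proof.
apply: (@moment_integrable R id) => // s; rewrite mulrDr mulr1 -exprD lerDl.
by rewrite exprn_even_ge0.
Qed.

Lemma moment2_integrable : mu.-integrable setT (EFin \o (fun s => s ^+ 2 * u s)).
Proof.
apply: (@moment_integrable R (fun s => s ^+ 2)) => // s.
by rewrite -exprM mulrDr mulr1 -exprD lerD2r lerDr sqr_ge0.
Qed.

Definition sine_transform t : R := \int[mu]_s (s * u s * sin (t * s)).
Definition cosine_moment t : R := \int[mu]_s (s * u s * (s * cos (t * s))).

Lemma measurable_sin_scale t : measurable_fun setT (fun s => sin (t * s)).
Proof.
apply: measurableT_comp; last exact: measurable_funM.
by apply: continuous_measurable_fun; exact: continuous_sin.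
Qed.

Lemma measurable_cos_scale t : measurable_fun setT (fun s => cos (t * s)).
Proof.
apply: measurableT_comp; last exact: measurable_funM.
by apply: continuous_measurable_fun; exact: continuous_cos.
Qed.

Lemma sine_integrable t : mu.-integrable setT (EFin \o (fun s => s * u s * sin (t * s))).
Proof.
exact: integrable_bounded_mul moment1_integrable (measurable_sin_scale t) (fun s => sin_max (t * s)).
Qed.

Lemma cosine_integrable t : mu.-integrable setT (EFin \o (fun s => s * u s * (s * cos (t * s)))).
Proof.
have := integrable_bounded_mul moment2_integrable (measurable_cos_scale t) (fun s => cos_max (t * s)).
by apply: eq_integrable => // s _ /=; congr EFin; ring.
Qed.

Lemma is_derive_sine_transform t : is_derive t 1 sine_transform (cosine_moment t).
Proof.
apply: (@is_derive_Rintegral _ (fun t s => s * u s * sin (t * s))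
  (fun t s => s * u s * (s * cos (t * s))) (fun s => `|s ^+ 2 * u s|) (t - 1) (t + 1)).
- by rewrite in_itv /=; apply/andP; split; lra.
- by move=> x _; exact: sine_integrable.
- move=> x s _; apply: (@is_deriveZ _ _ _ (fun x : R => sin (x * s)) (s * u s)).
  have d1 : is_derive x 1 (fun x : R => x * s) s.
    by apply: is_derive_eq; rewrite /GRing.scale /=; ring.
  have := @is_derive1_comp R sin (fun x : R => x * s) x _ _ (is_derive_sin _) d1.
  by rewrite mulrC.
- by have := integrable_abse moment2_integrable; apply: eq_integrable.
- move=> x s _; have -> : s * u s * (s * cos (x * s)) = s ^+ 2 * u s * cos (x * s) by ring.
  by rewrite normrM ler_piMr ?cos_max.
Qed.

Lemma sine_transform_bound t : `|sine_transform t| <= \int[mu]_s `|s * u s|.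
Proof.
apply: le_trans (le_normr_Rintegral _ _) _ => //; first exact: sine_integrable.
apply: le_Rintegral => //.
- by have := integrable_abse (sine_integrable t); apply: eq_integrable.
- by have := integrable_abse moment1_integrable; apply: eq_integrable.
- by move=> s _; rewrite normrM ler_piMr ?sin_max.
Qed.

(** Evenness of [u] makes [s u(s)] odd: its cosine integrals vanish, and its sine integrals are odd
    in [t], so positive [t] are enough for the uniqueness theorem. *)
Lemma sine_transform_eq0 : (forall s, u (- s) = u s) ->
  (forall t, 0 < t -> sine_transform t = 0) -> {ae mu, forall s, s * u s = 0}.
Proof.
move=> ue st0; apply: ae_eq0_of_fourier; first exact: moment1_integrable.
  move=> t; have [t0|t0|->] := ltgtP t 0; last 1 first.
  - by rewrite (_ : (fun s => _) = (fun=> 0)) ?Rintegral_cst ?mul0r //; apply/funext => s; rewrite mul0r sin0 mulr0.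
  - have E : sine_transform (- t) = -1 * \int[mu]_s (s * u s * sin (t * s)).
      rewrite -RintegralZl ?sine_integrable //; apply: eq_Rintegral => s _.
      by rewrite mulNr sinN; ring.
    have := st0 (- t); rewrite oppr_gt0 E => /(_ t0).
    by rewrite mulN1r => /eqP; rewrite oppr_eq0 => /eqP.
  - exact: st0.
move=> t; apply: Rintegral_odd.
  exact: integrable_bounded_mul moment1_integrable (measurable_cos_scale t) (fun s => cos_max (t * s)).
by move=> s; rewrite ue mulrN cosN; ring.
Qed.

End Moments.

(** * Vectors orthogonal to the test functions or to their defects *)

Section Defect.
Context {R : realType}.
Local Notation mu := (@lebesgue_measure R).
Local Notation RE z := (complex.Re z).
Local Notation IM z := (complex.Im z).
Implicit Types (s t : R).

Lemma weight0 : weight (0 : R) = 0.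
Proof. by rewrite /weight mulr0 mul0r. Qed.

Lemma sinh_pi_neq0 s : s != 0 -> (expR (pi * s) - expR (- (pi * s))) / 2 != 0.
Proof.
by move=> s0; have := weight_gt0 s0; rewrite /weight; case: eqVneq => // ->; rewrite mulr0 ltxx.
Qed.

Variable h : R -> R[i].
Hypothesis Hh : even_L2 h.

(* The inner product conjugates [h]. *)
Definition conj_re s : R := RE (h s).
Definition conj_im s : R := - IM (h s).

Lemma measurable_conj_re : measurable_fun setT conj_re.
Proof. by case: Hh => -[]. Qed.

Lemma measurable_conj_im : measurable_fun setT conj_im.
Proof. by case: Hh => -[_ mi] _ _; exact: measurableT_comp. Qed.

Lemma conj_re_integrable : mu.-integrable setT (EFin \o (fun s => conj_re s ^+ 2 * weight s)).
Proof.
apply: integrable_Rdom (even_L2_integrable Hh).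
  by apply: measurable_funM; [apply: measurable_funX; exact: measurable_conj_re|exact: measurable_weight].
move=> s; have w0 := weight_ge0 s; rewrite ger0_norm; last by apply: mulr_ge0 => //; exact: sqr_ge0.
by rewrite /weighted_sq sqr_normcE ler_wpM2r ?weight_ge0 // lerDl sqr_ge0.
Qed.

Lemma conj_im_integrable : mu.-integrable setT (EFin \o (fun s => conj_im s ^+ 2 * weight s)).
Proof.
apply: integrable_Rdom (even_L2_integrable Hh).
  by apply: measurable_funM; [apply: measurable_funX; exact: measurable_conj_im|exact: measurable_weight].
move=> s; have w0 := weight_ge0 s; rewrite ger0_norm; last by apply: mulr_ge0 => //; exact: sqr_ge0.
by rewrite /weighted_sq sqr_normcE ler_wpM2r ?weight_ge0 // sqrrN lerDr sqr_ge0.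
Qed.

(** The closed formulas for the test functions hold for [s != 0] only; at 0 both integrands vanish
    with the weight. *)
Lemma even_L2_inner_real (F : R -> R[i]) (g : R -> R) :
  (forall s, s != 0 -> F s = (g s)%:C%C) ->
  even_L2_inner F h =
  (2 / pi)%:C%C * Complex (\int[mu]_s (g s * weight s * conj_re s))
                          (\int[mu]_s (g s * weight s * conj_im s)).
Proof.
move=> Fg; rewrite /even_L2_inner /complex_integral; congr (_ * Complex _ _).
  apply: eq_Rintegral => s _; rewrite /conj_re; have [->|s0] := eqVneq s 0.
    by rewrite weight0; case: (F 0 * (h 0)^*%C) => x y /=; ring.
  by rewrite Fg //; case: (h s) => x y /=; ring.
apply: eq_Rintegral => s _; rewrite /conj_im; have [->|s0] := eqVneq s 0.
  by rewrite weight0; case: (F 0 * (h 0)^*%C) => x y /=; ring.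
by rewrite Fg //; case: (h s) => x y /=; ring.
Qed.

Lemma test_pairing (u : R -> R) t : measurable_fun setT u ->
  mu.-integrable setT (EFin \o (fun s => u s ^+ 2 * weight s)) ->
  \int[mu]_s ((s * cos (t * s) * sh t - sin (t * s) * ch t) /
    ((expR (pi * s) - expR (- (pi * s))) / 2) * weight s * u s) =
  pi^-1 * (sh t * cosine_moment u t - ch t * sine_transform u t).
Proof.
move=> um u2; have ic := cosine_integrable um u2 t; have si := sine_integrable um u2 t.
rewrite /cosine_moment /sine_transform -!RintegralZl //.
rewrite -RintegralB //; [|exact: integrable_RZ..].
rewrite -RintegralZl //; last by apply: integrable_RB; exact: integrable_RZ.
apply: eq_Rintegral => s _; have [->|s0] := eqVneq s 0; first by rewrite weight0; ring.
have := sinh_pi_neq0 s0; rewrite /weight; move: (pi^-1) (_ / 2) => p S S0.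
by field.
Qed.

Lemma opL_test_pairing (u : R -> R) t : measurable_fun setT u ->
  mu.-integrable setT (EFin \o (fun s => u s ^+ 2 * weight s)) ->
  \int[mu]_s (2 * sh t ^+ 2 * sin (t * s) /
    ((expR (pi * s) - expR (- (pi * s))) / 2) * weight s * u s) =
  pi^-1 * (2 * sh t ^+ 2 * sine_transform u t).
Proof.
move=> um u2; have si := sine_integrable um u2 t.
rewrite /sine_transform -!RintegralZl //; last exact: integrable_RZ.
apply: eq_Rintegral => s _; have [->|s0] := eqVneq s 0; first by rewrite weight0; ring.
have := sinh_pi_neq0 s0; rewrite /weight; move: (pi^-1) (_ / 2) => p S S0.
by field.
Qed.

Local Notation A := (sine_transform conj_re).
Local Notation B := (sine_transform conj_im).
Local Notation dA := (cosine_moment conj_re).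
Local Notation dB := (cosine_moment conj_im).

Lemma inner_test_fun t :
  even_L2_inner (restrict_line (test_fun t)) h = (2 / pi)%:C%C * (pi^-1)%:C%C *
    Complex (sh t * dA t - ch t * A t) (sh t * dB t - ch t * B t).
Proof.
rewrite (even_L2_inner_real (@test_fun_line _ t)) -mulrA.
rewrite !test_pairing //; [|exact: measurable_conj_im|exact: conj_im_integrable
  |exact: measurable_conj_re|exact: conj_re_integrable].
by congr (_ * _); congr Complex => /=; ring.
Qed.

Lemma inner_opL_test_fun t :
  even_L2_inner (opL (test_fun t)) h = (2 / pi)%:C%C * (pi^-1)%:C%C *
    Complex (2 * sh t ^+ 2 * A t) (2 * sh t ^+ 2 * B t).
Proof.
rewrite (even_L2_inner_real (@opL_test_fun _ t)) -mulrA.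
rewrite !opL_test_pairing //; [|exact: measurable_conj_im|exact: conj_im_integrable
  |exact: measurable_conj_re|exact: conj_re_integrable].
by congr (_ * _); congr Complex => /=; ring.
Qed.

(** The hypothesis is the vanishing real part of conj(P) (P' sinh t - P cosh t) for [P = A + i B].
    It gives [P = 0] for positive [t], hence [s h(s) = 0] almost everywhere, and at [s = 0] the
    weight vanishes. *)
Lemma norm_eq0_of_wronskian :
  (forall t, 0 < t -> A t * (sh t * dA t - ch t * A t) + B t * (sh t * dB t - ch t * B t) = 0) ->
  ip_norm (@even_L2_inner R) h = 0.
Proof.
move=> W; have [hm he _] := Hh.
pose M := Num.max (\int[mu]_s `|s * conj_re s|) (\int[mu]_s `|s * conj_im s|).
have bA t : `|A t| <= M.
  rewrite le_max; apply/orP; left.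
  exact: (sine_transform_bound measurable_conj_re conj_re_integrable).
have bB t : `|B t| <= M.
  rewrite le_max; apply/orP; right.
  exact: (sine_transform_bound measurable_conj_im conj_im_integrable).
have AB := bounded_wronskian_eq0
  (is_derive_sine_transform measurable_conj_re conj_re_integrable)
  (is_derive_sine_transform measurable_conj_im conj_im_integrable) bA bB W.
have re0 : {ae mu, forall s, s * conj_re s = 0}.
  apply: sine_transform_eq0 measurable_conj_re conj_re_integrable _ _.
    by move=> s; rewrite /conj_re he.
  by move=> t /AB [].
have im0 : {ae mu, forall s, s * conj_im s = 0}.
  apply: sine_transform_eq0 measurable_conj_im conj_im_integrable _ _.
    by move=> s; rewrite /conj_im he.
  by move=> t /AB [].
have ae0 : (\int[mu]_s (weighted_sq h s)%:E = 0)%E.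
  rewrite -(integral0 mu setT); apply: ae_eq_integral => //.
    by apply/measurable_EFinP; exact: measurable_weighted_sq.
  apply: (@filterS2 _ _ (ae_filter_ringOfSetsType mu)) re0 im0 => s + + _ /=.
  rewrite /conj_re /conj_im /weighted_sq sqr_normcE; have [->|s0] := eqVneq s 0.
    by rewrite weight0 mulr0.
  move=> /eqP; rewrite mulf_eq0 (negbTE s0) /= => /eqP ->.
  move=> /eqP; rewrite mulf_eq0 (negbTE s0) /= oppr_eq0 => /eqP ->.
  by rewrite expr0n /= addr0 mul0r.
have := even_L2_normE Hh; rewrite ae0 => -[] /esym/eqP.
have p2 : pi / 2 != 0 :> R by rewrite gt_eqF // divr_gt0 ?pi_gt0.
by rewrite mulf_eq0 (negbTE p2) /= sqrf_eq0 => /eqP.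
Qed.

Lemma inner_scale_neq0 : (2 / pi)%:C%C * (pi^-1)%:C%C != 0 :> R[i].
Proof.
by rewrite -rmorphM eq_complex /= eqxx andbT gt_eqF // mulr_gt0 ?divr_gt0 ?invr_gt0 ?pi_gt0.
Qed.

Lemma graph_L_dense :
  (forall f g, graph_L (f, g) -> even_L2_inner f h = 0) -> ip_norm (@even_L2_inner R) h = 0.
Proof.
move=> orth; apply: norm_eq0_of_wronskian => t t0.
have Gt : graph_L (restrict_line (test_fun t), opL (test_fun t)).
  by exists (test_fun t) => //; exact: test_fun_domain.
have /eqP := orth _ _ Gt; rewrite inner_test_fun mulf_eq0 (negbTE inner_scale_neq0) /=.
by rewrite eq_complex /= => /andP[/eqP -> /eqP ->]; rewrite !mulr0 addr0.
Qed.

Lemma graph_L_defect (l : R[i]) : l = 'i%C \/ l = - 'i%C ->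
  (forall f g, graph_L (f, g) -> even_L2_inner (g - l *: f) h = 0) ->
  ip_norm (@even_L2_inner R) h = 0.
Proof.
move=> li orth; apply: norm_eq0_of_wronskian => t t0.
have Dt := test_fun_domain t0.
have Gt : graph_L (restrict_line (test_fun t), opL (test_fun t)) by exists (test_fun t).
have := orth _ _ Gt.
have Hf := restrict_line_L2 Dt; have Hg := opL_L2 Dt.
rewrite (ipBl even_L2_semi_inner) //; last exact: (shZ even_L2_semi_inner).
rewrite (ipZl even_L2_semi_inner) // inner_test_fun inner_opL_test_fun.
rewrite [l * _]mulrCA -mulrBr => /eqP; rewrite mulf_eq0 (negbTE inner_scale_neq0) /=.
move: (sh t * dA t - ch t * A t) (sh t * dB t - ch t * B t) => X Y.
move: (2 * sh t ^+ 2) (A t) (B t) => c a b.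
(* Multiplication by [l] rotates by a right angle: [(X, Y)] is [c * (b, - a)] or its opposite, hence
   orthogonal to [(a, b)]. *)
case: li => ->; rewrite eq_complex /= => /andP[/eqP e1 /eqP e2].
- have -> : X = c * b by lra.
  have -> : Y = - (c * a) by lra.
  by ring.
- have -> : X = - (c * b) by lra.
  have -> : Y = c * a by lra.
  by ring.
Qed.

End Defect.

Theorem lemma3p1 (R : realType) :
  essentially_selfadjoint (@even_L2 R) (@even_L2_inner R) (@graph_L R).
Proof.
apply: essentially_selfadjoint_of_defect.
- exact: even_L2_semi_inner.
- exact: even_L2_complete.
- exact: graph_L_L2.
- exact: graph_L0.
- exact: graph_L_lin.
- exact: graph_L_symmetric.
- exact: graph_L_dense.
- by move=> l li h Hh; exact: graph_L_defect.
Qed.
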